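(* Let $\mathfrak m=\mathfrak g_{-s}\oplus\dots\oplus\mathfrak g_{-1}$ be a fundamental graded nilpotent Lie algebra over $\mathbb R$ or $\mathbb C$, and let $n=\dim\mathfrak g_{-1}$. Assume that $\mathfrak m$ is different from (not isomorphic, as a graded Lie algebra, to) the negative part $\mathfrak m_I$ of the grading associated with the parabolic subalgebra $\mathfrak p_1$ of $G_2$, and from the negative part of the grading associated with the parabolic subalgebra $\mathfrak p_r$ of $B_r$ for any $r\geq 2$. If $\mathfrak m$ is sub-free, i.e. $\mathfrak{der}_0(\mathfrak m)=\mathfrak{gl}(\mathfrak g_{-1})\cong\mathfrak{gl}(n)$, then $\mathfrak m$ is prolongation rigid: $\mathrm{pr}_+(\mathfrak m)=0$.
   Context: The ground field is $\mathbb R$ or $\mathbb C$. A finite-dimensional graded nilpotent Lie algebra (GNLA) $\mathfrak m=\mathfrak g_{-s}\oplus\dots\oplus\mathfrak g_{-1}$ (with $[\mathfrak g_{-i},\mathfrak g_{-j}]\subset\mathfrak g_{-i-j}$) is called fundamental if $\mathfrak g_{-1}$ generates $\mathfrak m$ as a Lie algebra and $\mathfrak z(\mathfrak m)\cap\mathfrak g_{-1}=0$, where $\mathfrak z(\mathfrak m)$ is the center; in particular $s>1$ when $\mathfrak m\ne0$. Here $s$ is the depth ($\mathfrak g_{-s}\neq0$). $\mathfrak{der}_0(\mathfrak m)$ denotes the Lie algebra of grading-preserving derivations of $\mathfrak m$; since $\mathfrak g_{-1}$ generates $\mathfrak m$, restriction to $\mathfrak g_{-1}$ embeds it in $\mathfrak{gl}(\mathfrak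 g_{-1})$. $\mathfrak m$ is called sub-free if this embedding is onto. The Tanaka prolongation $\mathrm{pr}(\mathfrak m)=\bigoplus_{k\ge -s}\mathfrak g_k$ is the maximal graded Lie algebra whose negative part is $\bigoplus_{k<0}\mathfrak g_k=\mathfrak m$ and such that, for every $x\in\mathfrak g_k$ with $k\ge0$, $[\mathfrak g_{-1},x]=0$ implies $x=0$. It satisfies $\mathfrak g_0=\mathfrak{der}_0(\mathfrak m)$. Put $\mathrm{pr}_+(\mathfrak m)=\bigoplus_{k>0}\mathfrak g_k$. For a simple Lie algebra $\mathfrak g$, a parabolic subalgebra $\mathfrak p$ is the nonnegative part $\mathfrak g_0\oplus\mathfrak g_+$ of a $\mathbb Z$-grading of $\mathfrak g$. Over $\mathbb C$, $\mathfrak p_I$ denotes the parabolic given by crossing the nodes $I$ of the Dynkin diagram (Bourbaki numbering), i.e. for the grading in which the simple root $\alpha_i$ has degree $1$ if $i\in I$ and $0$ otherwise; over $\mathbb R$ the same applies with the Satake diagram, where black nodes cannot be crossed and nodes joined by an arrow must be crossed simultaneously. $\mathfrak m_I=\mathfrak g_-$ is the sum of the components of negative degree of this grading, so $\mathfrak g=\mathfrak m_I\oplus\mathfrak p_I$. In Bourbaki numbering $\alpha_1$ is the short simple root of $G_2$ and $\alpha_r$ is the short simple root of $B_r$. The corresponding $\mathfrak m_I$ have graded dimensions $(\dim\mathfrak g_{-1},\dim\mathfrak g_{-2},\dots)$ equal to $(2,1,2)$ for $(G_2,\mathfrak p_1)$ and $\bigl(r,\binom r2\bigr)$ for $(B_r,\mathfrak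 p_r)$. *)

(* Defs.v *)
From HB Require Import structures.
From mathcomp Require Import all_boot all_order all_algebra.
From mathcomp Require Import classical_sets reals.
From mathcomp Require Import complex.
Set Implicit Arguments.
Unset Strict Implicit.
Unset Printing Implicit Defensive.
Import Order.TTheory GRing.Theory Num.Theory.
Local Open Scope classical_set_scope.
Local Open Scope ring_scope.

HB.mixin Record Lmodule_isLieAlgebra (K : fieldType) L of GRing.Lmodule K L := {
  lie : L -> L -> L;
  lie_linearl : forall (a : K) (x y z : L),
    lie (a *: x + y) z = a *: lie x z + lie y z;
  lie_linearr : forall (a : K) (x y z : L),
    lie z (a *: x + y) = a *: lie z x + lie z y;
  liexx : forall x : L, lie x x = 0;
  lie_jacobi : forall x y z : L,
    lie x (lie y z) + lie y (lie z x) + lie z (lie x y) = 0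
}.

(* No finiteness assumption: Tanaka prolongations may be infinite-dimensional. *)
#[short(type="lieAlgType")]
HB.structure Definition LieAlgebra (K : fieldType) :=
  { L of GRing.Lmodule K L & Lmodule_isLieAlgebra K L }.

#[short(type="finLieAlgType")]
HB.structure Definition FinLieAlgebra (K : fieldType) :=
  { L of Vector K L & Lmodule_isLieAlgebra K L }.

Notation "[ 'lie' x , y ]" := (lie x y)
  (at level 0, x, y at level 99, format "[ 'lie'  x ,  y ]") : ring_scope.

Section LieAlgebras.
Variables (K : fieldType) (L : lieAlgType K).

Definition subspace (S : set L) : Prop :=
  S 0 /\ forall (a : K) x y, S x -> S y -> S (a *: x + y).

Definition lie_subalgebra (S : set L) : Prop :=
  subspace S /\ forall x y, S x -> S y -> S [lie x, y].

Definition lie_ideal (S : set L) : Prop :=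
  subspace S /\ forall x y, S y -> S [lie x, y].

Definition lie_generates (X : set L) : Prop :=
  forall S : set L, lie_subalgebra S -> X `<=` S -> S = setT.

Definition lie_center : set L := [set x | forall y, [lie x, y] = 0].

Definition lie_simple : Prop :=
  (exists x y : L, [lie x, y] != 0) /\
  forall S : set L, lie_ideal S -> S = [set 0] \/ S = setT.

Record grading := Grading {
  component :> int -> set L;
  component_subspace : forall k, subspace (component k);
  component_span : forall x : L, exists (s : seq int) (u : int -> L),
    (forall k, component k (u k)) /\ x = \sum_(k <- s) u k;
  component_indep : forall (s : seq int) (u : int -> L), uniq s ->
    (forall k, component k (u k)) -> \sum_(k <- s) u k = 0 ->
    forall k, k \in s -> u k = 0;
  component_lie : forall i j x y,
    component i x -> component j y -> component (i + j) [lie x, y]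
}.

End LieAlgebras.
Arguments lie_center {K} L.

Definition lie_morphism (K : fieldType) (L L' : lieAlgType K) (f : L -> L') :=
  forall x y, f [lie x, y] = [lie f x, f y].

(* [f] identifies [L], when it is negatively graded, with the negative part
   of [L'] as a graded Lie algebra. *)
Definition onto_negative_part (K : fieldType) (L L' : lieAlgType K)
    (gL : grading L) (gL' : grading L') (f : {linear L -> L'}) : Prop :=
  [/\ lie_morphism f, injective f & forall k : int, k < 0 -> f @` gL k = gL' k].

Section GNLA.
Variables (K : fieldType) (m : finLieAlgType K) (gm : grading m).

(* Nilpotency is automatic from the bounds on the degrees; the zero algebra is
   allowed, with any [s]. *)
Definition gnla (s : nat) : Prop :=
  (forall k x, gm k x -> x != 0 -> - s%:Z <= k <= -1) /\
  ((exists x : m, x != 0) -> exists2 x, gm (- s%:Z) x & x != 0).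

Definition fundamental : Prop :=
  lie_generates (gm (-1)) /\ lie_center m `&` gm (-1) = [set 0].

Definition derivation (D : 'End(m)) : Prop :=
  forall x y, D [lie x, y] = [lie D x, y] + [lie x, D y].

Definition der0 : set 'End(m) :=
  [set D | derivation D /\ forall k x, gm k x -> gm k (D x)].

(* An element of gl(g_{-1}) is given by any linear extension to [m]. *)
Definition sub_free : Prop :=
  forall A : 'End(m), (forall x, gm (-1) x -> gm (-1) (A x)) ->
  exists2 D, der0 D & forall x, gm (-1) x -> D x = A x.

Definition transitive_extension (G : lieAlgType K) (gG : grading G)
    (iota : {linear m -> G}) : Prop :=
  onto_negative_part gm gG iota /\
  forall (k : int) x, 0 <= k -> gG k x ->
    (forall y, gG (-1) y -> [lie y, x] = 0) -> x = 0.

(* Maximality: every graded Lie algebra with these properties embeds in [G]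
   over [m]. *)
Definition tanaka_prolongation (G : lieAlgType K) (gG : grading G)
    (iota : {linear m -> G}) : Prop :=
  transitive_extension gG iota /\
  forall (G' : lieAlgType K) (gG' : grading G') (iota' : {linear m -> G'}),
    transitive_extension gG' iota' ->
    exists psi : {linear G' -> G},
      [/\ lie_morphism psi, injective psi,
          forall k x, gG' k x -> gG k (psi x)
        & forall x, psi (iota' x) = iota x].

(* The prolongation is unique up to a graded isomorphism over [m], so this
   existential also yields the conclusion for every prolongation. *)
Definition prolongation_rigid : Prop :=
  exists (G : lieAlgType K) (gG : grading G) (iota : {linear m -> G}),
    tanaka_prolongation gG iota /\ forall k : int, 0 < k -> gG k = [set 0].

End GNLA.

(* Cartan matrices in Bourbaki's convention: the (i, j) entry is
   <alpha_i, alpha_j^vee>, rows and columns being numbered from 0. *)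
Definition cartan_G2 : 'M[int]_2 :=
  \matrix_(i, j) (if i == j then 2 else if (i < j)%N then -1 else -3).

Definition cartan_B (r : nat) : 'M[int]_r :=
  \matrix_(i, j)
    (if i == j then 2
     else if j == i.+1 :> nat then (if j.+1 == r then -2 else -1)
     else if i == j.+1 :> nat then -1 else 0).

(* When [L] is simple, and [A] is the Cartan matrix of an irreducible root
   system, this makes [L] the split simple Lie algebra with Cartan matrix [A],
   with Chevalley generators [e], [f] and coroots [lie e i, f i]; the Serre
   relations follow from simplicity. *)
Definition chevalley_generators (K : fieldType) (L : lieAlgType K) (r : nat)
    (A : 'M[int]_r) (e f : 'I_r -> L) : Prop :=
  let h i := [lie e i, f i] in
  [/\ lie_generates (range e `|` range f),
      forall i j, [lie h i, h j] = 0,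
      forall i j, i != j -> [lie e i, f j] = 0,
      forall i j, [lie h j, e i] = (A i j)%:~R *: e i
    & forall i j, [lie h j, f i] = - (A i j)%:~R *: f i].

(* The grading of the parabolic p_k, where only node [k] (numbered from 1) is
   crossed.  Over the reals only the split form is considered: a real form of
   G_2 or of B_r whose Satake diagram has a white node 1, respectively r, is
   split. *)
Definition maximal_parabolic_grading (K : fieldType) (L : lieAlgType K)
    (r : nat) (A : 'M[int]_r) (k : nat) (gL : grading L) : Prop :=
  lie_simple L /\
  exists e f : 'I_r -> L, chevalley_generators A e f /\
    forall i : 'I_r, let d := (i.+1 == k)%:Z in
      gL d (e i) /\ gL (- d) (f i).

Definition is_parabolic_negative_part (K : fieldType) (m : finLieAlgType K)
    (gm : grading m) (r : nat) (A : 'M[int]_r) (k : nat) : Prop :=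
  exists (L : finLieAlgType K) (gL : grading L) (phi : {linear m -> L}),
    maximal_parabolic_grading A k gL /\ onto_negative_part gm gL phi.

(* Main.v *)
Require Import Defs.
From HB Require Import structures.
From mathcomp Require Import all_boot all_order all_algebra.
From mathcomp Require Import classical_sets reals.
From mathcomp Require Import complex.
From mathcomp Require Import boolp ring zify.
Set Implicit Arguments.
Unset Strict Implicit.
Unset Printing Implicit Defensive.
Import Order.TTheory GRing.Theory Num.Theory VectorInternalTheory.
Local Open Scope ring_scope.

(** Let [V = g_{-1}], of dimension [n]. Sub-freeness makes [gl(V)] act on [m] by
    derivations, so [m] is spanned by weight vectors, with weights [a] in [N^n]
    whose total is the degree. The elements of degree one of the prolongation
    are tensors in [V^* (x) gl(V)] and form a [gl(V)]-module; if this module is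
    not zero, it contains one of three families of elements [f] of weight
    [- l], for every index [l], such that [[f, e_l]] is a diagonal matrix [d].
    The [sl_2]-string argument for [e_l] and [f] shows that a vector [w] of
    weight [a] with [f [e_l, w] = 0] satisfies [2 sum_i d_i a_i = t d_l] for
    some integer [0 <= t <= a_l]. By downward induction on [k], the family kills
    the degree [k]: the string identities leave only weights with all
    coordinates equal; such a [w] is [sl(V)]-invariant, and then [f w], whose
    weight is not of this kind, is killed by the brackets with [V] because the
    trace of [d] is zero (a second string is needed for this in one of the three
    cases), and hence vanishes. At degree 3 ([n >= 3]) or 4 ([n = 2]) this forces [m] to have
    depth 2, or depth 3 with [n = 2], so that [m] is the negative part for
    [B_n] or for [G_2]. Otherwise the degree one part vanishes, so transitivity
    kills all positive degrees and the prolongation is the semidirect product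
    of [m] and [gl(V)]. *)

(** The three families reflect the decomposition of $V^{*}\otimes\mathfrak{gl}(V)$ into the
    trace-free part of $S^2V^{*}\otimes V$, the trace-free part of $\Lambda^2V^{*}\otimes V$, and
    two copies of $V^{*}$. The two copies are isomorphic, so a submodule can lie diagonally between
    them. The third family therefore carries an unknown ratio $p:q$, and it is the hard case:
    strings must first show that $P=2p/(p+q)$ is an integer. Complete reducibility is not invoked; a
    nonzero tensor is moved by matrix units until one extremal vector is isolated, and if this never
    succeeds the tensor has the third form. The third family does occur: for $B_n$ and for $G_2$ the
    degree one part is $V^{*}$. There the nonconstant weights $\epsilon_i+\epsilon_j$ (degree 2,
    $n\ge3$) and $(2,1)$ (degree 3, $n=2$) survive. The descent thus cannot reach below degree 3, or
    degree 4 when $n=2$, and the string inequalities must separate exactly these cases. *)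

Section Coordinates.
Variables (K : fieldType) (V : vectType K).
Implicit Types (x y : V) (i : 'I_(dim V)).

Definition vcoord i x : K := v2r x 0 i.

Lemma vcoord_inj x y : (forall i, vcoord i x = vcoord i y) -> x = y.
Proof. by move=> xy; apply: (can_inj v2rK); apply/rowP. Qed.

Lemma vcoordD i x y : vcoord i (x + y) = vcoord i x + vcoord i y.
Proof. by rewrite /vcoord linearD mxE. Qed.

Lemma vcoordZ i a x : vcoord i (a *: x) = a * vcoord i x.
Proof. by rewrite /vcoord linearZ mxE. Qed.

Lemma vcoordN i x : vcoord i (- x) = - vcoord i x.
Proof. by rewrite -scaleN1r vcoordZ mulN1r. Qed.

Lemma vcoord0 i : vcoord i (0 : V) = 0.
Proof. by rewrite -[0](scale0r (0 : V)) vcoordZ mul0r. Qed.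

Lemma vcoordMn i x k : vcoord i (x *+ k) = vcoord i x *+ k.
Proof. by rewrite -scaler_nat vcoordZ mulr_natl. Qed.

End Coordinates.

(** An identity between linear combinations of vectors becomes a ring identity in an arbitrary
    coordinate. *)
Ltac linear_arith :=
  apply: vcoord_inj => ?; rewrite ?(vcoordD, vcoordZ, vcoordN, vcoord0, vcoordMn);
  ring.

(** * Elementary identities in a Lie algebra *)

Section LieTheory.
Variables (K : fieldType) (L : lieAlgType K).
Implicit Types (x y z : L) (a : K).

Lemma lieDl x y z : [lie x + y, z] = [lie x, z] + [lie y, z].
Proof. by have := lie_linearl 1 x y z; rewrite !scale1r. Qed.

Lemma lieDr x y z : [lie z, x + y] = [lie z, x] + [lie z, y].
Proof. by have := lie_linearr 1 x y z; rewrite !scale1r. Qed.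

Lemma lie0l z : [lie 0, z] = 0 :> L.
Proof. by apply: (addrI [lie 0, z]); rewrite -lieDl !addr0. Qed.

Lemma lie0r z : [lie z, 0] = 0 :> L.
Proof. by apply: (addrI [lie z, 0]); rewrite -lieDr !addr0. Qed.

Lemma lieZl a x z : [lie a *: x, z] = a *: [lie x, z].
Proof. by have := lie_linearl a x 0 z; rewrite lie0l !addr0. Qed.

Lemma lieZr a x z : [lie z, a *: x] = a *: [lie z, x].
Proof. by have := lie_linearr a x 0 z; rewrite lie0r !addr0. Qed.

Lemma lieNl x z : [lie - x, z] = - [lie x, z].
Proof. by rewrite -scaleN1r lieZl scaleN1r. Qed.

Lemma lieNr x z : [lie z, - x] = - [lie z, x].
Proof. by rewrite -scaleN1r lieZr scaleN1r. Qed.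

Lemma lieBl x y z : [lie x - y, z] = [lie x, z] - [lie y, z].
Proof. by rewrite lieDl lieNl. Qed.

Lemma lieBr x y z : [lie z, x - y] = [lie z, x] - [lie z, y].
Proof. by rewrite lieDr lieNr. Qed.

Lemma lie_suml I (r : seq I) (P : pred I) (F : I -> L) z :
  [lie \sum_(i <- r | P i) F i, z] = \sum_(i <- r | P i) [lie F i, z].
Proof. by apply: (big_morph (fun x => [lie x, z]) (fun x y => lieDl x y z) (lie0l z)). Qed.

Lemma lie_sumr I (r : seq I) (P : pred I) (F : I -> L) z :
  [lie z, \sum_(i <- r | P i) F i] = \sum_(i <- r | P i) [lie z, F i].
Proof. by apply: (big_morph (fun x => [lie z, x]) (fun x y => lieDr x y z) (lie0r z)). Qed.

Lemma lieC x y : [lie x, y] = - [lie y, x].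
Proof.
apply/eqP; rewrite -addr_eq0; apply/eqP.
by have := liexx (x + y); rewrite lieDl !lieDr !liexx add0r addr0.
Qed.

Lemma lie_leibniz x y z :
  [lie x, [lie y, z]] = [lie [lie x, y], z] + [lie y, [lie x, z]].
Proof.
have := lie_jacobi x y z; rewrite (lieC z [lie x, y]) (lieC z x) lieNr.
by rewrite -addrA -opprD => /subr0_eq ->; rewrite addrC.
Qed.

Lemma lie_leibnizl x y z :
  [lie [lie x, y], z] = [lie x, [lie y, z]] - [lie y, [lie x, z]].
Proof. by rewrite (lie_leibniz x y z) addrK. Qed.

End LieTheory.

(** * Frames and weights *)

(** Sub-freeness provides one derivation for each matrix, chosen separately, so neither linearity in
    the matrix nor compatibility with commutators can be a field. Both follow, because a derivation
    is determined by its values on generators. [frame_ind] says that right-normed brackets of the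
    [vec i] span [m]. *)
Record frame (K : fieldType) (m : finLieAlgType K) (n : nat) := Frame {
  act : 'M[K]_n -> 'End(m);
  vec : 'I_n -> m;
  act_lie : forall A x y,
    act A [lie x, y] = [lie act A x, y] + [lie x, act A y];
  act_vec : forall A i, act A (vec i) = \sum_j A j i *: vec j;
  frame_ind : forall S : m -> Prop,
    S 0 -> (forall a x y, S x -> S y -> S (a *: x + y)) ->
    (forall i, S (vec i)) -> (forall i x, S x -> S [lie vec i, x]) ->
    forall x, S x
}.

Section FrameTheory.
Variables (K : fieldType) (m : finLieAlgType K) (n : nat) (F : frame m n).
Implicit Types (A B : 'M[K]_n) (x y : m) (i j k : 'I_n).
Local Notation e := (vec F).
Local Notation "A ∙ x" := (act F A x) (at level 35, right associativity).

Lemma actP A b x y : A ∙ (b *: x + y) = b *: (A ∙ x) + A ∙ y.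
Proof. exact: linearP. Qed.

Definition act_at x A := A ∙ x.

(** Both sides are derivations in [x] that agree on the generators, so they agree everywhere. *)
Lemma act_at_is_linear x : linear (act_at x).
Proof.
rewrite /act_at => a A B; move: x; apply: (@frame_ind _ _ _ F).
- by rewrite !linear0 addr0.
- by move=> b x y IHx IHy; rewrite !actP IHx IHy; linear_arith.
- move=> i; rewrite !act_vec scaler_sumr -big_split /=.
  by apply: eq_bigr => j _; rewrite !mxE; linear_arith.
- move=> i x IH; rewrite !act_lie IH !act_vec.
  have -> : \sum_j (a *: A + B) j i *: e j =
      a *: (\sum_j A j i *: e j) + \sum_j B j i *: e j.
    rewrite scaler_sumr -big_split /=.
    by apply: eq_bigr => j _; rewrite !mxE; linear_arith.
  by rewrite lieDl lieZl lieDr lieZr; linear_arith.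
Qed.

HB.instance Definition _ x :=
  GRing.isLinear.Build K 'M[K]_n m _ (act_at x) (act_at_is_linear x).

Lemma actD A B x : (A + B) ∙ x = A ∙ x + B ∙ x.
Proof. exact: (linearD (act_at x)). Qed.

Lemma actB A B x : (A - B) ∙ x = A ∙ x - B ∙ x.
Proof. exact: (linearB (act_at x)). Qed.

Lemma actZ a A x : (a *: A) ∙ x = a *: (A ∙ x).
Proof. by rewrite -!/(act_at x _) linearZ. Qed.

Lemma act0 x : 0 ∙ x = 0.
Proof. exact: (linear0 (act_at x)). Qed.

Lemma act_sum I (r : seq I) (P : pred I) (f : I -> 'M[K]_n) x :
  (\sum_(i <- r | P i) f i) ∙ x = \sum_(i <- r | P i) f i ∙ x.
Proof. exact: (linear_sum (act_at x)). Qed.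

Lemma act_comm A B x : (A *m B - B *m A) ∙ x = A ∙ B ∙ x - B ∙ A ∙ x.
Proof.
(* On generators the action is matrix multiplication; the commutator identity then propagates to
   brackets, both sides being derivations. *)
have on_vec A' B' i : A' ∙ B' ∙ e i = (A' *m B') ∙ e i.
  rewrite !act_vec linear_sum /=.
  under eq_bigr => j _ do rewrite linearZ /= act_vec scaler_sumr.
  rewrite exchange_big; apply: eq_bigr => k _; rewrite mxE scaler_suml.
  by apply: eq_bigr => j _; rewrite scalerA mulrC.
move: x; apply: (@frame_ind _ _ _ F).
- by rewrite !linear0 addr0.
- by move=> b x y IHx IHy; rewrite !actP IHx IHy; linear_arith.
- by move=> i; rewrite actB !on_vec.
- move=> i x IH; rewrite !act_lie IH !linearD /= !act_lie.
  by rewrite actB -!on_vec lieBl lieBr; linear_arith.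
Qed.

Lemma act_delta_vec i j k : delta_mx i j ∙ e k = (j == k)%:R *: e i.
Proof.
rewrite act_vec (bigD1 i) //= mxE eqxx eq_sym big1 ?addr0 // => l /negPf li.
by rewrite mxE li scale0r.
Qed.

Definition mono (t : seq 'I_n) i : m := foldr (fun j v => [lie e j, v]) (e i) t.

Lemma mono_ind (S : m -> Prop) : S 0 ->
  (forall a x y, S x -> S y -> S (a *: x + y)) ->
  (forall t i, S (mono t i)) -> forall x, S x.
Proof.
move=> S0 SD Sm x.
(* The claim is generalized to all prefixes of brackets around [x], so that a new innermost bracket
   is absorbed by [rcons]. *)
suff H t : S (foldr (fun j v => [lie e j, v]) x t) by exact: (H [::]).
move: x t; apply: (@frame_ind _ _ _ F) => [|a x y IHx IHy|i|i x IH] t.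
- have -> : foldr (fun j v => [lie e j, v]) 0 t = 0 :> m.
    by elim: t => //= j t ->; rewrite lie0r.
  exact: S0.
- have -> : foldr (fun j v => [lie e j, v]) (a *: x + y) t =
    a *: foldr (fun j v => [lie e j, v]) x t
      + foldr (fun j v => [lie e j, v]) y t.
    by elim: t => //= j t ->; rewrite lieDr lieZr.
  exact: SD.
- exact: Sm.
- by have := IH (rcons t i); rewrite foldr_rcons.
Qed.

Lemma mono_weight k t i :
  delta_mx k k ∙ mono t i = (count_mem k (i :: t))%:R *: mono t i.
Proof.
elim: t => [|j t IH] /=; first by rewrite act_delta_vec eq_sym addn0; case: eqP => [->|_] //; rewrite !scale0r.
rewrite act_lie {}IH /= act_delta_vec lieZl lieZr !natrD (eq_sym k j).
by case: (eqVneq j k) => [->|_] /=; linear_arith.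
Qed.

Lemma act1_vec i : 1%:M ∙ e i = e i.
Proof.
rewrite act_vec (bigD1 i) //= mxE eqxx scale1r big1 ?addr0 // => l /negPf li.
by rewrite mxE li scale0r.
Qed.

Lemma mono_degree t i : 1%:M ∙ mono t i = (size t).+1%:R *: mono t i.
Proof.
elim: t => [|j t IH] /=; first by rewrite act1_vec scale1r.
by rewrite act_lie {}IH act1_vec lieZr -[in RHS]natr1; linear_arith.
Qed.

(* The monomials span, so a product of factors [X - c], with [c] a monomial
   eigenvalue, kills any given vector. *)
Lemma eigenvalue_mono (X : 'End(m)) (C : K -> Prop) c w :
  (forall t i, exists2 b, X (mono t i) = b *: mono t i
     & mono t i != 0 -> C b) ->
  X w = c *: w -> w != 0 -> C c.
Proof.
move=> monoC; pose kill (s : seq K) v := foldr (fun c u => X u - c *: u) v s.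
have killD s a x y : kill s (a *: x + y) = a *: kill s x + kill s y.
  elim: s => //= b s ->; rewrite linearP; linear_arith.
have kill0 s : kill s 0 = 0.
  by elim: s => //= b s ->; rewrite linear0; linear_arith.
have kill_comm s a x : kill s (X x - a *: x) = X (kill s x) - a *: kill s x.
  elim: s => //= b s ->; rewrite !linearB !linearZ /=; linear_arith.
have kill_comm2 s t x : kill s (kill t x) = kill t (kill s x).
  elim: t => //= b t <-; exact: kill_comm.
have [s [sC sw]] : exists s, (forall b, b \in s -> C b) /\ kill s w = 0.
  move: w; apply: mono_ind => [|a x y [s [sC sx]] [t [tC ty]]|t i].
  - by exists [::].
  - exists (s ++ t); split=> [b|].
      by rewrite mem_cat => /orP[/sC|/tC].
    by rewrite {1}/kill foldr_cat -/(kill _ _) -/(kill _ _) !killD ty kill_comm2 sx !kill0 scaler0 addr0.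
  - have [b Xb Cb] := monoC t i; have [->|nz] := eqVneq (mono t i) 0.
      by exists [::].
    exists [:: b]; split=> [d|]; first by rewrite inE => /eqP ->; apply: Cb.
    by rewrite /kill /= Xb subrr.
move=> Xw nzw; apply: sC; move/eqP: sw.
have -> : kill s w = (\prod_(b <- s) (c - b)) *: w.
  elim: s => [|b s IH] /=; first by rewrite big_nil scale1r.
  by rewrite IH big_cons linearZ /= Xw; linear_arith.
by rewrite scaler_eq0 (negPf nzw) orbF prodf_seq_eq0 => /hasP[b bs /=]; rewrite subr_eq0 => /eqP ->.
Qed.

End FrameTheory.

(** * Weight vectors and strings *)

Section Weights.
Variables (K : numFieldType) (m : finLieAlgType K) (n : nat) (F : frame m n).
Implicit Types (x y : m) (i j k l : 'I_n) (a : 'I_n -> int) (d : 'I_n -> K)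
  (f : 'End(m)).
Local Notation e := (vec F).
Local Notation "A ∙ x" := (act F A x) (at level 35, right associativity).

Definition weight a x := forall i, delta_mx i i ∙ x = (a i)%:~R *: x.

Lemma sum_kronecker i : \sum_k (k == i)%:Z = 1.
Proof. by rewrite (bigD1 i) //= eqxx big1 // => k /negPf ->. Qed.

Lemma eq_weight a b x : a =1 b -> weight a x -> weight b x.
Proof. by move=> ab wx i; rewrite -ab. Qed.

(** On a monomial, $E_{ii}$ acts by the number of occurrences of [i], and the monomials span. *)
Lemma weight_ge0 a x i : weight a x -> x != 0 -> 0 <= a i.
Proof.
move=> wx nz; pose C (c : K) := exists k : nat, c = k%:R.
have [] // : C (a i)%:~R.
  apply: (@eigenvalue_mono _ _ _ F (act F (delta_mx i i)) C _ x _ (wx i) nz).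
  by move=> t j; exists (count_mem i (j :: t))%:R; [exact: mono_weight|exists (count_mem i (j :: t))].
by move=> k; rewrite pmulrn => /intr_inj ->.
Qed.

Lemma weight_total a x : weight a x -> 1%:M ∙ x = (\sum_i a i)%:~R *: x.
Proof.
move=> wx; rewrite mx1_sum_delta act_sum (eq_bigr _ (fun i _ => wx i)).
by rewrite -scaler_suml rmorph_sum.
Qed.

Lemma weight_lie a x i :
  weight a x -> weight (fun k => a k + (k == i)%:Z) [lie e i, x].
Proof.
move=> wx k; rewrite act_lie wx act_delta_vec lieZl lieZr intrD.
by case: (eqVneq k i) => [->|_] /=; linear_arith.
Qed.

Lemma weight_root a x i j : weight a x ->
  weight (fun k => a k + (k == i)%:Z - (k == j)%:Z) (delta_mx i j ∙ x).
Proof.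
move=> wx k; have := act_comm F (delta_mx k k) (delta_mx i j) x.
rewrite wx linearZ /= => /eqP; rewrite eq_sym subr_eq => /eqP ->.
have -> : delta_mx k k *m delta_mx i j - delta_mx i j *m delta_mx k k =
    ((k == i)%:R - (k == j)%:R) *: delta_mx i j :> 'M[K]_n.
  rewrite !mul_delta_mx_cond -!scaler_nat scalerBl (eq_sym j k).
  by congr (_ - _); case: eqP => [->|_] //; rewrite !scale0r.
rewrite actZ intrB intrD; linear_arith.
Qed.

(* The data of an element of weight [- l] in the first prolongation, restricted
   to what its bracket with [vec F l] sees: this bracket is the diagonal matrix
   [d], and [f] is its action on the part of degree at least two. *)
Definition lowering l d f : Prop :=
  (forall i x, delta_mx i i ∙ f x = f (delta_mx i i ∙ x) - (i == l)%:R *: f x) /\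
  (forall j x, f [lie e l, [lie e j, x]] =
     \sum_i d i *: (delta_mx i i ∙ [lie e j, x]) + [lie e l, f [lie e j, x]]).

Lemma lowering_weight l d f a x : lowering l d f -> weight a x ->
  weight (fun k => a k - (k == l)%:Z) (f x).
Proof.
by move=> [wf _] wx i; rewrite wf wx linearZ /= intrB; linear_arith.
Qed.

Lemma lowering_lie l d f a x : lowering l d f -> weight a x ->
  \sum_i a i != 1 ->
  f [lie e l, x] = (\sum_i d i * (a i)%:~R) *: x + [lie e l, f x].
Proof.
move=> [_ lf] wx a1.
pose g x := f [lie e l, x] - \sum_i d i *: (delta_mx i i ∙ x) - [lie e l, f x].
have gP b y z : g (b *: y + z) = b *: g y + g z.
  rewrite /g lieDr lieZr !linearP /= lieDr lieZr.
  rewrite (eq_bigr (fun i => b *: (d i *: (delta_mx i i ∙ y))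
      + d i *: (delta_mx i i ∙ z))); last by move=> i _; rewrite actP; linear_arith.
  by rewrite big_split /= -scaler_sumr; linear_arith.
have g0 : g 0 = 0 by have := gP (-1) 0 0; rewrite scaler0 addr0 scaleN1r addNr.
have gZ b y : g (b *: y) = b *: g y by rewrite -[b *: y]addr0 gP g0 addr0.
(* [lowering] controls [f] only on brackets. The identity matrix acts by the degree, so $x\mapsto
   1\cdot x-x$ kills degree one and sends everything into the span of brackets. On a weight vector
   it is multiplication by $\sum_i a_i-1$, which is nonzero by hypothesis. *)
have gx : g (1%:M ∙ x - x) = 0.
  move: {a wx a1} x; apply: (@frame_ind _ _ _ F) => [|b y z IHy IHz|i|i y _].
  - by rewrite linear0 subr0.
  - rewrite actP (_ : _ - _ = b *: (1%:M ∙ y - y) + (1%:M ∙ z - z)); last by linear_arith.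
    by rewrite gP IHy IHz scaler0 addr0.
  - by rewrite act1_vec subrr.
  - rewrite act_lie act1_vec (_ : _ - _ = [lie e i, 1%:M ∙ y]); last by linear_arith.
    by rewrite /g lf; linear_arith.
move: gx; rewrite (weight_total wx) -{2}[x]scale1r -scalerBl gZ => /eqP.
rewrite scaler_eq0 subr_eq0 (eqr_int _ _ 1) (negPf a1) /= => /eqP gx.
have -> : (\sum_i d i * (a i)%:~R) *: x = \sum_i d i *: (delta_mx i i ∙ x).
  by rewrite scaler_suml; apply: eq_bigr => i _; rewrite wx scalerA.
by apply: subr0_eq; rewrite -[RHS]gx /g; linear_arith.
Qed.

(* As in the [sl_2] theory: [e l] maps [f^(j+1) x] to a multiple of [f^j x], and
   this multiple vanishes for the last nonzero [f^j x]. *)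
Lemma lowering_string l d f a x : lowering l d f -> weight a x -> x != 0 ->
  a l <= \sum_i a i - 2 -> f [lie e l, x] = 0 ->
  exists2 t : int, 0 <= t <= a l &
    2%:R * (\sum_i d i * (a i)%:~R) = t%:~R * d l.
Proof.
move=> low wx nz al fx0; set lam := \sum_i _.
pose u (j : nat) := iter j f x; pose b (j : nat) k : int := a k - (k == l)%:Z * j%:Z.
have wu (j : nat) : weight (b j) (u j).
  elim: j => [|j IH]; first by apply: eq_weight wx => k; rewrite /b mulr0 subr0.
  apply: eq_weight (lowering_weight low IH) => k; rewrite /b intS; lia.
have sum_b (j : nat) : \sum_k b j k = \sum_k a k - j%:Z.
  by rewrite big_split /= sumrN -mulr_suml sum_kronecker mul1r.
have bl (j : nat) : b j l = a l - j%:Z by rewrite /b eqxx mul1r.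
(* One step beyond [a l], coordinate [l] of the weight would be negative. *)
have ex0 : exists j : nat, u j.+1 == 0.
  exists `|a l|%N; apply: contraT => nzu.
  by have := weight_ge0 l (wu _) nzu; rewrite bl; have := weight_ge0 l wx nz; lia.
case: (ex_minnP ex0) => t /eqP ut1 min_t.
have nzu (j : nat) : (j <= t)%N -> u j != 0.
  case: j => [|j] jt; first by [].
  by apply/negP => /min_t; rewrite leqNgt jt.
have t_al : t%:Z <= a l.
  by have := weight_ge0 l (wu _) (nzu t (leqnn t)); rewrite bl subr_ge0.
have lam_b (j : nat) : \sum_k d k * (b j k)%:~R = lam - j%:R * d l.
  under eq_bigr => k _ do rewrite intrB mulrBr.
  rewrite big_split /= sumrN; congr (_ - _).
  rewrite (bigD1 l) //= eqxx big1 ?addr0; first by rewrite mul1r mulrC.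
  by move=> k /negPf ->; rewrite mul0r mulr0.
(* The recursion applies to [u j] only if its total weight is not 1; as $t\le a_l$, the bound
   [a l <= \sum_i a i - 2] ensures this up to $j=t$. *)
have e_u (j : nat) : (j <= t)%N ->
  [lie e l, u j.+1] = - ((j.+1)%:R * (lam - j%:R * d l / 2%:R)) *: u j.
  elim: j => [|j IH] jt.
    move: fx0; rewrite (lowering_lie low wx); last by have := al; have := weight_ge0 l wx nz; lia.
    rewrite -/lam => /eqP; rewrite addrC addr_eq0 => /eqP -> /=.
    by rewrite !mul0r subr0 mul1r scaleNr.
  have j1 : \sum_k b j.+1 k != 1 by rewrite sum_b; move: al t_al jt; lia.
  have := lowering_lie low (wu j.+1) j1.
  rewrite lam_b (IH (ltnW jt)) linearZ /= -/(u j.+1) => E.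
  rewrite -[LHS](addKr ((lam - j.+1%:R * d l) *: u j.+1)) -E -scaleNr -scalerDl.
  by congr (_ *: _); rewrite -[j.+2]addn1 -[j.+1]addn1 !natrD; field.
have := e_u t (leqnn t); rewrite ut1 lie0r => /esym/eqP.
rewrite scaler_eq0 (negPf (nzu t _)) // orbF oppr_eq0 mulf_eq0 pnatr_eq0 /=.
rewrite subr_eq0 => /eqP ->; exists t%:Z; first by rewrite t_al.
by rewrite -pmulrn; field.
Qed.

(* A lowering operator of [sl_2] is injective on positive weights. *)
Lemma root_inj a x i j : weight a x -> a j < a i -> x != 0 ->
  delta_mx j i ∙ x != 0.
Proof.
move=> wx aij nz; apply/eqP => Fx0.
have ij : i != j by apply: contraTneq aij => ->; rewrite ltxx.
pose u p := iter p (act F (delta_mx i j)) x.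
pose b p k : int := a k + ((k == i)%:Z - (k == j)%:Z) * p%:Z.
have wu p : weight (b p) (u p).
  elim: p => [|p IH]; first by apply: eq_weight wx => k; rewrite /b mulr0 addr0.
  apply: eq_weight (weight_root i j IH) => k; rewrite /b intS; lia.
(* If $E_{ji}x=0$, then $E_{ji}E_{ij}^{p+1}x$ is a nonzero multiple of $E_{ij}^{p}x$ for every $p$.
   No raised vector vanishes then, although coordinate [j] of their weights eventually becomes
   negative. *)
have Eu p : delta_mx j i ∙ u p.+1 =
    - ((p.+1)%:R * ((a i - a j)%:~R + p%:R)) *: u p.
  have H q : delta_mx j i ∙ u q.+1 = delta_mx i j ∙ delta_mx j i ∙ u q
      - (b q i - b q j)%:~R *: u q.
    have := act_comm F (delta_mx i j) (delta_mx j i) (u q).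
    rewrite !mul_delta_mx actB !wu intrB => /eqP; rewrite eq_sym => /eqP E.
    by rewrite -[LHS](subKr (delta_mx i j ∙ delta_mx j i ∙ u q)) E; linear_arith.
  elim: p => [|p IH].
    rewrite H Fx0 linear0 /b eqxx (negPf ij) eq_sym (negPf ij) eqxx !mulr0 !addr0.
    by linear_arith.
  rewrite H IH linearZ /= -/(u p.+1) -scalerBl; congr (_ *: _).
  have -> : b p.+1 i - b p.+1 j = a i - a j + (p.+1%:Z + p.+1%:Z).
    by rewrite /b !eqxx (negPf ij) eq_sym (negPf ij) /=; lia.
  by rewrite !intrD -!pmulrn -!natr1; ring.
have nzu p : u p != 0.
  elim: p => [|p IH] //; apply: contraNneq IH => u0; move: (Eu p).
  rewrite u0 linear0 => /esym/eqP; rewrite scaler_eq0 oppr_eq0 mulf_eq0 pnatr_eq0 /=.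
  rewrite pmulrn -intrD intr_eq0 => /orP[|//]; move: aij; lia.
have := weight_ge0 j (wu (`|a j|.+1)%N) (nzu _).
rewrite /b eqxx eq_sym (negPf ij); have := weight_ge0 j wx nz; lia.
Qed.

End Weights.

(** * Downward induction on the degree *)

Section Descent.
Variables (K : numFieldType) (m : finLieAlgType K) (n : nat) (F : frame m n).
Implicit Types (x y : m) (i j k l : 'I_n) (a : 'I_n -> int) (d : 'I_n -> K)
  (f : 'End(m)).
Local Notation e := (vec F).
Local Notation "A ∙ x" := (act F A x) (at level 35, right associativity).

Definition constant a := forall i j, a i = a j.

Lemma sum_addk a l : \sum_k (a k + (k == l)%:Z) = \sum_k a k + 1.
Proof. by rewrite big_split /= sum_kronecker. Qed.

Lemma sum_subk a l : \sum_k (a k - (k == l)%:Z) = \sum_k a k - 1.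
Proof. by rewrite big_split /= sumrN sum_kronecker. Qed.

Lemma lie_root i j l x :
  [lie e l, delta_mx i j ∙ x]
    = delta_mx i j ∙ [lie e l, x] - (j == l)%:R *: [lie e i, x].
Proof. by rewrite act_lie act_delta_vec lieZl; linear_arith. Qed.

Variables (shape : 'I_n -> ('I_n -> K) -> Prop) (k0 : int).

Definition family l d f := shape l d /\ lowering F l d f.

Hypotheses (n_gt1 : (1 < n)%N) (k0_gt1 : 1 < k0).
(** Together with [trace_zero], this is what each family has to supply. The premises on [f
    [lie e l, _]] concern one degree higher, where the descent already knows that the family
    vanishes; the one with a matrix unit serves the third family. *)
Hypothesis weight_constant : forall a x, weight F a x -> x != 0 ->
  k0 <= \sum_i a i ->
  (forall l d f, family l d f -> f [lie e l, x] = 0) ->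
  (forall l d f i j, family l d f -> f [lie e l, delta_mx i j ∙ x] = 0) ->
  constant a.
Hypothesis trace_zero : forall l d f a x, family l d f -> weight F a x ->
  k0 < \sum_i a i -> x != 0 -> f x != 0 -> constant a ->
  (forall l d f, family l d f -> f [lie e l, x] = 0) ->
  (forall j, j != l -> [lie e j, f x] = 0) -> \sum_i d i = 0.

Let vanish (k : int) := forall l d f a x, family l d f -> weight F a x ->
  \sum_i a i = k -> f x = 0.

Let nonconstant_vanish (k : int) a x : k0 <= k -> vanish (k + 1) -> weight F a x ->
  \sum_i a i = k -> x != 0 -> constant a.
Proof.
move=> k0k van wx sa nz; apply: (weight_constant wx nz); rewrite ?sa //.
  by move=> l d f fam; apply: (van _ _ _ _ _ fam (weight_lie l wx)); rewrite sum_addk sa.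
move=> l d f i j fam; apply: (van _ _ _ _ _ fam (weight_lie l (weight_root i j wx))).
by rewrite sum_addk sum_subk sum_addk sa addrK.
Qed.

Let other i : exists j, j != i.
Proof.
have [->|] := eqVneq i (Ordinal n_gt1); last by rewrite eq_sym; exists (Ordinal n_gt1).
by exists (Ordinal (ltnW n_gt1)).
Qed.

Let descent_step (k : int) : k0 < k -> vanish (k + 1) -> vanish k.
Proof.
move=> k0k van l d f a x fam wx sa.
have [->|nz] := eqVneq x 0; first by rewrite linear0.
apply/eqP/negPn/negP => nzf.
have wf : weight F _ (f x) := lowering_weight fam.2 wx.
have ca := nonconstant_vanish (ltW k0k) van wx sa nz.
have fe l' d' f' : family l' d' f' -> f' [lie e l', x] = 0.
  by move=> fam'; apply: (van _ _ _ _ _ fam' (weight_lie l' wx)); rewrite sum_addk sa.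
(* This bracket is back in degree $k$ with weight $a+\epsilon_j-\epsilon_l$, which is not constant
   since [a] is. *)
have ej j : j != l -> [lie e j, f x] = 0.
  move=> jl; apply/eqP/negPn/negP => nzj.
  have := nonconstant_vanish (ltW k0k) van (weight_lie j wf) _ nzj.
  rewrite sum_addk sum_subk sa subrK => /(_ erefl j l).
  by rewrite !eqxx (negPf jl) eq_sym (negPf jl) (ca j l); lia.
have trd : \sum_i d i = 0 by apply: (trace_zero fam wx) => //; rewrite sa.
have el : [lie e l, f x] = 0.
  have a1 : \sum_i a i != 1 by rewrite sa gt_eqF // (lt_trans k0_gt1).
  have := lowering_lie fam.2 wx a1; rewrite (fe _ _ _ fam).
  rewrite (eq_bigr (fun i => d i * (a l)%:~R)); last by move=> i _; rewrite (ca i l).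
  by rewrite -mulr_suml trd mul0r scale0r add0r.
have {}ej j : [lie e j, f x] = 0 by have [->|/ej] := eqVneq j l.
have [j jl] := other l.
(* As all generators kill [f x], and therefore also its images under matrix units, [weight_constant]
   applies to [f x] itself, in degree $k-1\ge k_0$. Its weight $a-\epsilon_l$ is not constant
   because $n\ge2$. *)
have : constant (fun i => a i - (i == l)%:Z).
  apply: (weight_constant wf nzf); first by rewrite sum_subk sa; lia.
    by move=> l' d' f' _; rewrite ej linear0.
  by move=> l' d' f' i' j' _; rewrite lie_root !ej scaler0 linear0 subr0 linear0.
by move=> /(_ j l); rewrite eqxx (negPf jl) (ca j l); lia.
Qed.

(** Above degree [N] there is nothing, which starts the descent; it stops at $k_0+1$, the degree
    needed to treat the weights of degree $k_0$. *)
Lemma nonconstant_weight_vanish (N : int) :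
  (forall a x, weight F a x -> N < \sum_i a i -> x = 0) ->
  forall a x, weight F a x -> \sum_i a i = k0 -> x != 0 -> constant a.
Proof.
move=> bounded a x; apply: nonconstant_vanish => //.
have top (r : int) : N < r -> vanish r.
  by move=> Nr l d f b y _ wy sb; rewrite (bounded _ _ wy) ?linear0 // sb.
have down p : k0 < N + 1 - p%:Z -> vanish (N + 1 - p%:Z).
  elim: p => [|p IH] k0p; first by apply: top; rewrite subr0 ltrDl.
  apply: (descent_step k0p).
  have E : N + 1 - p.+1%:Z + 1 = N + 1 - p%:Z by lia.
  by rewrite E; apply: IH; lia.
have [Nk|kN] := ltrP N (k0 + 1); first exact: top.
have := down `|N - k0|%N; rewrite (_ : N + 1 - _ = k0 + 1); last by lia.
by apply; rewrite ltrDl.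
Qed.

End Descent.

(** * Degrees three and four when only constant weights survive *)

Section Generation.
Variables (K : numFieldType) (m : finLieAlgType K) (n : nat) (F : frame m n).
Implicit Types (x y : m) (i j k l : 'I_n).
Local Notation e := (vec F).
Local Notation "A ∙ x" := (act F A x) (at level 35, right associativity).

Lemma weight_vec i : weight F (fun k => (k == i)%:Z) (e i).
Proof.
move=> k; rewrite act_delta_vec; case: (eqVneq k i) => [->|_] /=; linear_arith.
Qed.

Definition nonconstant_weights_vanish (r : int) := forall a x, weight F a x ->
  \sum_i a i = r -> x != 0 -> constant a.

(** For $n\ge3$ the weight of $[e_i,[e_i,e_k]]$ misses an index, so it is not constant. Polarizing
    these zeros with matrix units makes the triple bracket alternating in all its arguments, and the
    Jacobi identity then reads $3B=0$. *)
Lemma triple_brackets_vanish : (2 < n)%N -> nonconstant_weights_vanish 3 ->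
  forall i j k, [lie e i, [lie e j, e k]] = 0.
Proof.
move=> n_gt2 ncv; pose B i j k := [lie e i, [lie e j, e k]].
have Biik i k : B i i k = 0.
  apply/eqP/negPn/negP => nz.
  have := ncv _ _ (weight_lie i (weight_lie i (weight_vec k))).
  rewrite !sum_addk sum_kronecker => /(_ erefl nz) ca.
  have [j /andP[ji jk]] : exists j, (j != i) && (j != k).
    have /card_gt0P[j] : (0 < #|~: [set i; k]|)%N.
      by rewrite cardsCs finset.setCK card_ord cards2; move: n_gt2; case: (i != k); lia.
    by rewrite !inE negb_or; exists j.
  by have := ca j i; rewrite (negPf ji) (negPf jk) eqxx; lia.
have Bijj i j : B i j j = 0 by rewrite /B liexx lie0r.
have Bij i j k : B i j k = - B i k j by rewrite /B (lieC (e j)) lieNr.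
have Biji i j : B i j i = 0 by rewrite Bij Biik oppr0.
have Bji i j k : B i j k = - B j i k.
  have [->|ij] := eqVneq i j; first by rewrite Biik oppr0.
  have [->|kj] := eqVneq k j; first by rewrite Bijj Biji oppr0.
  have := congr1 (act F (delta_mx i j)) (Biik j k).
  rewrite /B linear0 !act_lie !act_delta_vec eqxx eq_sym (negPf kj) !scale1r.
  by rewrite scale0r lie0r addr0 => /eqP; rewrite addr_eq0 => /eqP.
move=> i j k; rewrite -/(B i j k).
have := lie_jacobi (e i) (e j) (e k); rewrite -!/(B _ _ _).
rewrite (Bij j) (Bji j) (Bji k) (Bij i k) !opprK => B3.
have /eqP : 3%:R *: B i j k = 0 by rewrite -[RHS]B3; linear_arith.
by rewrite scaler_eq0 pnatr_eq0 => /eqP.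
Qed.

End Generation.

(** With $z=[e_k,e_l]\neq0$, the vector $[e_p,[e_p,z]]$ has weight $(3,1)$ or $(1,3)$. Polarizing
    gives $X_{ij}=-X_{ji}$, whereas the Leibniz rule gives $X_{ij}=X_{ji}$ because $[e_i,e_j]=\pm z$
    commutes with $z$. If $z=0$ there is nothing to prove. *)
Lemma quadruple_brackets_vanish (K : numFieldType) (m : finLieAlgType K)
    (F : frame m 2) : nonconstant_weights_vanish F 4 ->
  forall i j k l,
    [lie vec F i, [lie vec F j, [lie vec F k, vec F l]]] = 0.
Proof.
move=> ncv i j k l; set e := vec F.
have [<-|kl] := eqVneq k l; first by rewrite liexx !lie0r.
pose X i j := [lie e i, [lie e j, [lie e k, e l]]].
have Xii p : X p p = 0.
  apply/eqP/negPn/negP => nz.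
  have := ncv _ _ (weight_lie p (weight_lie p (weight_lie k (weight_vec F l)))).
  rewrite !sum_addk sum_kronecker => /(_ erefl nz) /(_ k l).
  rewrite !eqxx (negPf kl) (eq_sym l) (negPf kl).
  have : (k == p) || (l == p).
    by move: k l p kl {nz X}; do 3 case=> [[|[|//]] ?].
  by move: kl => /[swap] /orP[]/eqP <-; rewrite !eqxx ?(eq_sym l) => /negPf->; lia.
rewrite -/(X i j); have [<-|ij] := eqVneq i j; first exact: Xii.
(* With two generators their bracket spans a quotient of $\Lambda^2V$, on which $\mathfrak{sl}_2$
   acts trivially. *)
have z0 : act F (delta_mx i j) [lie e k, e l] = 0.
  have : (k == j) && (l == i) || (k == i) && (l == j).
    by move: k l i j kl ij {X Xii}; do 4 case=> [[|[|//]] ?].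
  have ji : (j == i) = false by rewrite eq_sym (negPf ij).
  rewrite act_lie !act_delta_vec.
  by case/orP => /andP[/eqP -> /eqP ->]; rewrite eqxx ji scale0r scale1r liexx ?lie0l ?lie0r addr0.
have X1 : X i j = - X j i.
  have := congr1 (act F (delta_mx i j)) (Xii j).
  rewrite /X linear0 act_lie (act_lie _ _ (e j)) !act_delta_vec eqxx !scale1r.
  by rewrite z0 lie0r addr0 => /eqP; rewrite addr_eq0 => /eqP.
have X2 : X i j = X j i.
  rewrite /X lie_leibniz.
  have : (k == j) && (l == i) || (k == i) && (l == j).
    by move: k l i j kl ij {X Xii X1 z0}; do 4 case=> [[|[|//]] ?].
  by case/orP => /andP[/eqP -> /eqP ->]; rewrite ?(lieC (e i) (e j)) ?lieNl ?lieNr liexx ?oppr0 add0r.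
have /eqP : 2%:R *: X i j = 0 by rewrite {1}(_ : 2 *: _ = X i j + X i j); [rewrite {1}X1 X2 addNr|linear_arith].
by rewrite scaler_eq0 pnatr_eq0 => /eqP.
Qed.

(** * Constancy of weights for the three families *)

Section Families.
Variables (K : numFieldType) (m : finLieAlgType K) (n : nat) (F : frame m n).
Implicit Types (x y : m) (i j k l : 'I_n) (a : 'I_n -> int) (d : 'I_n -> K)
  (f : 'End(m)).
Local Notation e := (vec F).
Local Notation "A ∙ x" := (act F A x) (at level 35, right associativity).

Lemma sum_kronecker_mul l a :
  \sum_i (i == l)%:R * (a i)%:~R = (a l)%:~R :> K.
Proof.
rewrite (bigD1 l) //= eqxx mul1r big1 ?addr0 // => i /negPf ->.
by rewrite mul0r.
Qed.

Lemma sum_kroneckerR l : \sum_i (i == l)%:R = 1 :> K.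
Proof. by rewrite (bigD1 l) //= eqxx big1 ?addr0 // => i /negPf ->. Qed.

Lemma sum_ge2 a i j : (forall l, 0 <= a l) -> i != j ->
  a i + a j <= \sum_l a l.
Proof.
move=> a0 ij; rewrite (bigD1 i) //= (bigD1 j) 1?eq_sym //= addrA lerDl.
exact: sumr_ge0.
Qed.

Lemma sum_ge3 a i j l : (forall l, 0 <= a l) -> i != j -> l != i -> l != j ->
  a i + a j + a l <= \sum_k a k.
Proof.
move=> a0 ij li lj; rewrite (bigD1 i) //= (bigD1 j) 1?eq_sym //=.
by rewrite (bigD1 l) ?li ?lj //= !addrA lerDl sumr_ge0.
Qed.

Lemma third i j : (2 < n)%N -> exists2 l, l != i & l != j.
Proof.
move=> n_gt2; have /card_gt0P[l] : (0 < #|~: [set i; j]|)%N.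
  by rewrite cardsCs finset.setCK card_ord cards2; case: (i != j); lia.
by rewrite !inE negb_or => /andP[]; exists l.
Qed.

Hypotheses (n_gt1 : (1 < n)%N) (N : int).
Hypothesis bounded : forall a x, weight F a x -> N < \sum_i a i -> x = 0.
Variable k0 : int.
Hypotheses (k0_gt2 : 2 < k0) (k0_gt3 : n = 2%N -> 3 < k0).

Definition shape_sym l d := exists2 j, j != l &
  d = (fun i => (i == l)%:R - (i == j)%:R).

Lemma symmetric_family :
  (forall l d, shape_sym l d -> exists f, lowering F l d f) ->
  nonconstant_weights_vanish F k0.
Proof.
move=> ex a0 x0; apply: (nonconstant_weight_vanish (shape := shape_sym)) bounded _ _; rewrite // ?(lt_trans _ k0_gt2) //.
  move=> {a0 x0} a x wx nz k0k fe _.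
  have a0 i := weight_ge0 i wx nz.
  have H i j : a i < a j -> False.
    move=> aij; have ij : j != i by apply: contraTneq aij => ->; rewrite ltxx.
    have sh : shape_sym i (fun k => (k == i)%:R - (k == j)%:R) by exists j.
    have [f lf] := ex _ _ sh.
    have ai : a i <= \sum_i a i - 2.
      by have := sum_ge2 a0 ij; move: aij k0k k0_gt2; lia.
    (* Here $d=\epsilon_i-\epsilon_j$, and the string gives $2(a_i-a_j)=t\ge0$, contrary to
       $a_i<a_j$. *)
    have [t /andP[t0 _]] := lowering_string lf wx nz ai (fe _ _ _ (conj sh lf)).
    under eq_bigr => k _ do rewrite mulrBl.
    rewrite big_split sumrN /= !sum_kronecker_mul eqxx eq_sym (negPf ij) subr0 mulr1.
    rewrite -intrB -[2]/(2%:~R) -intrM => /intr_inj; move: t0 aij; lia.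
  move=> i j; case: (ltgtP (a i) (a j)) => // /H; contradiction.
move=> l d f a x [[j jl ->] _] _ _ _ _ _ _ _.
by rewrite sumrB !sum_kroneckerR subrr.
Qed.

Definition shape_alt l d := exists i j, [/\ i != l, j != l, i != j &
  d = (fun k => (k == i)%:R - (k == j)%:R)].

Lemma alternating_family : (2 < n)%N ->
  (forall l d, shape_alt l d -> exists f, lowering F l d f) ->
  nonconstant_weights_vanish F k0.
Proof.
move=> n_gt2 ex a0 x0; apply: (nonconstant_weight_vanish (shape := shape_alt)) bounded _ _; rewrite // ?(lt_trans _ k0_gt2) //.
  move=> {a0 x0} a x wx nz k0k fe _.
  have a0 i := weight_ge0 i wx nz.
  (* Since $d_l=0$, the right side of the string identity is zero, whatever [t] is. *)
  have E l i j : i != l -> j != l -> i != j -> a l <= \sum_i a i - 2 -> a i = a j.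
    move=> il jl ij al.
    have sh : shape_alt l (fun k => (k == i)%:R - (k == j)%:R) by exists i, j.
    have [f lf] := ex _ _ sh.
    have [t _] := lowering_string lf wx nz al (fe _ _ _ (conj sh lf)).
    under eq_bigr => k _ do rewrite mulrBl.
    rewrite big_split sumrN /= !sum_kronecker_mul (eq_sym l i) (negPf il) (eq_sym l j) (negPf jl) subr0 mulr0.
    rewrite -intrB -[2]/(2%:~R) -intrM => /eqP; rewrite intr_eq0; lia.
  have H i j : a i < a j -> False.
    move=> aij; have ij : j != i by apply: contraTneq aij => ->; rewrite ltxx.
    have [l li lj] := third i j n_gt2.
    have s3 := sum_ge3 a0 ij lj li.
    have [al|al] := lerP (a l) (\sum_i a i - 2).
      by have := E l i j; rewrite eq_sym li eq_sym lj eq_sym ij => /(_ isT isT isT al) ?; move: aij; lia.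
    have ai : a i <= \sum_i a i - 2.
      by have := sum_ge2 a0 ij; move: aij k0k k0_gt2; lia.
    have := E i l j li ij lj ai; move: s3 al (a0 i) aij k0k k0_gt2; lia.
  move=> i j; case: (ltgtP (a i) (a j)) => // /H; contradiction.
move=> l d f a x [[i [j [_ _ _ ->]]] _] _ _ _ _ _ _ _.
by rewrite sumrB !sum_kroneckerR subrr.
Qed.

(** The matrix $p\,1+q\,E_{ll}$; its two terms come from the two copies of $V^{*}$. *)
Definition shape_vec (p q : K) l d := d = (fun i => p + (i == l)%:R * q).

Lemma sum_shape_vec (p q : K) l a :
  \sum_i (p + (i == l)%:R * q) * (a i)%:~R = p * (\sum_i a i)%:~R + q * (a l)%:~R.
Proof.
under eq_bigr => i _ do rewrite mulrDl mulrAC.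
by rewrite big_split /= -mulr_sumr -mulr_suml sum_kronecker_mul rmorph_sum mulrC [_ * q]mulrC [_ * p]mulrC.
Qed.

(* The outcome of [lowering_string] for [shape_vec p q], in the ratio
   [P = 2 p / (p + q)]. *)
Let vec_string (p q : K) a x l f : p != 0 \/ q != 0 ->
  lowering F l (fun i => p + (i == l)%:R * q) f -> weight F a x -> x != 0 ->
  a l <= \sum_i a i - 2 -> f [lie e l, x] = 0 ->
  p + q != 0 /\
  exists2 u : int, - (2 * a l) <= u <= - a l &
    2%:R * p / (p + q) * (\sum_i a i - a l)%:~R = u%:~R.
Proof.
move=> pq0 lf wx nz al fx.
have [t /andP[t0 ta]] := lowering_string lf wx nz al fx.
rewrite sum_shape_vec eqxx mul1r; set k := \sum_i a i in al * => E.
have s0 : p + q != 0.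
  apply/eqP => s0; move: E; rewrite s0 mulr0 (_ : q = - p); last by rewrite -[q](addKr p) s0 addr0.
  rewrite mulNr -mulrBr -intrB => /eqP; rewrite !mulf_eq0 pnatr_eq0 /= intr_eq0.
  case/orP => [/eqP p0|]; last by move: al; lia.
  by move: pq0 s0; rewrite p0 eqxx add0r => -[] // /eqP.
split=> //; exists (t - 2 * a l); first by move: t0 ta; lia.
rewrite !intrB intrM; apply: (mulfI s0).
by rewrite [RHS]mulrBr [_ * t%:~R]mulrC -E; field.
Qed.

Lemma vector_family (p q : K) : p != 0 \/ q != 0 ->
  (forall l, exists f, lowering F l (fun i => p + (i == l)%:R * q) f) ->
  nonconstant_weights_vanish F k0.
Proof.
move=> pq0 ex a0 x0; apply: (nonconstant_weight_vanish (shape := shape_vec p q)) bounded _ _; rewrite // ?(lt_trans _ k0_gt2) //.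
  move=> {a0 x0} a x wx nz k0k fe fre.
  set k := \sum_i a i in k0k *; pose P := 2%:R * p / (p + q).
  have a0 i := weight_ge0 i wx nz.
  have st l : a l <= k - 2 ->
      exists2 u : int, - (2 * a l) <= u <= - a l & P * (k - a l)%:~R = u%:~R.
    move=> al; have [f lf] := ex l.
    by have [] := vec_string pq0 lf wx nz al (fe _ _ _ (conj erefl lf)).
  (* The vector $E_{ji}x$ is nonzero by [root_inj] and provides a second string, with $a_j+1$ in
     place of $a_j$ and the same total. *)
  have st1 i j : a j < a i -> a j + 1 <= k - 2 ->
      exists2 u : int, - (2 * (a j + 1)) <= u <= - (a j + 1) &
        P * (k - (a j + 1))%:~R = u%:~R.
    move=> aij aj; have [f lf] := ex j.
    have ij : (j == i) = false by apply: contraTF aij => /eqP ->; rewrite ltxx.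
    have := vec_string pq0 lf (weight_root j i wx) (root_inj wx aij nz).
    rewrite sum_subk sum_addk addrK -/k eqxx ij subr0.
    by case=> //; apply: fre (conj erefl lf).
  (* If $a_j=0$, the first string forces $P=0$, while the second one requires a value at most
     $-1$. *)
  have good i j : a j < a i -> a j <= k - 2 /\ 1 <= a j.
    move=> aij; have ij : i != j by apply: contraTneq aij => ->; rewrite ltxx.
    have s2 := sum_ge2 a0 ij; rewrite -/k in s2.
    have aj : a j <= k - 2 by move: aij s2 k0k k0_gt2; lia.
    split=> //; apply: contraT; rewrite -ltNge => aj0.
    have {}aj0 : a j = 0 by have := a0 j; move: aj0; lia.
    have [u ub] := st j aj; have u0 : u = 0 by move: ub; rewrite aj0; lia.
    rewrite aj0 u0 subr0 => /eqP; rewrite mulf_eq0 intr_eq0 => /orP[/eqP P0|/eqP]; last by move: k0k k0_gt2; lia.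
    have [|v vb] := st1 i j aij; first by rewrite aj0; move: k0k k0_gt2; lia.
    rewrite P0 mul0r => /esym/eqP; rewrite intr_eq0; move: vb; rewrite aj0; lia.
  (* The difference of the two strings is $P$, which is thus an integer $-r$; putting it back into
     the first string gives the bounds. *)
  have integral i j : a j < a i ->
      exists2 r : int, P = - r%:~R & (1 <= r) && (a j <= r * (k - a j) <= 2 * a j).
    move=> aij; have ij : i != j by apply: contraTneq aij => ->; rewrite ltxx.
    have s2 := sum_ge2 a0 ij; rewrite -/k in s2.
    have [aj aj1] := good i j aij.
    have aj2 : a j + 1 <= k - 2.
      have [k3|k3] := leP (a j + 3) k; first by move: k3; lia.
      have n_gt2 : (2 < n)%N.
        by rewrite ltn_neqAle n_gt1 andbT eq_sym; apply/eqP => /k0_gt3; move: k3 aij s2 k0k k0_gt2; lia.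
      have [l li lj] := third i j n_gt2.
      have := sum_ge3 a0 ij li lj; rewrite -/k => s3.
      have := good i l; move: k3 aij s2 s3 aj1 k0k k0_gt2 (a0 l); lia.
    have [u ub Eu] := st j aj; have [v vb Ev] := st1 i j aij aj2.
    have PE : P = - (v - u)%:~R.
      rewrite intrB -Eu -Ev -mulrBr -intrB (_ : _ - _ = -1); last by lia.
      by rewrite mulrN1 opprK.
    exists (v - u) => //; move: Eu; rewrite PE mulNr -intrM -intrN => /intr_inj Eu.
    by apply/andP; split; [|]; move: Eu ub aj aj1; nia.
  have H i j : a j < a i -> False.
    move=> aij; have ij : i != j by apply: contraTneq aij => ->; rewrite ltxx.
    have [r PE /andP[r1 rb]] := integral i j aij.
    have kj : k <= 3 * a j by move: r1 rb (a0 j); nia.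
    have [aj aj1] := good i j aij.
    have s2 := sum_ge2 a0 ij; rewrite -/k in s2.
    have [n_gt2|n_le2] := ltnP 2 n.
      have [l li lj] := third i j n_gt2.
      have := sum_ge3 a0 ij li lj; rewrite -/k => s3.
      (* From $k\le3a_j$ and $a_j<a_i$ follows $a_l<a_j$. Then also $k\le3a_l$, whereas
         $a_i+a_j+a_l>3a_l$. *)
      have [ali|ali] := ltP (a l) (a i); last by move: ali s3 kj aij; lia.
      have [r' _ /andP[r1' rb']] := integral i l ali.
      have kl : k <= 3 * a l by move: r1' rb' (a0 l); nia.
      by move: kl kj s3 aij; lia.
    have n2 : n = 2%N by apply/eqP; rewrite eqn_leq n_le2.
    have kE : k = a i + a j.
      rewrite /k (bigD1 i) //= (bigD1 j) 1?eq_sym //= big1 ?addr0 // => l /andP[li lj].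
      have := sum_ge3 (a := fun=> 1) (fun=> isT) ij li lj.
      by rewrite sumr_const card_ord n2.
    have k4 := k0_gt3 n2.
    (* Here $r=1$ and $a_i\le2a_j$, so $k\ge4$ gives $a_j\ge2$ and makes the string at [i]
       available; the weight $(2,1)$ of $G_2$ would escape at this point. That string gives
       $-a_j\le-a_i$, a contradiction. *)
    have [|u ub Eu] := st i; first by move: kj kE k0k k4 aj1 rb r1 aij; nia.
    move: Eu; rewrite PE mulNr -intrM -intrN => /intr_inj.
    have -> : r = 1 by move: rb r1 aij (a0 j); rewrite kE; nia.
    by move: ub aij; rewrite kE; lia.
  move=> i j; case: (ltgtP (a i) (a j)) => // /H; contradiction.
move=> l d f a x [-> lf] wx k0k nz nzf ca fe ej.
set k := \sum_i a i in k0k *; pose P := 2%:R * p / (p + q).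
have kE : k = a l * n%:Z.
  rewrite /k (eq_bigr (fun=> a l)); last by move=> i _; apply: ca.
  by rewrite sumr_const card_ord -mulr_natr pmulrn intz.
have al0 := weight_ge0 l wx nz.
have n_big : n%:Z = 2 /\ 4 < k \/ 3 <= n%:Z /\ 3 < k.
  have [n_gt2|n_le2] := ltnP 2 n; first by right; move: k0k k0_gt2; lia.
  have n2 : n = 2%N by apply/eqP; rewrite eqn_leq n_le2.
  by left; split; [rewrite n2|move: k0k (k0_gt3 n2); lia].
have [j jl] : exists j, j != l.
  have [E|ne] := eqVneq l (Ordinal n_gt1); last by rewrite eq_sym in ne; exists (Ordinal n_gt1).
  by exists (Ordinal (ltnW n_gt1)); rewrite E.
have [|s0 [u ub Eu]] := vec_string pq0 lf wx nz _ (fe _ _ _ (conj erefl lf)).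
  by rewrite -/k; move: n_big kE al0; nia.
have [g lg] := ex j.
(* The second string starts at [f x], of total $k-1$, in another direction [j]; it applies because
   $[e_j,fx]=0$. The two strings again differ by $P$. *)
have := vec_string pq0 lg (lowering_weight lf wx) nzf.
rewrite sum_subk -/k (negPf jl) subr0 ej // linear0 => -[||_ [v vb Ev]] //.
  by rewrite (ca j l); move: n_big kE al0; nia.
rewrite -/P -/k (ca j l) in Eu Ev vb.
have PE : P = (u - v)%:~R.
  rewrite intrB -Eu -Ev -mulrBr -intrB (_ : _ - _ = 1); last by lia.
  by rewrite mulr1.
(* From $P(n-1)a_l=u$ the integer $P(n-1)$ is $-1$ or $-2$. The value $-1$ would mean $n=2$, $P=-1$
   and $v=1-a_l$, above the bound $-a_l$. The value $-2$ is exactly the vanishing of the trace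
   $np+q$. *)
have PN : P * (n%:Z - 1)%:~R = - 2%:R.
  move: Eu Ev; rewrite PE -!intrM => /intr_inj Eu /intr_inj Ev.
  rewrite -[RHS](intrN _ 2); congr (_%:~R).
  move: Eu Ev ub vb kE n_big al0; nia.
rewrite big_split /= sumr_const card_ord -mulr_suml sum_kroneckerR mul1r.
have p2 : p = P * (p + q) / 2%:R by rewrite /P; field.
have -> : p *+ n + q = p * (n%:Z - 1)%:~R + (p + q).
  by rewrite intrB -pmulrn mulrBr mulr_natr; ring.
by rewrite {1}p2 mulrAC [_ * (p + q) * _]mulrAC PN; field.
Qed.

End Families.

(** * The first prolongation *)

Section Prolongation.
Variables (K : fieldType) (m : finLieAlgType K) (n : nat) (F : frame m n).
Implicit Types (x y v : m) (i j k l : 'I_n) (f : 'End(m)) (A : 'M[K]_n)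
  (T : 'I_n -> 'M[K]_n).
Local Notation e := (vec F).
Local Notation "A ∙ x" := (act F A x) (at level 35, right associativity).

(* An element [phi] of degree one of a transitive extension, given by the
   elements [T i] of degree zero and the map [f] induced by [phi] in
   degrees below [-1]: [phi, vec F i] is [T i] and [phi, v] is [f v]. *)
Definition first_prolongation T f : Prop :=
  [/\ forall i, f (e i) = 0,
      forall i j, f [lie e i, e j] = T i ∙ e j - T j ∙ e i
    & forall i j v, f [lie e i, [lie e j, v]] =
        T i ∙ [lie e j, v] + [lie e i, f [lie e j, v]]].

(** The natural action of $\mathfrak{gl}(V)$ on $V^{*}\otimes\mathfrak{gl}(V)$. *)
Definition prol_act A T i := A *m T i - T i *m A - \sum_j A j i *: T j.

Lemma first_prolongation_lin c T f T' f' :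
  first_prolongation T f -> first_prolongation T' f' ->
  first_prolongation (fun i => c *: T i + T' i) (c *: f + f').
Proof.
move=> [f1 f2 f3] [g1 g2 g3].
have E v : (c *: f + f') v = c *: f v + f' v. by rewrite add_lfunE scale_lfunE.
split=> [i|i j|i j v]; rewrite !E.
- by rewrite f1 g1 scaler0 addr0.
- by rewrite f2 g2 !actD !actZ; linear_arith.
- by rewrite f3 g3 actD actZ lieDr lieZr; linear_arith.
Qed.

Lemma first_prolongation_act A T f : first_prolongation T f ->
  first_prolongation (prol_act A T) ((act F A \o f) - (f \o act F A))%VF.
Proof.
move=> [f1 f2 f3].
have E v : ((act F A \o f) - (f \o act F A))%VF v = A ∙ f v - f (A ∙ v).
  by rewrite add_lfunE opp_lfunE !comp_lfunE.
pose S i := \sum_j A j i *: T j.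
have S2 i j : f [lie A ∙ e i, e j] = S i ∙ e j - T j ∙ A ∙ e i.
  rewrite /S act_vec lie_suml !linear_sum act_sum /= -?sumrB -?big_split /=.
  by apply: eq_bigr => k _; rewrite lieZl linearZ /= f2 linearZ actZ /=; linear_arith.
have S3 i j v : f [lie A ∙ e i, [lie e j, v]] =
    S i ∙ [lie e j, v] + [lie A ∙ e i, f [lie e j, v]].
  rewrite /S act_vec !lie_suml !linear_sum act_sum /= -big_split /=.
  by apply: eq_bigr => k _; rewrite !lieZl linearZ /= f3 actZ; linear_arith.
have S4 i j v : f [lie e i, A ∙ [lie e j, v]] =
    T i ∙ A ∙ [lie e j, v] + [lie e i, f (A ∙ [lie e j, v])].
  pose Y y := f [lie e i, y] = T i ∙ y + [lie e i, f y].
  have YD x y : Y x -> Y y -> Y (x + y).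
    by rewrite /Y lieDr !linearD /= lieDr => -> ->; linear_arith.
  rewrite -/(Y _) act_lie; apply: (YD); last exact: f3.
  rewrite act_vec lie_suml; apply: (big_ind Y) => //.
    by rewrite /Y lie0r !linear0 lie0r addr0.
  move=> k _; rewrite /Y lieZl lieZr !linearZ /= f3 lieZr; linear_arith.
have f0 i : f (A ∙ e i) = 0.
  by rewrite act_vec linear_sum big1 // => j _; rewrite linearZ /= f1 scaler0.
have R i x : prol_act A T i ∙ x = A ∙ T i ∙ x - T i ∙ A ∙ x - S i ∙ x.
  by rewrite /prol_act actB act_comm.
split=> [i|i j|i j v]; rewrite !E.
- by rewrite f1 f0 linear0 subr0.
- rewrite f2 act_lie !linearD !linearN /= S2 (lieC (e i)) linearN /= S2 !R.
  by linear_arith.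
- rewrite f3 (act_lie _ _ (e i)) !linearD /= (act_lie _ _ (e i)) S3 S4 R lieBr.
  by linear_arith.
Qed.

Lemma first_prolongation_unique T f : (forall i, T i = 0) ->
  first_prolongation T f -> forall v, f v = 0.
Proof.
move=> T0 [f1 f2 f3] v.
(* The values at [v] and at all $[e_i,v]$ are treated together, because the recursive clause for [f]
   only starts at an inner bracket. *)
suff [] : f v = 0 /\ forall i, f [lie e i, v] = 0 by [].
move: v; apply: (@frame_ind _ _ _ F) => [|a x y [x0 x1] [y0 y1]|i|i x [_ x1]].
- by split=> [|i]; rewrite ?lie0r linear0.
- split=> [|i]; first by rewrite linearP /= x0 y0 scaler0 addr0.
  by rewrite lieDr lieZr linearP /= x1 y1 scaler0 addr0.
- by split=> // j; rewrite f2 !T0 !act0 subrr.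
- by split=> [|j] //; rewrite f3 T0 act0 x1 lie0r addr0.
Qed.

Lemma first_prolongation_ext T T' f : T =1 T' ->
  first_prolongation T f -> first_prolongation T' f.
Proof.
by move=> TT' [f1 f2 f3]; split=> // [i j|i j v]; rewrite -!TT' ?f2 ?f3.
Qed.

(** The pair of $A\cdot T-cT$ and $[A,f]-cf$ is again in the prolongation, and its tensor is zero,
    so uniqueness applies. *)
Lemma first_prolongation_weight A T f c : first_prolongation T f ->
  (forall i, prol_act A T i = c *: T i) ->
  forall v, A ∙ f v = f (A ∙ v) + c *: f v.
Proof.
move=> H AT v.
have := first_prolongation_lin (- c) H (first_prolongation_act A H).
move=> /first_prolongation_unique/(_ v) E; apply: subr0_eq; rewrite -[RHS]E.
  by rewrite add_lfunE scale_lfunE add_lfunE opp_lfunE !comp_lfunE; linear_arith.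
by move=> i; rewrite AT scaleNr addNr.
Qed.

End Prolongation.

(** * Elements of degree one as tensors *)

Section Tensors.
Variables (K : fieldType) (m : finLieAlgType K) (n : nat) (F : frame m n).
Implicit Types (i a b x y z : 'I_n) (t : 'I_n -> 'I_n -> 'I_n -> K).

(* [t x y z] is the coefficient of [vec F z] in [act F (T x) (vec F y)]. *)
Definition tensor_mx t x : 'M[K]_n :=
  \matrix_(z, y) t x y z.

Definition in_prolongation t := exists f, first_prolongation F (tensor_mx t) f.

(** The action of $E_{ab}$ on $V^{*}\otimes V^{*}\otimes V$: one term for the vector index [z], and
    a term with a minus sign for each covector index. *)
Definition delta_act a b t x y z : K :=
  (z == a)%:R * t x y b - (y == b)%:R * t x a z - (x == b)%:R * t a y z.

Lemma delta_act_diag i t x y z : delta_act i i t x y z =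
  ((z == i)%:R - (y == i)%:R - (x == i)%:R) * t x y z.
Proof.
rewrite /delta_act; have [->|_] := eqVneq z i; have [->|_] := eqVneq y i;
  have [->|_] := eqVneq x i; rewrite /=; ring.
Qed.

Lemma tensor_mx_act a b t x :
  tensor_mx (delta_act a b t) x = prol_act (delta_mx a b) (tensor_mx t) x.
Proof.
apply/matrixP => z y; rewrite !mxE summxE; congr (_ - _ - _).
- rewrite (bigD1 b) //= big1 => [|k /negPf kb]; rewrite !mxE ?kb ?andbF ?mul0r //.
  by rewrite eqxx andbT addr0.
- rewrite (bigD1 a) //= big1 => [|k /negPf ka]; rewrite !mxE ?ka ?mulr0 //.
  by rewrite eqxx addr0 mulrC.
- rewrite (bigD1 a) //= big1 => [|k /negPf ka]; rewrite !mxE ?ka ?mul0r //.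
  by rewrite eqxx addr0.
Qed.

Lemma in_prolongation_ext t t' : (forall x y z, t x y z = t' x y z) ->
  in_prolongation t -> in_prolongation t'.
Proof.
move=> tt' [f H]; exists f; move: H; apply: first_prolongation_ext => x.
by apply/matrixP => z y; rewrite !mxE tt'.
Qed.

Lemma in_prolongation_act a b t :
  in_prolongation t -> in_prolongation (delta_act a b t).
Proof.
move=> [f /(first_prolongation_act (delta_mx a b)) H]; eexists.
by move: H; apply: first_prolongation_ext => x; rewrite tensor_mx_act.
Qed.

Lemma in_prolongation_scale c t :
  in_prolongation t -> in_prolongation (fun x y z => c * t x y z).
Proof.
move=> [f H]; have := first_prolongation_lin (c - 1) H H.
move=> H'; eexists; move: H'; apply: first_prolongation_ext => x.
by apply/matrixP => z y; rewrite !mxE; ring.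
Qed.

End Tensors.

(** * Isolating one of the three families *)

Section Trichotomy.
Variables (K : numFieldType) (m : finLieAlgType K) (n : nat) (F : frame m n).
Implicit Types (i j k l a b x y z : 'I_n) (t : 'I_n -> 'I_n -> 'I_n -> K).
Local Notation in_prol := (in_prolongation F).

(** The general tensor of weight $-\epsilon_l$: the condition
    $\epsilon_z-\epsilon_x-\epsilon_y=-\epsilon_l$ leaves only these entries. The bracket with
    [vec l] sees [d] alone. *)
Definition diagonal_tensor l (d c : 'I_n -> K) x y z : K :=
  (x == l)%:R * (y == z)%:R * d y + (x != l)%:R * c x * (y == l)%:R * (z == x)%:R.

Lemma diagonal_lowering l d c : in_prol (diagonal_tensor l d c) ->
  exists f, lowering F l d f.
Proof.
move=> [f H]; exists f; have [f1 f2 f3] := H; split.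
  move=> i v; rewrite (first_prolongation_weight (A := delta_mx i i) (c := - (i == l)%:R) H).
    by rewrite scaleNr.
  move=> x; rewrite -tensor_mx_act; apply/matrixP => z y; rewrite !mxE.
  rewrite delta_act_diag /diagonal_tensor.
  have [->|_] := eqVneq x l.
    by have [->|_] := eqVneq y z; rewrite (eq_sym l i) /=; ring.
  have [->|_] := eqVneq y l; last by rewrite /=; ring.
  by have [->|_] := eqVneq z x; rewrite (eq_sym l i) /=; ring.
move=> j v; rewrite f3; congr (_ + _).
have -> : tensor_mx (diagonal_tensor l d c) l = \sum_i d i *: delta_mx i i.
  apply/matrixP => z y; rewrite !mxE summxE /diagonal_tensor eqxx /= (bigD1 y) //= big1 => [|k /negPf ky].
    by rewrite !mxE eqxx andbT (eq_sym y z); ring.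
  by rewrite !mxE (eq_sym y) ky andbF mulr0.
by rewrite act_sum; apply: eq_bigr => i _; rewrite actZ.
Qed.

Ltac kronecker :=
  repeat (match goal with
  | H : is_true (?u != ?u) |- _ => by rewrite eqxx in H
  | |- context [?u == ?u] => rewrite (eqxx u)
  | H : is_true (?u != ?v) |- context [?u == ?v] => rewrite (negPf H)
  | H : is_true (?u != ?v) |- context [?v == ?u] => rewrite (eq_sym v u) (negPf H)
  | |- context [?u == ?v] =>
      let E := fresh in case: (eqVneq u v) => [E|E]; [subst|]
  end); rewrite /=; ring.

(** For $l\ne r$, the extremal vector $e_l^{*}\otimes e_l^{*}\otimes e_r$ of the trace-free part of
    $S^2V^{*}\otimes V$. *)
Definition theta l r x y z : K := (x == l)%:R * (y == l)%:R * (z == r)%:R.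

(* [delta_mx a b] has square zero on [V] and on its dual, so that its third power
   on tensors only sees this coefficient. *)
Lemma theta_of_coef t a b : a != b -> in_prol t -> t a a b != 0 ->
  in_prol (theta b a).
Proof.
move=> ab Pt nz.
have := in_prolongation_act a b (in_prolongation_act a b (in_prolongation_act a b Pt)).
(* The factor 6 counts the orders in which the three indices are moved. *)
move/(in_prolongation_scale (6%:R * t a a b)^-1); apply: in_prolongation_ext => x y z.
rewrite /delta_act /theta (eq_sym b a) (negPf ab) /=; field.
by rewrite nz.
Qed.

Lemma theta_change_right l r s : s != l -> s != r -> l != r ->
  in_prol (theta l r) -> in_prol (theta l s).
Proof.
move=> sl sr lr /(in_prolongation_act s r); apply: in_prolongation_ext => x y z.
rewrite /delta_act /theta; kronecker.
Qed.

Lemma theta_change_left l r s : s != l -> s != r -> l != r ->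
  in_prol (theta l r) -> in_prol (theta s r).
Proof.
move=> sl sr lr /(in_prolongation_act l s)/(in_prolongation_act l s).
move=> /(in_prolongation_scale (2%:R)^-1); apply: in_prolongation_ext => x y z.
by rewrite /delta_act /theta ?eqxx (negPf sr) (negPf sl) (eq_sym l s) (negPf sl) /=; field.
Qed.

(** Exchanges the indices without passing through a third one, which does not exist when $n=2$. *)
Lemma theta_swap l r : l != r -> in_prol (theta l r) -> in_prol (theta r l).
Proof.
move=> lr P; apply: (theta_of_coef lr P).
by rewrite /theta ?eqxx !mulr1 oner_eq0.
Qed.

Lemma theta_all l r l' r' : l != r -> l' != r' -> in_prol (theta l r) ->
  in_prol (theta l' r').
Proof.
move=> lr l'r' P.
have R s : s != l' -> l' != r' -> in_prol (theta l' s) -> in_prol (theta l' r').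
  move=> sl' _ Ps; have [<-//|r's] := eqVneq s r'.
  by apply: (theta_change_right (r := s)); rewrite // eq_sym.
have [E|l'l] := eqVneq l' l; first by subst; apply: (R r); rewrite // eq_sym.
have [E|l'r] := eqVneq l' r; first by subst; apply: (R l) => //; apply: theta_swap.
by apply: (R r); [rewrite eq_sym| |apply: (theta_change_left (l := l))].
Qed.

Lemma symmetric_lowering t a b : a != b -> in_prol t -> t a a b != 0 ->
  forall l d, shape_sym l d -> exists f, lowering F l d f.
Proof.
move=> ab Pt nz l d [j jl ->].
have /(in_prolongation_act l j) P : in_prol (theta l j).
  by apply: theta_all (theta_of_coef ab Pt nz); rewrite // eq_sym.
apply: (@diagonal_lowering _ _ (fun x => - (x == j)%:R)); move: P.
apply: in_prolongation_ext => x y z.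
rewrite /delta_act /theta /diagonal_tensor; kronecker.
Qed.

(** The vector $(e_b^{*}\wedge e_w^{*})\otimes e_a$, extremal in the trace-free part of
    $\Lambda^2V^{*}\otimes V$ when the indices are distinct. *)
Definition psi b w a x y z : K := (x == b)%:R * (y == w)%:R * (z == a)%:R -
  (x == w)%:R * (y == b)%:R * (z == a)%:R.

Lemma psi_sym b w a : in_prol (psi b w a) -> in_prol (psi w b a).
Proof.
move=> /(in_prolongation_scale (-1)); apply: in_prolongation_ext => x y z.
by rewrite /psi; ring.
Qed.

Lemma psi_swap b w a : b != w -> b != a -> w != a ->
  in_prol (psi b w a) -> in_prol (psi b a w).
Proof.
move=> bw ba wa /(in_prolongation_act w a)/(in_prolongation_act w a).
move=> /(in_prolongation_scale (- 2%:R)^-1); apply: in_prolongation_ext => x y z.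
by rewrite /delta_act /psi ?eqxx ?(eq_sym w b) ?(eq_sym a b) ?(eq_sym a w) ?(negPf bw) ?(negPf ba) ?(negPf wa) /=; field.
Qed.

Lemma psi_change b w a c : b != w -> b != a -> w != a ->
  c != a -> c != b -> c != w ->
  in_prol (psi b w a) -> in_prol (psi b w c).
Proof.
move=> bw ba wa ca cb cw /(in_prolongation_act c a).
apply: in_prolongation_ext => x y z.
by rewrite /delta_act /psi ?eqxx ?(eq_sym a w) ?(eq_sym a b) ?(negPf ba) ?(negPf wa) ?(negPf cb) ?(negPf cw) /=; ring.
Qed.

Definition distinct3 a b c := [&& a != b, a != c & b != c].

(** Exchanging indices and replacing the last one already act transitively on triples of distinct
    indices. *)
Lemma psi_all b w a b' w' a' : distinct3 b w a -> distinct3 b' w' a' ->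
  in_prol (psi b w a) -> in_prol (psi b' w' a').
Proof.
move=> D /and3P[b'w' b'a' w'a'].
have sym b1 w1 a1 : distinct3 b1 w1 a1 /\ in_prol (psi b1 w1 a1) ->
    distinct3 w1 b1 a1 /\ in_prol (psi w1 b1 a1).
  by move=> [/and3P[h1 h2 h3] /psi_sym]; split; rewrite // /distinct3 eq_sym h1 h3 h2.
have swap b1 w1 a1 : distinct3 b1 w1 a1 /\ in_prol (psi b1 w1 a1) ->
    distinct3 b1 a1 w1 /\ in_prol (psi b1 a1 w1).
  move=> [/and3P[h1 h2 h3] /psi_swap]; split; last by auto.
  by rewrite /distinct3 h2 h1 eq_sym h3.
have last3 c b1 w1 a1 : c != b1 -> c != w1 ->
    distinct3 b1 w1 a1 /\ in_prol (psi b1 w1 a1) ->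
    distinct3 b1 w1 c /\ in_prol (psi b1 w1 c).
  have [->//|ca cb cw [/and3P[h1 h2 h3] /psi_change]] := eqVneq c a1.
  split; last by auto.
  by rewrite /distinct3 h1 eq_sym cb eq_sym cw.
move=> P; have {D P} : distinct3 b w a /\ in_prol (psi b w a) by [].
move=> H; have {b w a H} [w [a H]] : exists w a, distinct3 b' w a /\ in_prol (psi b' w a).
  have [E|h1] := eqVneq b' b; first by subst; exists w, a.
  have [E|h2] := eqVneq b' w; first by subst; exists b, a; apply: (sym b).
  by exists b, w; apply: sym; apply: swap; apply: last3 H.
have {w a H} [a H] : exists a, distinct3 b' w' a /\ in_prol (psi b' w' a).
  have [E|h1] := eqVneq w' w; first by subst; exists a.
  by exists w; apply: swap; apply: last3 H; rewrite // eq_sym.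
by case: (last3 a' _ _ _ _ _ H); rewrite // eq_sym.
Qed.

Lemma alternating_lowering t a w b : distinct3 a w b ->
  (forall t x z, in_prol t -> x != z -> t x x z = 0) ->
  in_prol t -> t a w b != 0 ->
  forall l d, shape_alt l d -> exists f, lowering F l d f.
Proof.
move=> D nosym Pt nz l d [i [j [il jl ij ->]]].
have [aw ab wb] := and3P D.
(* After $E_{aw}$ the coefficient at $(w,w,b)$ is $-(t_{wab}+t_{awb})$, and [nosym] makes it
   vanish. *)
have anti : t w a b = - t a w b.
  have := nosym _ w b (in_prolongation_act a w Pt) wb.
  rewrite /delta_act ?eqxx (eq_sym b a) (negPf ab) !mul1r mul0r add0r => /eqP.
  by rewrite subr_eq0 eqr_oppLR => /eqP ->.
have aaw := nosym _ a w Pt aw.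
(* $E_{ab}^2$ moves two of the three indices and $E_{ww}$ keeps the terms in which the remaining one
   is [w]. The term with coefficient [t a a w] vanishes, and what is left is $2t_{awb}$ times
   [psi b w a]. *)
have Ppsi : in_prol (psi b w a).
  have := in_prolongation_act w w (in_prolongation_act a b (in_prolongation_act a b Pt)).
  move=> /(in_prolongation_scale (2%:R * t a w b)^-1).
  apply: in_prolongation_ext => x y z; rewrite /delta_act /psi.
  rewrite ?eqxx ?(eq_sym w a) ?(eq_sym b a) ?(eq_sym b w) ?(negPf ab) ?(negPf aw) ?(negPf wb) aaw anti /=; field.
  by rewrite nz.
have /(in_prolongation_act i j) P : in_prol (psi l i j).
  apply: psi_all Ppsi; rewrite /distinct3.
    by rewrite eq_sym wb eq_sym ab eq_sym aw.
  by rewrite eq_sym il eq_sym jl ij.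
apply: (@diagonal_lowering _ _ (fun x => (x == j)%:R - (x == i)%:R)); move: P.
apply: in_prolongation_ext => x y z.
rewrite /delta_act /psi /diagonal_tensor; kronecker.
Qed.

(** If no tensor of the submodule has a coefficient of the first two kinds, applying this to the
    images under matrix units shows that [t x a a] and [t a y a] do not depend on [a] off the
    diagonal. Hence [t] is built from two covectors [p] and [q], and $-E_{al}$ moves both to
    multiples of $e_l^{*}$, with values [p a] and [q a]. *)
Lemma vector_lowering t : (1 < n)%N ->
  (forall t x z, in_prol t -> x != z -> t x x z = 0) ->
  (forall t a w b, in_prol t -> distinct3 a w b -> t a w b = 0) ->
  in_prol t -> (exists x y z, t x y z != 0) ->
  exists p q : K, (p != 0 \/ q != 0) /\
    forall l, exists f, lowering F l (fun i => p + (i == l)%:R * q) f.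
Proof.
move=> n_gt1 nosym noalt Pt [x0 [y0 [z0 nz]]].
have [o oE] : exists o : 'I_n -> 'I_n, forall x, x != o x.
  exists (fun x => if x == Ordinal n_gt1 then Ordinal (ltnW n_gt1) else Ordinal n_gt1) => x.
  by case: ifP => [/eqP ->|->].
pose p x := t x (o x) (o x); pose q y := t (o y) y (o y).
have pE x a : x != a -> t x a a = p x.
  move=> xa; have [->//|ao] := eqVneq a (o x).
  have D : distinct3 x (o x) a by rewrite /distinct3 oE xa eq_sym.
  have := noalt _ _ _ _ (in_prolongation_act a (o x) Pt) D.
  rewrite /delta_act ?eqxx (negPf (oE x)) mul0r subr0 !mul1r => /subr0_eq.
  by rewrite /p => ->.
have qE y a : y != a -> t a y a = q y.
  move=> ya; have [->//|ao] := eqVneq a (o y).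
  have D : distinct3 (o y) y a by rewrite /distinct3 eq_sym oE ya eq_sym ao.
  have := noalt _ _ _ _ (in_prolongation_act a (o y) Pt) D.
  rewrite /delta_act ?eqxx (negPf (oE y)) mul0r subr0 !mul1r => /subr0_eq.
  by rewrite /q => ->.
have tE x y z : t x y z = (y == z)%:R * p x + (x == z)%:R * q y.
  have [yz|yz] := eqVneq y z; have [xz|xz] := eqVneq x z.
  - subst; have := nosym _ z (o z) (in_prolongation_act (o z) z Pt) (oE z).
    rewrite /delta_act ?eqxx !mul1r -/(p z) => /eqP.
    by rewrite -addrA -opprD subr_eq0 => /eqP ->; rewrite /q; ring.
  - by subst; rewrite pE //=; ring.
  - by subst; rewrite qE //=; ring.
  - have [E|xy] := eqVneq x y; first by subst; rewrite nosym //=; ring.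
    by rewrite noalt //= ?/distinct3 ?xy ?xz ?yz //; ring.
have [a pq] : exists a, p a != 0 \/ q a != 0.
  move: nz; rewrite tE; have [p0|] := eqVneq (p x0) 0; last by exists x0; left.
  rewrite p0 mulr0 add0r => q0; exists y0; right.
  by apply: contraNneq q0 => ->; rewrite mulr0.
exists (p a), (q a); split=> // l.
apply: (@diagonal_lowering _ _ (fun=> q a)).
have /(in_prolongation_scale (-1)) := in_prolongation_act a l Pt.
apply: in_prolongation_ext => x y z.
rewrite /delta_act !tE /diagonal_tensor; kronecker.
Qed.

(** The lengths at which the vanishing brackets give a contradiction. Among sub-free fundamental
    algebras with $n\ge2$, those that fail it are of type $B_n$ or $G_2$. *)
Definition long_enough : Prop :=
  ((2 < n)%N /\ exists i j k, [lie vec F i, [lie vec F j, vec F k]] != 0) \/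
  (n = 2%N /\ exists i j k l,
     [lie vec F i, [lie vec F j, [lie vec F k, vec F l]]] != 0).

End Trichotomy.

Theorem first_prolongation_trivial (K : numFieldType) (m : finLieAlgType K)
    (n : nat) (F : frame m n) (N : int) :
  (forall a x, weight F a x -> N < \sum_i a i -> x = 0) -> long_enough F ->
  forall T f, first_prolongation F T f -> forall i, T i = 0.
Proof.
move=> bounded long T f H i; apply: contrapT => /eqP nzT.
pose t x y z := T x z y.
have Pt : in_prolongation F t.
  exists f; move: H; apply: first_prolongation_ext => x.
  by apply/matrixP => z y; rewrite mxE.
have nzt : exists x y z, t x y z != 0.
  apply: contrapT => t0; move/eqP: nzT; apply.
  apply/matrixP => z y; rewrite mxE; apply: contrapT => /eqP nz.
  by apply: t0; exists i, y, z.
have vanishing k0 : (1 < n)%N -> 2 < k0 -> (n = 2%N -> 3 < k0) ->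
    nonconstant_weights_vanish F k0.
  move=> n_gt1 k2 k3.
  have [[t' [a [b [Pt' ab nz]]]]|nosym] := EM (exists t' a b,
      [/\ in_prolongation F t', a != b & t' a a b != 0]).
    exact: (symmetric_family n_gt1 bounded k2 k3 (symmetric_lowering ab Pt' nz)).
  have {}nosym t' a b : in_prolongation F t' -> a != b -> t' a a b = 0.
    by move=> Pt' ab; apply: contrapT => /eqP nz; apply: nosym; exists t', a, b.
  have [[t' [a [w [b [Pt' D nz]]]]]|noalt] := EM (exists t' a w b,
      [/\ in_prolongation F t', distinct3 a w b & t' a w b != 0]).
    apply: (alternating_family n_gt1 bounded k2 k3 _ (alternating_lowering D nosym Pt' nz)).
    have U : uniq [:: a; w; b] by rewrite /= !inE negb_or andbT -andbA.
    by have := max_card (mem [:: a; w; b]); rewrite (card_uniqP U) card_ord.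
  have {}noalt t' a w b : in_prolongation F t' -> distinct3 a w b -> t' a w b = 0.
    by move=> Pt' D; apply: contrapT => /eqP nz; apply: noalt; exists t', a, w, b.
  have [p [q [pq ex]]] := vector_lowering n_gt1 nosym noalt Pt nzt.
  exact: (vector_family n_gt1 bounded k2 k3 pq ex).
case: long => [[n_gt2 [j [k [l /eqP]]]]|[n2 [j [k [l [r /eqP]]]]]]; apply.
  apply: triple_brackets_vanish => //; apply: vanishing => //; first exact: ltnW.
  by move=> n2; rewrite n2 in n_gt2.
have van : nonconstant_weights_vanish F 4 by apply: vanishing; rewrite ?n2.
by subst n; exact: quadruple_brackets_vanish.
Qed.

(** * The semidirect product *)

Section Semidirect.
Variables (K : fieldType) (m : finLieAlgType K) (n : nat) (F : frame m n).
Local Notation "A ∙ x" := (act F A x) (at level 35, right associativity).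

(** The frame is a phantom parameter, on which the bracket depends. *)
Definition semidirect of frame m n : Type := (m * 'M[K]_n)%type.
Local Notation G := (semidirect F).

HB.instance Definition _ := GRing.Lmodule.on G.

Definition semidirect_lie (u v : G) : G :=
  ([lie u.1, v.1] + u.2 ∙ v.1 - v.2 ∙ u.1, u.2 *m v.2 - v.2 *m u.2).

Fact semidirect_liexx u : semidirect_lie u u = 0.
Proof.
by case: u => x A; rewrite /semidirect_lie /= liexx add0r !subrr.
Qed.

Fact semidirect_lie_linearl a (u v w : G) :
  semidirect_lie (a *: u + v) w = a *: semidirect_lie u w + semidirect_lie v w.
Proof.
case: u v w => x A [y B] [z C]; congr pair; rewrite /=.
  by rewrite lieDl lieZl actD actZ actP; linear_arith.
by rewrite mulmxDl mulmxDr -scalemxAl -scalemxAr scalerBr opprD addrACA.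
Qed.

Fact semidirect_lie_linearr a (u v w : G) :
  semidirect_lie w (a *: u + v) = a *: semidirect_lie w u + semidirect_lie w v.
Proof.
case: u v w => x A [y B] [z C]; congr pair; rewrite /=.
  by rewrite lieDr lieZr actD actZ actP; linear_arith.
by rewrite mulmxDl mulmxDr -scalemxAl -scalemxAr scalerBr opprD addrACA.
Qed.

Fact semidirect_jacobi u v w :
  semidirect_lie u (semidirect_lie v w) + semidirect_lie v (semidirect_lie w u)
    + semidirect_lie w (semidirect_lie u v) = 0.
Proof.
case: u v w => x A [y B] [z C]; congr pair; rewrite /=.
  rewrite !act_comm !linearB !linearD /= !act_lie !lieBr !lieDr.
  rewrite (lieC (A ∙ y)) (lieC (B ∙ z)) (lieC (C ∙ x)).
  have : [lie x, [lie y, z]] = - ([lie y, [lie z, x]] + [lie z, [lie x, y]]).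
    by apply/eqP; rewrite -addr_eq0 addrA lie_jacobi.
  by move=> ->; linear_arith.
rewrite !mulmxBl !mulmxBr !mulmxA; apply/matrixP => i j; rewrite !mxE; ring.
Qed.

HB.instance Definition _ := Lmodule_isLieAlgebra.Build K G
  semidirect_lie_linearl semidirect_lie_linearr semidirect_liexx
  semidirect_jacobi.

Variables (gm : grading m) (s : nat).

Definition graded_frame : Prop :=
  [/\ forall A k x, gm k x -> gm k (A ∙ x), forall i, gm (-1) (vec F i),
      forall x, gm (-1) x -> exists c, x = \sum_i c i *: vec F i
    & forall c, \sum_i c i *: vec F i = 0 -> forall i, c i = 0].

Hypotheses (gm_s : gnla gm s) (gF : graded_frame).

Lemma component0 (L : lieAlgType K) (gL : grading L) k : gL k 0.
Proof. by have [] := component_subspace gL k. Qed.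

Lemma componentP (L : lieAlgType K) (gL : grading L) k a (x y : L) :
  gL k x -> gL k y -> gL k (a *: x + y).
Proof. by have [_ H] := component_subspace gL k; apply: H. Qed.

Lemma componentD (L : lieAlgType K) (gL : grading L) k (x y : L) :
  gL k x -> gL k y -> gL k (x + y).
Proof. by move=> gx gy; rewrite -[x]scale1r; apply: componentP. Qed.

Lemma componentZ (L : lieAlgType K) (gL : grading L) k a (x : L) :
  gL k x -> gL k (a *: x).
Proof. by move=> gx; rewrite -[a *: x]addr0; apply/componentP/component0. Qed.

Lemma componentN (L : lieAlgType K) (gL : grading L) k (x : L) :
  gL k x -> gL k (- x).
Proof. by move=> gx; rewrite -scaleN1r; apply: componentZ. Qed.

Lemma gnla_nonneg k x : 0 <= k -> gm k x -> x = 0.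
Proof.
move=> k0 gx; apply: contrapT => /eqP nz.
by have /andP[_] := gm_s.1 k x gx nz; move: k0; lia.
Qed.

Definition semidirect_component (k : int) : classical_sets.set G :=
  fun u => gm k u.1 /\ (k != 0 -> u.2 = 0).

Fact semidirect_component_subspace k : subspace (semidirect_component k).
Proof.
split=> [|a [x A] [y B] [/= gx kA] [/= gy kB]].
  by split=> //; apply: component0.
by split=> /= [|k0]; [apply: componentP | rewrite kA // kB // scaler0 addr0].
Qed.

Fact semidirect_component_span u : exists (r : seq int) (v : int -> G),
  (forall k, semidirect_component k (v k)) /\ u = \sum_(k <- r) v k.
Proof.
case: u => x A; have [r [v [gv ->]]] := component_span gm x.
(* Degree 0 holds exactly the matrix part, [m] having nothing there, and is listed once at the
   head. *)
exists (0 :: filter (predC1 0) r), (fun k => if k == 0 then (0, A) else (v k, 0)).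
split=> [k|].
  by case: eqP => [->|_]; split=> //=; apply: component0.
rewrite big_cons eqxx big_filter.
have -> : \sum_(k <- r | k != 0) (if k == 0 then (0, A) else (v k, 0))
    = (\sum_(k <- r | k != 0) v k, 0) :> G.
  elim/big_rec2: _ => // k y1 y2 /negPf -> ->.
  by congr pair; rewrite /= addr0.
congr pair; rewrite /= ?addr0 // add0r [RHS]big_mkcond /=; apply: eq_bigr => k _.
by case: eqP => // k0; rewrite [v k](gnla_nonneg _ (gv k)) // k0.
Qed.

Fact semidirect_component_indep (r : seq int) (v : int -> G) : uniq r ->
  (forall k, semidirect_component k (v k)) -> \sum_(k <- r) v k = 0 ->
  forall k, k \in r -> v k = 0.
Proof.
move=> Ur gv sv k kr.
have [E1 E2] : \sum_(k <- r) (v k).1 = 0 /\ \sum_(k <- r) (v k).2 = 0.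
  have -> : \sum_(k <- r) (v k).1 = (\sum_(k <- r) v k).1.
    by elim/big_rec2: _ => // j y1 y2 _ ->.
  have -> : \sum_(k <- r) (v k).2 = (\sum_(k <- r) v k).2.
    by elim/big_rec2: _ => // j y1 y2 _ ->.
  by rewrite sv.
have v1 := component_indep Ur (fun k => (gv k).1) E1 kr.
suff v2 : (v k).2 = 0 by case: (v k) v1 v2 => x A /= -> ->.
have [k0|k0] := eqVneq k 0; last by apply: (gv k).2.
move: E2; rewrite (bigD1_seq k) //= big1 ?addr0 // => j.
by rewrite k0 => j0; apply: (gv j).2.
Qed.

Fact semidirect_component_lie i j (u v : G) :
  semidirect_component i u -> semidirect_component j v ->
  semidirect_component (i + j) [lie u, v].
Proof.
case: u v => x A [y B] [/= gx iA] [/= gy jB]; have [gact _ _ _] := gF.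
split=> /= [|ij].
  apply: componentD; [apply: componentD|apply: componentN].
  - exact: component_lie.
  - have [->|i0] := eqVneq i 0; first by rewrite add0r; apply: gact.
    by rewrite iA // act0; apply: component0.
  - have [->|j0] := eqVneq j 0; first by rewrite addr0; apply: gact.
    by rewrite jB // act0; apply: component0.
have [i0|i0] := eqVneq i 0; last by rewrite iA // mul0mx mulmx0 subrr.
by rewrite jB ?mul0mx ?mulmx0 ?subrr //; move: ij; rewrite i0 add0r.
Qed.

Definition semidirect_grading : grading G :=
  Grading semidirect_component_subspace semidirect_component_span
    semidirect_component_indep semidirect_component_lie.

Definition semidirect_inl (x : m) : G := (x, 0).

Fact semidirect_inl_is_linear : linear semidirect_inl.
Proof. by move=> a x y; congr pair; rewrite /= scaler0 addr0. Qed.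

HB.instance Definition _ := GRing.isLinear.Build K m G _
  semidirect_inl semidirect_inl_is_linear.

Lemma semidirect_transitive :
  transitive_extension gm semidirect_grading semidirect_inl.
Proof.
have [_ ge _ free] := gF; split; first split=> [x y|x y []|k k0] //.
- by congr pair; rewrite /= ?act0 ?subr0 ?addr0 // mulmx0 subrr.
- apply/funext => -[x A]; apply/propext; split=> [[y gy [<- <-]] //|[/= gx kA]].
  by exists x; rewrite // kA // lt_eqF.
move=> k [x A] k0 [/= gx kA] trans.
have x0 := gnla_nonneg k0 gx; rewrite x0; congr pair.
have [k_eq0|/kA //] := eqVneq k 0.
apply/matrixP => i j; rewrite mxE.
have := trans (vec F j, 0) (conj (ge j) (fun _ => erefl)).
case=> /=; rewrite x0 lie0r act0 addr0 sub0r act_vec => /eqP.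
by rewrite oppr_eq0 => /eqP /free ->.
Qed.

End Semidirect.

(** A total linear relation is single-valued as soon as it is so at 0, by subtraction; it is then
    the graph of a linear map. Maps into or out of a graded algebra are obtained from decompositions
    in this way. *)
Lemma linear_of_relation (K : fieldType) (U V : lmodType K) (R : U -> V -> Prop) :
  (forall a u v p q, R u p -> R v q -> R (a *: u + v) (a *: p + q)) ->
  (forall u, exists p, R u p) -> (forall p, R 0 p -> p = 0) ->
  exists f : {linear U -> V}, (forall u, R u (f u)) /\ forall u p, R u p -> p = f u.
Proof.
move=> lin /choice[f Rf] fun0.
have funR u p : R u p -> p = f u.
  move=> Rp; apply/eqP; rewrite -subr_eq0 addrC -scaleN1r; apply/eqP/fun0.
  by have := lin (-1) _ _ _ _ (Rf u) Rp; rewrite (scaleN1r u) addNr.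
have fl : linear f by move=> a u v; apply/esym/funR; apply: lin.
pose g : {linear U -> V} := HB.pack f (GRing.isLinear.Build _ _ _ _ f fl).
by exists g.
Qed.

Lemma component_span_uniq (K : fieldType) (L : lieAlgType K) (gL : grading L) u :
  exists (r : seq int) (v : int -> L),
    [/\ uniq r, forall k, gL k (v k) & u = \sum_(k <- r) v k].
Proof.
have [r [v [gv ->]]] := component_span gL u.
(* A repeated index contributes the same vector each time, hence the multiplicity. *)
exists (undup r), (fun k => v k *+ count_mem k r); split; first exact: undup_uniq.
  by move=> k; rewrite -scaler_nat; apply: componentZ.
by rewrite big_undup_iterop_count.
Qed.

(** * Every transitive extension embeds in the semidirect product *)

Section Maximality.
Variables (K : fieldType) (m : finLieAlgType K) (n : nat) (F : frame m n).
Variables (gm : grading m) (s : nat) (gm_s : gnla gm s) (gF : graded_frame F gm).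
Variables (L : lieAlgType K) (gL : grading L) (iota : {linear m -> L}).
Hypothesis trans : transitive_extension gm gL iota.
Local Notation "A ∙ x" := (act F A x) (at level 35, right associativity).
Local Notation e := (vec F).

Let iota_lie x y : iota [lie x, y] = [lie iota x, iota y].
Proof. by have [[H _ _] _] := trans; apply: H. Qed.

Let iota_inj : injective iota.
Proof. by have [[_ H _] _] := trans. Qed.

Let iota_component k x : k < 0 -> gm k x -> gL k (iota x).
Proof. by move=> k0 gx; have [[_ _ H] _] := trans; rewrite -H //; exists x. Qed.

Let component_iota k u : k < 0 -> gL k u -> exists2 x, gm k x & u = iota x.
Proof. by move=> k0; have [[_ _ H] _] := trans; rewrite -H // => -[x gx <-]; exists x. Qed.

Let component_iota1 u : gL (-1) u -> exists c, u = \sum_i c i *: iota (e i).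
Proof.
have [_ _ gen _] := gF; move=> /(@component_iota (-1) _ isT)[x /gen[c ->] ->]; exists c.
by rewrite linear_sum; apply: eq_bigr => i _; rewrite linearZ.
Qed.

(** The image of [iota] lies in negative degrees, which are independent of degree 0. *)
Let iota_zero x w : gL 0 w -> iota x = w -> w = 0.
Proof.
move=> gw xw; have [r [v [Ur gv xE]]] := component_span_uniq gm x.
pose V k := if k == 0 then - w else if k < 0 then iota (v k) else 0.
have gV k : gL k (V k).
  rewrite /V; case: eqP => [->|_]; first exact: componentN.
  by case: ltP => k0; [apply: iota_component|apply: component0].
pose r' := 0 :: [seq k <- r | k < 0].
have Ur' : uniq r' by rewrite /= mem_filter ltxx /= filter_uniq.
have sV : \sum_(k <- r') V k = 0.
  rewrite big_cons /V eqxx big_filter addrC -xw xE linear_sum.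
  apply/eqP; rewrite subr_eq0 [X in X == _]big_mkcond /=; apply/eqP/eq_bigr => k _.
  by case: ltP => k0; [rewrite lt_eqF|rewrite (gnla_nonneg gm_s k0 (gv k)) linear0].
have := component_indep Ur' gV sV (mem_head _ _).
by rewrite /V eqxx => /eqP; rewrite oppr_eq0 => /eqP.
Qed.

Let acts w A := gL 0 w /\ forall x, [lie w, iota x] = iota (A ∙ x).

Let acts_exists w : gL 0 w -> exists A, acts w A.
Proof.
move=> gw; have [_ ge gen _] := gF.
have /choice[c cE] i : exists c : 'I_n -> K,
    [lie w, iota (e i)] = iota (\sum_k c k *: e k).
  have := component_lie gw (iota_component (isT : -1 < 0 :> int) (ge i)).
  by rewrite add0r => /(@component_iota (-1) _ isT)[x /gen[c ->] ->]; exists c.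
exists (\matrix_(k, i) c i k); split=> //.
apply: (@frame_ind _ _ _ F) => [|a x y Hx Hy|i|i x Hx].
- by rewrite !linear0 lie0r.
- by rewrite linearP lieDr lieZr Hx Hy actP linearP.
- rewrite cE act_vec; congr (iota _).
  by apply: eq_bigr => k _; rewrite mxE.
- rewrite iota_lie lie_leibniz cE Hx act_lie linearD !iota_lie; congr ([lie iota _, _] + _).
  by rewrite act_vec; apply: eq_bigr => k _; rewrite mxE.
Qed.

Let acts_lin a w A w' A' : acts w A -> acts w' A' -> acts (a *: w + w') (a *: A + A').
Proof.
move=> [gw Hw] [gw' Hw']; split=> [|x]; first exact: componentP.
by rewrite lieDl lieZl Hw Hw' actD actZ linearP.
Qed.

Let acts_lie w A w' A' : acts w A -> acts w' A' ->
  acts [lie w, w'] (A *m A' - A' *m A).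
Proof.
move=> [gw Hw] [gw' Hw']; split=> [|x].
  by have := component_lie gw gw'; rewrite addr0.
by rewrite lie_leibnizl Hw Hw' Hw Hw' act_comm linearB.
Qed.

Let transitive k u : 0 <= k -> gL k u -> (forall i, [lie u, iota (e i)] = 0) -> u = 0.
Proof.
move=> k0 gu ue; apply: (trans.2 k u k0 gu) => y /component_iota1[c ->].
by rewrite lie_suml big1 // => i _; rewrite lieZl lieC ue oppr0 scaler0.
Qed.

Let acts0 w : acts w 0 -> w = 0.
Proof.
move=> [gw Hw]; apply: (transitive (lexx 0) gw) => i.
by rewrite Hw act0 linear0.
Qed.

Let acts_inj w A A' : acts w A -> acts w A' -> A = A'.
Proof.
move=> [_ Hw] [_ Hw']; have [_ _ _ free] := gF; apply/matrixP => k i.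
apply/eqP; rewrite -subr_eq0; apply/eqP; apply: (free (fun k => A k i - A' k i)).
have := Hw (e i); rewrite Hw' => /iota_inj/eqP.
rewrite !act_vec eq_sym -subr_eq0 -sumrB => /eqP E; rewrite -[RHS]E.
by apply: eq_bigr => j _; rewrite scalerBl.
Qed.

Hypothesis prolongation0 :
  forall T f, first_prolongation F T f -> forall i, T i = 0.

Let degree1 phi : gL 1 phi -> phi = 0.
Proof.
move=> gphi; have [_ ge _ _] := gF; pose W i := [lie phi, iota (e i)].
have gW i : gL 0 (W i).
  exact: (component_lie gphi (iota_component (isT : -1 < 0 :> int) (ge i))).
have /choice[T HT] i := acts_exists (gW i).
(* The relation forgets the degree-zero part of $[\phi,x]$, so that [f] is defined on all of [m] and
   vanishes on $\mathfrak g_{-1}$, as [first_prolongation] requires. *)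
pose R x y := exists2 w, gL 0 w & [lie phi, iota x] = iota y + w.
(* One bracket with [e i] turns the forgotten part [w] into the term $-A\cdot e_i$ of [m]; on
   brackets nothing is forgotten any more. *)
have Rlie i v y w A : acts w A -> [lie phi, iota v] = iota y + w ->
    [lie phi, iota [lie e i, v]] = iota (T i ∙ v + [lie e i, y] - A ∙ e i).
  move=> [_ Hw] Hv; rewrite iota_lie lie_leibniz -/(W i) (HT i).2 Hv lieDr.
  by rewrite -iota_lie (lieC _ w) Hw addrA linearB linearD.
have RE x y : [lie phi, iota x] = iota y -> R x y.
  by move=> E; exists 0; [apply: component0|rewrite addr0].
have [f [Rf fR]] : exists f : {linear m -> m},
    (forall x, R x (f x)) /\ forall x y, R x y -> y = f x.
  apply: linear_of_relation => [a x y p q [w gw Hw] [w' gw' Hw']|x|p [w gw]].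
  - exists (a *: w + w'); first exact: componentP.
    by rewrite !linearP lieDr lieZr Hw Hw' scalerDr addrACA.
  - move: x; apply: (@frame_ind _ _ _ F) => [|a x y [p [w gw Hw]] [q [w' gw' Hw']]|i|i x [y [w gw Hw]]].
    + by exists 0; apply: RE; rewrite !linear0 lie0r.
    + exists (a *: p + q), (a *: w + w'); first exact: componentP.
      by rewrite !linearP lieDr lieZr Hw Hw' scalerDr addrACA.
    + by exists 0, (W i) => //; rewrite linear0 add0r.
    + have [A HA] := acts_exists gw.
      by exists (T i ∙ x + [lie e i, y] - A ∙ e i); apply/RE/(Rlie _ _ _ _ _ HA).
  - rewrite linear0 lie0r => /esym/eqP; rewrite addr_eq0 => /eqP pw.
    have w0 := iota_zero (componentN gw) pw.
    by apply: iota_inj; rewrite pw w0 linear0.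
have a0 : acts 0 0.
  by split=> [|x]; [apply: component0|rewrite lie0l act0 linear0].
have fE x y : [lie phi, iota x] = iota y -> y = f x by move=> /RE/fR.
have fe i : f (e i) = 0.
  by apply/esym/fR; exists (W i) => //; rewrite linear0 add0r.
have flie j v : [lie phi, iota [lie e j, v]] = iota (f [lie e j, v]).
  have [w gw Hw] := Rf v; have [A HA] := acts_exists gw.
  by have E := Rlie j _ _ _ _ HA Hw; rewrite -(fE _ _ E).
have /prolongation0 T0 : first_prolongation F T (linfun f).
  split=> [i|i j|i j v]; rewrite !lfunE //=.
  - apply/esym/fE; have := Rlie i (e j) 0 (W j) (T j) (HT j).
    by rewrite linear0 add0r lie0r addr0 => ->.
  - apply/esym/fE; have := Rlie i _ _ _ _ a0 (etrans (flie j v) (esym (addr0 _))).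
    by rewrite act0 subr0.
apply: (transitive _ gphi) => // i; rewrite -/(W i).
by apply: acts0; have := HT i; rewrite T0.
Qed.

Let positive0 k u : 0 < k -> gL k u -> u = 0.
Proof.
move=> k0; have {k0} -> : k = `|k|.-1.+1%:Z by move: k0; lia.
elim: `|k|.-1 u => [|p IH] u gu; first exact: degree1.
have [_ ge _ _] := gF; apply: (transitive _ gu) => // i; apply: IH.
have := component_lie gu (iota_component (isT : -1 < 0 :> int) (ge i)).
by rewrite [_ + _](_ : _ = p.+1%:Z) //; lia.
Qed.

Lemma transitive_embeds : exists psi : {linear L -> semidirect F},
  [/\ lie_morphism psi, injective psi,
      forall k u, gL k u -> semidirect_component gm k (psi u)
    & forall x, psi (iota x) = semidirect_inl F x].
Proof.
(* As positive degrees vanish, every element is $\iota(x)+w$ with [w] of degree 0, and [w] is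
   recorded by the matrix through which it acts on [m]. *)
pose R u (p : semidirect F) := exists2 w, acts w p.2 & u = iota p.1 + w.
have a0 : acts 0 0.
  by split=> [|x]; [apply: component0|rewrite lie0l act0 linear0].
have Rlin a u v p q : R u p -> R v q -> R (a *: u + v) (a *: p + q).
  move=> [w Hw ->] [w' Hw' ->]; exists (a *: w + w'); first exact: acts_lin.
  by rewrite /= linearP scalerDr addrACA.
have Rneg k u : k < 0 -> gL k u -> exists2 x, gm k x & R u (x, 0).
  by move=> k0 /(component_iota k0)[x gx ->]; exists x => //; exists 0; rewrite //= addr0.
have Rzero u : gL 0 u -> exists A, R u (0, A).
  by move=> /acts_exists[A HA]; exists A, u; rewrite //= linear0 add0r.
have R0 : R 0 0 by exists 0; rewrite //= linear0 addr0.
have [psi [Rpsi psiR]] : exists psi : {linear L -> semidirect F},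
    (forall u, R u (psi u)) /\ forall u p, R u p -> p = psi u.
  apply: linear_of_relation => // [u|[x A] [w Hw /esym/eqP]].
    have [r [v [gv ->]]] := component_span gL u.
    elim: r => [|k r [p Hp]]; first by rewrite big_nil; exists 0.
    rewrite big_cons; suff [q Hq] : exists q, R (v k) q.
      by exists (1 *: q + p); rewrite -[v k]scale1r; apply: Rlin.
    have [k0|k0|k0] := ltgtP k 0.
    - by have [x _ Hx] := Rneg _ _ k0 (gv k); exists (x, 0).
    - by rewrite (positive0 k0 (gv k)); exists 0.
    - by have := gv k; rewrite k0 => /Rzero[A HA]; exists (0, A).
  rewrite /= addr_eq0 => /eqP xw; have w0 := iota_zero (componentN Hw.1) xw.
  congr pair; first by apply: iota_inj; rewrite linear0 xw.
  by apply: (acts_inj Hw); have /eqP := w0; rewrite oppr_eq0 => /eqP ->.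
exists psi; split=> [u v|u v uv|k u gu|x].
- apply/esym/psiR; have [w Hw uE] := Rpsi u; have [w' Hw' vE] := Rpsi v.
  exists [lie w, w']; first exact: acts_lie.
  rewrite {1}uE {1}vE lieDl !lieDr -iota_lie Hw.2 (lieC _ w') Hw'.2 /=.
  by rewrite linearB linearD !addrA; congr (_ + _); rewrite addrAC.
- apply/eqP; rewrite -subr_eq0; apply/eqP; set d := u - v.
  have [w Hw dE] := Rpsi d; have d0 : psi d = 0 by rewrite linearB uv subrr.
  by move: dE Hw; rewrite d0 linear0 add0r => -> /acts0.
- have [k0|k0|k0] := ltgtP k 0.
  + by have [x gx /psiR <-] := Rneg _ _ k0 gu.
  + by rewrite (positive0 k0 gu) linear0; split=> //; apply: component0.
  + rewrite k0 in gu *; have [A /psiR <-] := Rzero _ gu.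
    by split=> //; apply: component0.
- by apply/esym/psiR; exists 0; rewrite //= addr0.
Qed.

End Maximality.

Lemma prolongation_rigid_of_frame (K : fieldType) (m : finLieAlgType K)
    (gm : grading m) (s n : nat) (F : frame m n) :
  gnla gm s -> graded_frame F gm ->
  (forall T f, first_prolongation F T f -> forall i, T i = 0) ->
  prolongation_rigid gm.
Proof.
move=> gm_s gF P0.
exists (semidirect F), (semidirect_grading gm_s gF), (semidirect_inl F).
split; first split.
- exact: semidirect_transitive.
- by move=> L gL iota tr; apply: (transitive_embeds gm_s gF tr P0).
- move=> k k0; apply/funext => -[x A]; apply/propext; split=> [[/= gx kA]|->].
    by rewrite /= kA ?gt_eqF // (gnla_nonneg gm_s (ltW k0) gx).
  exact: component0.
Qed.

(** * From sub-freeness to a frame *)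

Section FrameOfSubFree.
Variables (K : fieldType) (m : finLieAlgType K).

(** A [vspace] of maximal dimension inside [S] is all of [S], since a missing vector could be added
    to it. *)
Lemma vspace_of_subspace (S : classical_sets.set m) : subspace S ->
  exists U : {vspace m}, forall x, x \in U <-> S x.
Proof.
move=> [S0 SD]; pose P d := `[< exists2 U : {vspace m}, \dim U = d & forall x, x \in U -> S x >].
have exP : exists d, P d.
  exists 0%N; apply/asboolP; exists 0%VS; first by rewrite dimv0.
  by move=> x; rewrite memv0 => /eqP ->.
have ubP d : P d -> (d <= \dim {:m})%N.
  by move=> /asboolP[U <- _]; apply/dimvS/subvf.
case: (ex_maxnP exP ubP) => d /asboolP[U dU US] maxd.
exists U => x; split=> [/US//|Sx]; apply: contrapT => /negP xU.
have UV : (U <= U + <[x]>)%VS := addvSl _ _.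
have := dimv_leqif_sup UV; suff dV : (\dim (U + <[x]>) <= \dim U)%N.
  case=> _; rewrite eqn_leq dV dimvS //= => /esym/subvP VU.
  by move/negP: xU; apply; apply: VU; rewrite memvE addvSr.
rewrite dU; apply/maxd/asboolP; exists (U + <[x]>)%VS => // y.
move=> /memv_addP[u Uu [v /vlineP[c ->] ->]].
by rewrite addrC; apply: SD => //; apply/US.
Qed.

Lemma frame_of_sub_free (gm : grading m) : fundamental gm -> sub_free gm ->
  exists n (F : frame m n), graded_frame F gm.
Proof.
move=> [gen _] free; have [U US] := vspace_of_subspace (component_subspace gm (-1)).
pose e i := (vbasis U)`_i; pose n := \dim U.
have ge i : (i < n)%N -> gm (-1) (e i).
  by move=> iU; apply/US/vbasis_mem/mem_nth; rewrite size_tuple.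
have geS (c : 'I_n -> K) : gm (-1) (\sum_i c i *: e i).
  elim/big_rec: _ => [|i x _ gx]; first exact: component0.
  by apply: componentP => //; apply: ge.
have coordE x : gm (-1) x -> x = \sum_i coord (vbasis U) i x *: e i.
  by move/US/coord_vbasis.
have eF := basis_free (vbasisP U).
have /choice[D DE] (A : 'M[K]_n) : exists D : 'End(m), der0 gm D /\
    forall i : 'I_n, D (e i) = \sum_j A j i *: e j.
  pose f x := \sum_i coord (vbasis U) i x *: \sum_j A j i *: e j.
  have fl : linear f.
    move=> a x y; rewrite /f scaler_sumr -big_split /=; apply: eq_bigr => i _.
    by rewrite linearD linearZ /=; linear_arith.
  pose g : {linear m -> m} := HB.pack f (GRing.isLinear.Build _ _ _ _ f fl).
  have [|D HD DE] := free (linfun g).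
    move=> x _; rewrite lfunE /= /f; elim/big_rec: _ => [|i y _ gy]; first exact: component0.
    by apply: componentP.
  exists D; split=> // i; rewrite DE ?lfunE /=; last exact: ge.
  rewrite /f (bigD1 i) //= coord_free // eqxx scale1r.
  rewrite [X in _ + X]big1 ?addr0 // => j /negPf ji.
  by rewrite coord_free // eq_sym ji scale0r.
have ind : forall S : m -> Prop,
    S 0 -> (forall a x y, S x -> S y -> S (a *: x + y)) ->
    (forall i : 'I_n, S (e i)) -> (forall (i : 'I_n) x, S x -> S [lie e i, x]) ->
    forall x, S x.
  move=> S S0 SD Se SL.
  pose M x := forall S : m -> Prop,
    S 0 -> (forall a x y, S x -> S y -> S (a *: x + y)) ->
    (forall i : 'I_n, S (e i)) -> (forall (i : 'I_n) x, S x -> S [lie e i, x]) -> S x.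
  have M0 : M 0 by move=> ? *.
  have MD a x y : M x -> M y -> M (a *: x + y).
    move=> Mx My S' h0 hD hE hL.
    exact: (hD a x y (Mx S' h0 hD hE hL) (My S' h0 hD hE hL)).
  (* [M] is the span of right-normed brackets and is not visibly a subalgebra. The elements of [M]
     whose bracket preserves [M] form a subalgebra containing $\mathfrak g_{-1}$, hence
     everything. *)
  pose Q : classical_sets.set m := fun x => M x /\ forall y, M y -> M [lie x, y].
  have subQ : lie_subalgebra Q.
    split; first split.
    - by split=> // y _; rewrite lie0l.
    - move=> a x y [Mx Tx] [My Ty]; split; first exact: MD.
      by move=> z Mz; rewrite lieDl lieZl; apply: MD; [apply: Tx|apply: Ty].
    - move=> x y [Mx Tx] [My Ty]; split; first exact: Tx.
      move=> z Mz; rewrite lie_leibnizl addrC -scaleN1r.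
      by apply: MD; [exact: (Ty _ (Tx _ Mz))|exact: (Tx _ (Ty _ Mz))].
  have gQ x : gm (-1) x -> Q x.
    move=> /coordE ->; elim/big_rec: _ => [|i y _]; first by case: subQ.1.
    move=> Qy; apply: subQ.1.2 => //; split=> [S' h0 hD hE hL|y' My' S' h0 hD hE hL] //.
    exact: (hL i y' (My' S' h0 hD hE hL)).
  by move=> x; have [Mx _] : Q x; [rewrite (gen Q subQ gQ)|apply: Mx].
pose F : frame m n := Frame (fun A x y => (DE A).1.1 x y) (fun A i => (DE A).2 i) ind.
exists n, F; split=> [A k x gx|i|x /coordE E|c c0].
- exact: (DE A).1.2.
- exact: ge (ltn_ord i).
- by exists (fun i => coord (vbasis U) i x).
- by have /freeP free_e := eF; apply: free_e.
Qed.

Lemma component_act1 (gm : grading m) n (F : frame m n) t i :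
  graded_frame F gm -> gm (- (size t).+1%:Z) (mono F t i).
Proof.
move=> [_ ge _ _]; elim: t => [|j t IH]; first exact: ge.
rewrite /= (_ : - _ = -1 + - (size t).+1%:Z); last by lia.
exact: component_lie.
Qed.

End FrameOfSubFree.

(** The total weight is an eigenvalue of the identity matrix, which acts on a monomial by its
    length; nonzero monomials have length at most [s]. *)
Lemma graded_frame_bounded (K : numFieldType) (m : finLieAlgType K)
    (gm : grading m) (s n : nat) (F : frame m n) :
  gnla gm s -> graded_frame F gm ->
  forall a x, weight F a x -> s%:Z < \sum_i a i -> x = 0.
Proof.
move=> gm_s gF a x wx sa; apply: contrapT => /eqP nz.
pose C (c : K) := exists2 k : nat, (k <= s)%N & c = k%:R.
have [] : C (\sum_i a i)%:~R.
  apply: (@eigenvalue_mono _ _ _ F (act F 1%:M) C _ x _ (weight_total wx) nz).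
  move=> t i; exists (size t).+1%:R => [|nzm]; first exact: mono_degree.
  exists (size t).+1 => //.
  by have := gm_s.1 _ _ (component_act1 t i gF) nzm; lia.
by move=> k ks; rewrite pmulrn => /intr_inj E; move: sa; rewrite E; lia.
Qed.

(** Spanning families with the same linear relations take the place of bases, so that the brackets
    of generators can be indexed by all pairs, without ordering them. *)
Lemma onto_negative_part_of_bases (K : fieldType) (m L : lieAlgType K)
    (gm : grading m) (gL : grading L) (I : finType) (deg : I -> int)
    (X : I -> m) (Y : I -> L) :
  (forall i, gm (deg i) (X i)) -> (forall i, gL (deg i) (Y i)) ->
  (forall x, exists c, x = \sum_i c i *: X i) ->
  (forall k u, k < 0 -> gL k u -> exists c, u = \sum_(i | deg i == k) c i *: Y i) ->
  (forall c, \sum_i c i *: X i = 0 -> \sum_i c i *: Y i = 0) ->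
  (forall c, \sum_i c i *: Y i = 0 -> \sum_i c i *: X i = 0) ->
  (forall i j, exists c, [lie X i, X j] = \sum_k c k *: X k
      /\ [lie Y i, Y j] = \sum_k c k *: Y k) ->
  exists phi : {linear m -> L}, onto_negative_part gm gL phi.
Proof.
move=> gX gY spanX spanY XY YX brXY.
pose comb (M : lmodType K) (Z : I -> M) (c : I -> K) := \sum_i c i *: Z i.
have combP (M : lmodType K) (Z : I -> M) a c c' :
    comb M Z (fun i => a * c i + c' i) = a *: comb M Z c + comb M Z c'.
  rewrite scaler_sumr -big_split; apply: eq_bigr => i _.
  by rewrite scalerDl scalerA.
pose R x u := exists2 c, x = comb _ X c & u = comb _ Y c.
have [phi [Rphi phiR]] : exists phi : {linear m -> L},
    (forall x, R x (phi x)) /\ forall x u, R x u -> u = phi x.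
  apply: linear_of_relation => [a x y u v [c -> ->] [c' -> ->]|x|u [c /esym/XY c0 ->]] //.
    by exists (fun i => a * c i + c' i); rewrite combP.
  by have [c ->] := spanX x; exists (comb _ Y c), c.
have phiE c : phi (comb _ X c) = comb _ Y c by apply/esym/phiR; exists c.
have phiX i : phi (X i) = Y i.
  have E (M : lmodType K) (Z : I -> M) : Z i = comb M Z (fun j => (j == i)%:R).
    rewrite /comb (bigD1 i) //= eqxx scale1r big1 ?addr0 // => j /negPf ->.
    by rewrite scale0r.
  by rewrite [X i]E phiE -E.
exists phi; split=> [x y|x y xy|k k0].
- have [c ->] := spanX x; have [c' ->] := spanX y.
  rewrite !lie_suml !linear_sum /= lie_suml; apply: eq_bigr => i _.
  rewrite !lie_sumr linear_sum; apply: eq_bigr => j _ /=.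
  rewrite !linearZ /= !(lieZl, lieZr) !linearZ /= !phiX !scalerA mulrC.
  congr (_ *: _).
  by have [d [-> ->]] := brXY i j; apply: phiE.
- apply/eqP; rewrite -subr_eq0; apply/eqP.
  have [c E] := spanX (x - y); rewrite E; apply: YX.
  by have := phiE c; rewrite /comb -E linearB xy subrr => <-.
apply/funext => u; apply/propext; split=> [[x gx <-]|gu].
  have [c xE] := spanX x.
  (* Comparison of homogeneous parts: only the terms of degree [k] contribute to [x]. *)
  pose v j := \sum_(i | deg i == j) c i *: X i - (if j == k then x else 0).
  have gv j : gm j (v j).
    apply: componentD.
      elim/big_rec: _ => [|i y /eqP <- gy]; first exact: component0.
      exact: componentP.
    by apply: componentN; case: eqP => [->//|_]; apply: component0.
  pose r := undup (k :: [seq deg i | i <- enum I]).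
  have kr : k \in r by rewrite mem_undup mem_head.
  have sv : \sum_(j <- r) v j = 0.
    rewrite sumrB [X in _ - X](bigD1_seq k) ?undup_uniq //= eqxx.
    rewrite [X in _ - (_ + X)]big1 ?addr0 => [|j /negPf -> //]; rewrite {1}xE.
    apply/eqP; rewrite subr_eq0; apply/eqP/esym.
    rewrite (exchange_big_dep predT) //=; apply: eq_bigr => i _.
    have ir : deg i \in r by rewrite mem_undup inE map_f ?mem_enum ?orbT.
    rewrite big_mkcond (bigD1_seq (deg i)) ?undup_uniq //= eqxx big1 ?addr0 // => j.
    by rewrite eq_sym => /negPf ->.
  have := component_indep (undup_uniq _) gv sv kr.
  rewrite /v eqxx => /subr0_eq <-; rewrite linear_sum.
  elim/big_rec: _ => [|i y /eqP <- gy]; first exact: component0.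
  by rewrite linearZ /= phiX; apply: componentP.
have [c ->] := spanY k u k0 gu; exists (\sum_(i | deg i == k) c i *: X i).
  elim/big_rec: _ => [|i y /eqP <- gy]; first exact: component0.
  exact: componentP.
by rewrite linear_sum; apply: eq_bigr => i _; rewrite linearZ /= phiX.
Qed.

(** * The orthogonal Lie algebra *)

Section Orthogonal.
Variables (K : numFieldType) (N : nat).
Implicit Types (a b c d : 'I_N).
Local Notation rv := rev_ord.

(** The split symmetric form pairing the basis vectors [a] and [rv a]; for it the diagonal matrices
    of the orthogonal algebra form a Cartan subalgebra. *)
Definition antidiag : 'M[K]_N := \matrix_(a, b) (a == (rv b))%:R.

Definition so_defect (X : 'M[K]_N) := X^T *m antidiag + antidiag *m X.

Fact so_defect_is_linear : linear so_defect.
Proof.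
move=> k X Y; rewrite /so_defect linearP /= mulmxDl mulmxDr -scalemxAl -scalemxAr.
by rewrite scalerDr addrACA.
Qed.

HB.instance Definition _ := GRing.isLinear.Build K 'M[K]_N 'M[K]_N _
  so_defect so_defect_is_linear.

Definition so_space : {vspace 'M[K]_N} := lker (linfun so_defect).

Lemma rev_eq a b : ((rv a) == b) = (a == (rv b)).
Proof. by rewrite -(inj_eq rev_ord_inj) rev_ordK. Qed.

Lemma so_spaceP (X : 'M[K]_N) : reflect (forall a b, X a b = - X (rv b) (rv a)) (X \in so_space).
Proof.
have E a b : so_defect X a b = X (rv b) a + X (rv a) b.
  rewrite !mxE (bigD1 (rv b)) //= big1 => [|c /negPf cb].
    rewrite (bigD1 (rv a)) //= big1 => [|c /negPf ca].
      by rewrite !mxE rev_ordK !eqxx mulr1 mul1r !addr0.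
    by rewrite mxE eq_sym rev_eq ca mul0r.
  by rewrite !mxE cb mulr0.
rewrite memv_ker lfunE /=; apply: (iffP eqP) => [H a b|H].
  have /matrixP/(_ (rv a) b) := H; rewrite E rev_ordK mxE addrC => /eqP.
  by rewrite addr_eq0 => /eqP.
by apply/matrixP => a b; rewrite E [X (rv a) b]H rev_ordK subrr mxE.
Qed.

Definition so : Type := subvs_of so_space.

HB.instance Definition _ := Vector.on so.

Definition somx (X : so) : 'M[K]_N := vsval X.

Fact somx_is_linear : linear somx.
Proof. by move=> k X Y; rewrite /somx linearP. Qed.

HB.instance Definition _ := GRing.isLinear.Build K so 'M[K]_N _
  somx somx_is_linear.

Lemma somxP k X Y : somx (k *: X + Y) = k *: somx X + somx Y.
Proof. exact: somx_is_linear. Qed.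

Lemma somxZ k X : somx (k *: X) = k *: somx X.
Proof. exact: linearZ. Qed.

Lemma somxB X Y : somx (X - Y) = somx X - somx Y.
Proof. exact: linearB. Qed.

Lemma somx_inj : injective somx. Proof. exact: subvs_inj. Qed.

Lemma somx_rev (X : so) a b : somx X a b = - somx X (rv b) (rv a).
Proof. by move: a b; apply/so_spaceP/subvsP. Qed.

Definition mxso (X : 'M[K]_N) : so := vsproj so_space X.

Lemma mxsoK X : X \in so_space -> somx (mxso X) = X.
Proof. exact: vsprojK. Qed.

Definition so_lie (X Y : so) := mxso (somx X *m somx Y - somx Y *m somx X).

Lemma mul_rev (X Y : so) a b :
  (somx X *m somx Y) a b = (somx Y *m somx X) (rv b) (rv a).
Proof.
rewrite !mxE (reindex_inj rev_ord_inj) /=; apply: eq_bigr => c _.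
by rewrite (somx_rev X a) (somx_rev Y _ b) rev_ordK mulrNN mulrC.
Qed.

Lemma somx_lie X Y : somx (so_lie X Y) = somx X *m somx Y - somx Y *m somx X.
Proof.
apply/mxsoK/so_spaceP => a b; rewrite mxE [in RHS]mxE [X in _ + X]mxE.
by rewrite [X in _ = - (_ + X)]mxE -mul_rev -mul_rev opprB addrC.
Qed.

Fact so_lie_linearl k X Y Z : so_lie (k *: X + Y) Z = k *: so_lie X Z + so_lie Y Z.
Proof.
apply: somx_inj; rewrite somxP !somx_lie somxP.
by rewrite mulmxDl mulmxDr -scalemxAl -scalemxAr scalerBr opprD addrACA.
Qed.

Fact so_liexx X : so_lie X X = 0.
Proof. by apply: somx_inj; rewrite somx_lie subrr linear0. Qed.

Fact so_lie_linearr k X Y Z : so_lie Z (k *: X + Y) = k *: so_lie Z X + so_lie Z Y.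
Proof.
apply: somx_inj; rewrite somxP !somx_lie somxP.
by rewrite mulmxDl mulmxDr -scalemxAl -scalemxAr scalerBr opprD addrACA.
Qed.

Fact so_jacobi X Y Z :
  so_lie X (so_lie Y Z) + so_lie Y (so_lie Z X) + so_lie Z (so_lie X Y) = 0.
Proof.
apply: somx_inj; rewrite !linearD linear0 /= !somx_lie.
rewrite !mulmxBl !mulmxBr !mulmxA; apply/matrixP => i j; rewrite !mxE; ring.
Qed.

HB.instance Definition _ := Lmodule_isLieAlgebra.Build K so
  so_lie_linearl so_lie_linearr so_liexx so_jacobi.

Lemma so_lieE (X Y : so) : somx [lie X, Y] = somx X *m somx Y - somx Y *m somx X.
Proof. exact: somx_lie. Qed.

Definition so_delta a b : so := mxso (delta_mx a b - delta_mx (rv b) (rv a)).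
Local Notation F := so_delta.

Lemma somxF a b : somx (F a b) = delta_mx a b - delta_mx (rv b) (rv a).
Proof.
apply/mxsoK/so_spaceP => c d; rewrite !mxE !rev_eq !rev_ordK opprB.
by congr (_%:R - _%:R); rewrite andbC.
Qed.

Lemma F_rev a b : F a b = - F (rv b) (rv a).
Proof. by apply: somx_inj; rewrite linearN /= !somxF !rev_ordK opprB. Qed.

Lemma F_anti a : F a (rv a) = 0.
Proof. by apply: somx_inj; rewrite somxF rev_ordK subrr linear0. Qed.

(** The division by 2 accounts for every term occurring twice, since [F a b] is the opposite of
    [F (rv b) (rv a)]. *)
Lemma so_expand (X : so) : X = \sum_a \sum_b (somx X a b / 2%:R) *: F a b.
Proof.
apply: somx_inj; rewrite linear_sum /=; apply/matrixP => c d.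
have -> : (\sum_a somx (\sum_b (somx X a b / 2%:R) *: F a b)) c d =
  \sum_a \sum_b (somx X a b / 2%:R) * ((c == a) && (d == b))%:R -
  \sum_a \sum_b (somx X a b / 2%:R) * ((c == (rv b)) && (d == (rv a)))%:R.
  rewrite summxE -sumrB; apply: eq_bigr => a _.
  rewrite linear_sum summxE -sumrB; apply: eq_bigr => b _.
  by rewrite linearZ /= somxF !mxE; ring.
rewrite (bigD1 c) //= (bigD1 d) //= !eqxx big1 => [|b /negPf bd]; last first.
  by rewrite eq_sym bd mulr0.
rewrite big1 => [|a /negPf ac]; last by rewrite big1 // => b _; rewrite eq_sym ac mulr0.
rewrite (bigD1 (rv d)) //= (bigD1 (rv c)) //= !rev_ordK !eqxx big1 => [|b /negPf bd]; last first.
  by rewrite -rev_eq eq_sym bd mulr0.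
rewrite big1 => [|a /negPf ac]; last first.
  rewrite big1 // => b _; rewrite (_ : (d == rv a) = false) ?andbF ?mulr0 //.
  by rewrite -rev_eq eq_sym.
by rewrite [somx X (rv d) _]somx_rev !rev_ordK /=; field.
Qed.

Lemma lieFF a b c d : [lie F a b, F c d] =
  (b == c)%:R *: F a d - (a == d)%:R *: F c b
  - (b == (rv d))%:R *: F a (rv c) - ((rv a) == c)%:R *: F (rv b) d.
Proof.
apply: somx_inj; rewrite so_lieE !somxB !somxZ !somxF.
rewrite !mulmxBl !mulmxBr !mul_delta_mx_cond !rev_ordK.
rewrite !(inj_eq rev_ord_inj) (eq_sym d a) (eq_sym c b) (rev_eq c a) (eq_sym c (rv a)).
rewrite -(rev_eq d b) (eq_sym (rv d) b) -!scaler_nat.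
apply/matrixP => i j; rewrite !mxE; ring.
Qed.

End Orthogonal.

(** * Simplicity of the split odd orthogonal algebra *)

Section OddOrthogonal.
Variables (K : numFieldType) (r : nat).
Local Notation N := (r.*2.+1).
Local Notation so := (so K N).
Local Notation F := (@so_delta K N).
Local Notation rv := (@rev_ord N).
Implicit Types (a b c d i j : 'I_N) (X Y : so).

Definition mid : 'I_N := inord r.

Lemma midE : mid = r :> nat.
Proof. by rewrite /mid inordK //; lia. Qed.

Lemma rvE a : rv a = (r.*2 - a)%N :> nat.
Proof. by rewrite /= subSS. Qed.

Lemma F_mid : F mid mid = 0.
Proof. by rewrite -[X in F _ X](_ : rv mid = _) ?F_anti //; apply/val_inj; rewrite /= midE; lia. Qed.

Lemma F_midr a : F mid a = - F (rv a) mid.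
Proof.
rewrite F_rev; congr (- F _ _); apply/val_inj.
by rewrite /= midE; lia.
Qed.

Lemma lieF_mid a b : a != r :> nat -> b != r :> nat ->
  [lie F a mid, F mid b] = F a b.
Proof.
move=> ar br; rewrite lieFF.
have -> : (mid == rv b) = false.
  by apply/eqP => /(congr1 val); rewrite /= midE; have := ltn_ord b; lia.
have -> : (rv a == mid) = false.
  by apply/eqP => /(congr1 val); rewrite /= midE; have := ltn_ord a; lia.
by rewrite eqxx F_mid scaler0 !scale0r !subr0 scale1r.
Qed.

Lemma subalgebra_full (S : classical_sets.set so) : lie_subalgebra S ->
  (forall a, a != r :> nat -> S (F a mid)) -> S = classical_sets.setT.
Proof.
move=> [[S0 SP] SL] SF; apply/funext => X; apply/propext; split=> // _.
have SN Y : S Y -> S (- Y) by move=> SY; rewrite -scaleN1r -[_ *: _]addr0; apply: SP.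
have SFall a b : S (F a b).
  have [ar|ar] := eqVneq (a : nat) r.
    have -> : a = mid by apply/val_inj; rewrite /= midE.
    have [br|br] := eqVneq (b : nat) r.
      have -> : b = mid by apply/val_inj; rewrite /= midE.
      by rewrite F_mid.
    by rewrite F_midr; apply/SN/SF; rewrite /=; have := ltn_ord b; lia.
  have [br|br] := eqVneq (b : nat) r.
    by have -> : b = mid; [apply/val_inj; rewrite /= midE|apply: SF].
  rewrite -lieF_mid //; apply: SL; first exact: SF.
  by rewrite F_midr; apply/SN/SF; rewrite /=; have := ltn_ord b; lia.
rewrite (so_expand X); elim/big_rec: _ => // a Y _ SY.
rewrite -[\sum_b _]scale1r; apply: (SP 1) => //.
by elim/big_rec: _ => // b Z _ SZ; apply: SP.
Qed.

Lemma delta_mulmx (M : 'M[K]_N) a b i j :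
  (delta_mx a b *m M) i j = (i == a)%:R * M b j.
Proof.
rewrite mxE (bigD1 b) //= big1 => [|c /negPf cb]; last by rewrite mxE cb andbF mul0r.
by rewrite mxE eqxx andbT addr0.
Qed.

Lemma mulmx_delta (M : 'M[K]_N) a b i j :
  (M *m delta_mx a b) i j = (j == b)%:R * M i a.
Proof.
rewrite mxE (bigD1 a) //= big1 => [|c /negPf ca]; last by rewrite mxE ca mulr0.
by rewrite mxE eqxx addr0 mulrC.
Qed.

Lemma lieF_entry a b X i j : somx [lie F a b, X] i j =
  (i == a)%:R * somx X b j - (i == rv b)%:R * somx X (rv a) j
  - (j == b)%:R * somx X i a + (j == rv a)%:R * somx X i (rv b).
Proof.
rewrite so_lieE somxF mulmxBl mulmxBr.
rewrite !(delta_mulmx, mulmx_delta, mxE).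
ring.
Qed.

(** The condition for [F a b] to be a root vector of a long root. *)
Definition long a b := [&& a != r :> nat, b != r :> nat, a != b :> nat & (a + b != r.*2)%N].

(** Adding a long root $\beta$ twice to a root leads to a root only from $-\beta$. The square of the
    adjoint action thus projects onto the line of [F a b] and reads off the opposite coordinate. *)
Lemma long_square a b X : long a b ->
  [lie F a b, [lie F a b, X]] = (- 2%:R * somx X b a) *: F a b.
Proof.
move=> /and4P[ar br ab ab2]; apply: somx_inj; apply/matrixP => i j.
rewrite somxZ mxE somxF !lieF_entry !mxE.
have ha := ltn_ord a; have hb := ltn_ord b.
have E (x y : 'I_N) : (x : nat) <> y -> (x == y) = false.
  by move=> xy; apply/eqP => E; apply: xy; rewrite E.
rewrite ?eqxx ?(E b a) ?(E a b) ?(E b (rv b)) ?(E (rv a) a) ?(E (rv a) (rv b)) ?(E a (rv b)) ?(E b (rv a)) ?(E (rv b) (rv a)) ?(E (rv b) b) ?(E a (rv a)) ?(E (rv a) b) ?(E (rv b) a) /=; try lia.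
have E1 : somx X b (rv b) = 0.
  by have /eqP := somx_rev X b (rv b); rewrite rev_ordK -addr_eq0 -mulr2n mulrn_eq0 => /eqP.
have E2 : somx X (rv a) a = 0.
  by have /eqP := somx_rev X (rv a) a; rewrite rev_ordK -addr_eq0 -mulr2n mulrn_eq0 => /eqP.
have E3 : somx X (rv a) (rv b) = - somx X b a by rewrite somx_rev !rev_ordK.
rewrite E1 E2 E3; case: (i == a); case: (i == rv b); case: (j == b); case: (j == rv a); rewrite /=; try ring.
Qed.

Lemma ord_neq a b : (a : nat) <> b -> (a == b) = false.
Proof. by move=> ab; apply/eqP => E; apply: ab; rewrite E. Qed.

Hypothesis r_gt1 : (1 < r)%N.

Lemma so_simple : lie_simple so.
Proof.
split.
  have [a a0] : exists a : 'I_N, a = 0%N :> nat by exists ord0.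
  exists (F a mid), (F mid a).
  rewrite lieF_mid; [|by rewrite a0; lia..].
  apply/eqP => /(congr1 (@somx K N))/matrixP/(_ a a).
  rewrite somxF linear0 !mxE !eqxx ord_neq /=; last by rewrite /= a0; lia.
  by move/eqP; rewrite subr0 oner_eq0.
move=> S [[S0 SP] SI].
have SN Y : S Y -> S (- Y) by move=> SY; rewrite -scaleN1r -[_ *: _]addr0; apply: SP.
have SI' Y Z : S Y -> S [lie Y, Z] by move=> SY; rewrite lieC; apply/SN/SI.
have [[X [SX nzX]]|S_0] := EM (exists X, S X /\ X != 0); last first.
  left; apply/funext => X; apply/propext; split=> [SX|->] //.
  by apply: contrapT => /eqP nz; apply: S_0; exists X.
right.
have Slong Y a b : S Y -> long a b -> somx Y b a != 0 -> S (F a b).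
  move=> SY ab nz; have := SI (F a b) _ (SI (F a b) _ SY).
  rewrite long_square //; set k := _ * _ => SF.
  have -> : F a b = k^-1 *: (k *: F a b) + 0.
    by rewrite addr0 scalerA mulVf ?scale1r // mulf_neq0 // oppr_eq0 pnatr_eq0.
  exact: SP.
have other a : a != r :> nat -> exists b, long a b.
  move=> ar; have ha := ltn_ord a.
  have [a0|a0] := boolP ((a == 0 :> nat) || (a == r.*2 :> nat)).
    have h1 : (1 < N)%N by lia.
    by exists (Ordinal h1); rewrite /long /=; move: a0 ar; lia.
  by exists ord0; rewrite /long /=; move: a0 ar; lia.
have mid0 Y : somx Y mid mid = 0.
  have /eqP := somx_rev Y mid mid; rewrite (_ : rv mid = mid); last by apply/val_inj; rewrite /= midE; lia.
  by rewrite -addr_eq0 -mulr2n mulrn_eq0 => /eqP.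
have diag Y a : S Y -> a != r :> nat -> somx Y a a != 0 -> exists a b, long a b /\ S (F a b).
  move=> SY ar nz; have [b0 ab0] := other a ar; have ha := ltn_ord a.
  (* Mirrored indices carry opposite diagonal entries, so [b0] or its mirror differs from the entry
     at [a]. *)
  have [b ab nb] : exists2 b, long a b & somx Y b b != somx Y a a.
    have [E|] := eqVneq (somx Y b0 b0) (somx Y a a); last by exists b0.
    exists (rv b0).
      by move: ab0; rewrite /long /=; have := ltn_ord b0; lia.
    by rewrite somx_rev rev_ordK E eq_sym -addr_eq0 -mulr2n mulrn_eq0.
  exists b, a; have hb := ltn_ord b; split; first by move: ab; rewrite /long; lia.
  apply: (Slong _ _ _ (SI (F a b) _ SY)); first by move: ab; rewrite /long; lia.
  rewrite lieF_entry !eqxx !ord_neq /=; first by rewrite !mul0r !mul1r subr0 addr0 subr_eq0.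
    by move: ab; rewrite /long; lia.
  by move: ab; rewrite /long; lia.
have side Y a : S Y -> a != r :> nat -> somx Y a mid != 0 -> exists a b, long a b /\ S (F a b).
  move=> SY ar nz; have [c ac] := other a ar; have ha := ltn_ord a.
  exists c, a; have hc := ltn_ord c; split; first by move: ac; rewrite /long; lia.
  apply: (Slong _ _ _ (SI (F mid c) _ SY)); first by move: ac; rewrite /long; lia.
  rewrite lieF_entry !eqxx !ord_neq /= ?midE; try by move: ac; rewrite /long; lia.
  by rewrite !mul0r mul1r subr0 addr0 add0r oppr_eq0.
have [a [b [ab SF]]] : exists a b, long a b /\ S (F a b).
  have [i [j nz]] : exists i j, somx X i j != 0.
    apply: contrapT => H; move/eqP: nzX; apply; apply: somx_inj; rewrite linear0.
    apply/matrixP => i j; rewrite mxE; apply: contrapT => /eqP nz.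
    by apply: H; exists i, j.
  have hi := ltn_ord i; have hj := ltn_ord j.
  have [ir|ir] := eqVneq (i : nat) r.
    have iE : i = mid by apply/val_inj; rewrite /= midE.
    have jr : j != r :> nat.
      by apply/eqP => jr; move: nz; rewrite (_ : j = mid) ?iE ?mid0 ?eqxx //; apply/val_inj; rewrite /= midE.
    apply: (side X (rv j) SX); first by rewrite /=; move: jr; lia.
    by move: nz; rewrite somx_rev iE oppr_eq0 (_ : rv mid = mid) //; apply/val_inj; rewrite /= midE; lia.
  have [jr|jr] := eqVneq (j : nat) r.
    by have jE : j = mid; [apply/val_inj; rewrite /= midE|apply: (side X i SX ir); rewrite -jE].
  have [ij|ij] := eqVneq (i : nat) j; first by apply: (diag X i SX ir); rewrite {2}(val_inj ij).
  exists j, i; have L : long j i.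
    rewrite /long ir jr eq_sym ij /=; apply: contraNneq nz => ij2.
    have -> : j = rv i by apply/val_inj; rewrite /=; lia.
    have /eqP := somx_rev X i (rv i).
    by rewrite rev_ordK -addr_eq0 -mulr2n mulrn_eq0.
  by split=> //; apply: Slong nz.
have ha := ltn_ord a; have hb := ltn_ord b.
(* The semisimple element $[F_{cd},F_{dc}]$ fixes the short root vector [F c mid]. *)
have Smid c d : long c d -> S (F c d) -> S (F c mid).
  move=> cd Scd; have hc := ltn_ord c; have hd := ltn_ord d.
  have -> : F c mid = [lie [lie F c d, F d c], F c mid].
    rewrite lieFF !eqxx !ord_neq /=; try by move: cd; rewrite /long; lia.
    rewrite !scale1r !scale0r !subr0 lieBl !lieFF !eqxx !ord_neq /= ?midE; try by move: cd; rewrite /long; lia.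
    by rewrite !scale1r !scale0r !subr0.
  exact/SI'/SI'.
have Sa := Smid _ _ ab SF.
have Sc c : (c : nat) <> r -> (c : nat) <> rv a -> S (F c mid).
  move=> cr ca; have hc := ltn_ord c.
  have -> : F c mid = [lie F c a, F a mid].
    by rewrite lieFF !eqxx !ord_neq /= ?midE; [rewrite !scale1r !scale0r !subr0|move: ab ca; rewrite /long /=; lia..].
  exact: SI.
apply: subalgebra_full => [|c cr].
  by split=> // Y Z SY SZ; apply: SI.
(* The index [rv a] cannot be reached from [a], because [F (rv a) a] is zero; it is reached through
   [b]. *)
have [ca|ca] := eqVneq c (rv a); last first.
  by apply: Sc; [apply/eqP|move=> E; move/eqP: ca; apply; apply/val_inj].
have Sb : S (F b mid) by apply: Sc; move: ab; rewrite /long /=; lia.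
have hc := ltn_ord c; have cE := congr1 val ca; rewrite /= in cE.
have -> : F c mid = [lie F c b, F b mid].
  by rewrite lieFF !eqxx !ord_neq /= ?midE; [rewrite !scale1r !scale0r !subr0|move: ab cE; rewrite /long /=; lia..].
exact: SI.
Qed.

End OddOrthogonal.

(** * Chevalley generators of type B *)

Section OddOrthogonalGrading.
Variables (K : numFieldType) (r : nat).
Local Notation N := (r.*2.+1).
Local Notation so := (so K N).
Local Notation F := (@so_delta K N).
Local Notation rv := (@rev_ord N).
Local Notation mid := (mid r).
Implicit Types (a b c d i j : 'I_N) (X Y : so).

Definition up (k : nat) : 'I_N := inord k.

Lemma upE k : (k <= r.*2)%N -> up k = k :> nat.
Proof. by move=> kr; rewrite /up inordK. Qed.

Lemma up_eq k l : (k <= r.*2)%N -> (l <= r.*2)%N -> (up k == up l) = (k == l).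
Proof. by move=> kr lr; rewrite -val_eqE /= !upE. Qed.

Lemma rv_up_eq k l : (k <= r.*2)%N -> (l <= r.*2)%N ->
  (rv (up k) == up l) = (k + l == r.*2)%N.
Proof. by move=> kr lr; rewrite -val_eqE /= !upE //; lia. Qed.

Lemma up_rv_eq k l : (k <= r.*2)%N -> (l <= r.*2)%N ->
  (up k == rv (up l)) = (k + l == r.*2)%N.
Proof. by move=> kr lr; rewrite -val_eqE /= !upE //; lia. Qed.

Lemma lieF_diag a c d : [lie F a a, F c d] =
  ((a == c)%:R - (a == d)%:R + (rv a == d)%:R - (rv a == c)%:R) *: F c d.
Proof.
rewrite lieFF -(rev_eq a d).
have -> : (a == c)%:R *: F a d = (a == c)%:R *: F c d :> so.
  by case: eqVneq => [->|_] //; rewrite !scale0r.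
have -> : (a == d)%:R *: F c a = (a == d)%:R *: F c d :> so.
  by case: eqVneq => [->|_] //; rewrite !scale0r.
have -> : (rv a == c)%:R *: F (rv a) d = (rv a == c)%:R *: F c d :> so.
  by case: eqVneq => [->|_] //; rewrite !scale0r.
have -> : (rv a == d)%:R *: F a (rv c) = - (rv a == d)%:R *: F c d :> so.
  case: eqVneq => [<-|_]; last by rewrite oppr0 !scale0r.
  by rewrite F_rev rev_ordK scaleNr scalerN.
linear_arith.
Qed.

(** The last simple root is short, and without the factor 2 its generators would produce half of the
    coroot. *)
Definition coroot_scale (i : 'I_r) : K := if i.+1 == r then 2%:R else 1.

Definition gen_e (i : 'I_r) : so := F (up i) (up i.+1).
Definition gen_f (i : 'I_r) : so := coroot_scale i *: F (up i.+1) (up i).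

Lemma gen_h (i : 'I_r) : [lie gen_e i, gen_f i] =
  coroot_scale i *: (F (up i) (up i) - F (up i.+1) (up i.+1)).
Proof.
have ir := ltn_ord i; rewrite lieZr lieFF !eqxx up_rv_eq ?rv_up_eq; try lia.
have -> : (i.+1 + i == r.*2)%N = false by lia.
have -> : (i + i.+1 == r.*2)%N = false by lia.
by rewrite /= !scale0r !subr0 !scale1r.
Qed.

Ltac nat_kronecker := repeat match goal with
  | |- context [?x == ?y :> nat] =>
    first [have -> : (x == y) = true by lia | have -> : (x == y) = false by lia]
  end.

Lemma lie_gen_h (i j : 'I_r) (k l : nat) :
  (k == i) && (l == i.+1) || (k == i.+1) && (l == i) ->
  [lie [lie gen_e j, gen_f j], F (up k) (up l)] =
    ((if k == i then 1 else -1) * cartan_B r i j)%:~R *: F (up k) (up l).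
Proof.
move=> kl; have ir := ltn_ord i; have jr := ltn_ord j.
rewrite gen_h lieZl lieBl !lieF_diag -scalerBl scalerA !up_eq ?rv_up_eq; try lia.
congr (_ *: _); rewrite mxE /coroot_scale -val_eqE /=.
have [ij|ij] := eqVneq (i : nat) j.
  have [jr1|jr1] := eqVneq j.+1 r; case/orP: kl => /andP[/eqP-> /eqP->];
  nat_kronecker; rewrite /=; ring.
have [ij1|ij1] := eqVneq (j : nat) i.+1.
  have [jr1|jr1] := eqVneq j.+1 r; case/orP: kl => /andP[/eqP-> /eqP->];
  nat_kronecker; rewrite /=; ring.
have [ij2|ij2] := eqVneq (i : nat) j.+1.
  have [jr1|jr1] := eqVneq j.+1 r; first by lia.
  case/orP: kl => /andP[/eqP-> /eqP->]; nat_kronecker; rewrite /=; ring.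
have [jr1|jr1] := eqVneq j.+1 r; case/orP: kl => /andP[/eqP-> /eqP->];
  nat_kronecker; rewrite /=; ring.
Qed.

Lemma so_chevalley : chevalley_generators (cartan_B r) gen_e gen_f.
Proof.
split.
- move=> S subS SX; have [[S0 SP] SL] := subS.
  have SZ k Y : S Y -> S (k *: Y) by move=> SY; rewrite -[_ *: _]addr0; apply: SP.
  have Se (i : 'I_r) : S (F (up i) (up i.+1)) by apply: SX; left; exists i.
  have Sf (i : 'I_r) : S (F (up i.+1) (up i)).
    have -> : F (up i.+1) (up i) = (coroot_scale i)^-1 *: gen_f i.
      rewrite scalerA mulVf ?scale1r // /coroot_scale.
      by case: ifP => _; rewrite ?pnatr_eq0 ?oner_eq0.
    by apply/SZ/SX; right; exists i.
  have Smid p k : (k + p.+1 = r)%N -> S (F (up k) mid) /\ S (F mid (up k)).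
    elim: p k => [|p IH] k kr.
      have kr' : (k < r)%N by lia.
      have := Se (Ordinal kr'); have := Sf (Ordinal kr').
      by rewrite /= (_ : k.+1 = r); [split|lia].
    have kr' : (k < r)%N by lia.
    have [Sk1 Sk2] := IH k.+1 ltac:(lia).
    have := SL _ _ (Se (Ordinal kr')) Sk1; have := SL _ _ Sk2 (Sf (Ordinal kr')).
    rewrite !lieFF /= !eqxx /mid -/(up r) !up_eq ?rv_up_eq ?up_rv_eq; try lia.
    by nat_kronecker; rewrite !scale0r !subr0 !scale1r.
  apply: subalgebra_full => // a ar; have ha := ltn_ord a.
  have [lt_ar|gt_ar] := ltnP a r.
    have [] := Smid (r - a.+1)%N a ltac:(lia).
    by rewrite (_ : up a = a) //; apply/val_inj; rewrite /= upE //; lia.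
  have [] := Smid (a - r.+1)%N (r.*2 - a)%N ltac:(lia) => _.
  rewrite (_ : up _ = rv a); last by apply/val_inj; rewrite /= upE //; lia.
  by rewrite F_midr rev_ordK => /(SZ (-1)); rewrite scaleN1r opprK.
- move=> i j; rewrite !gen_h !(lieZl, lieZr, lieBl, lieBr) !lieF_diag.
  have E a c : ((a == c)%:R - (a == c)%:R + (rv a == c)%:R - (rv a == c)%:R) = 0 :> K by ring.
  by rewrite !E !scale0r !(subr0, scaler0).
- move=> i j ij; rewrite lieZr lieFF !up_eq ?rv_up_eq ?up_rv_eq; try (have := ltn_ord i; have := ltn_ord j; lia).
  have := ltn_ord i; have := ltn_ord j; move=> jr ir; have {}ij : i <> j :> nat by move/val_inj/eqP; apply/negP.
  by nat_kronecker; rewrite !scale0r !subr0 scaler0.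
- by move=> i j; have := @lie_gen_h i j i i.+1; rewrite !eqxx mul1r => ->.
- move=> i j; have := @lie_gen_h i j i.+1 i.
  rewrite !eqxx orbT (gtn_eqF (ltnSn i)) mulN1r intrN => /(_ isT) E.
  by rewrite lieZr E !scalerA mulrC.
Qed.

End OddOrthogonalGrading.

(** * The grading of type B and its negative part *)

Section ParabolicB.
Variables (K : numFieldType) (r : nat).
Local Notation N := (r.*2.+1).
Local Notation so := (so K N).
Local Notation F := (@so_delta K N).
Local Notation rv := (@rev_ord N).
Local Notation mid := (mid r).
Local Notation up := (up r).
Implicit Types (a b : 'I_N) (X Y : so).

(* The weight of the basis vector [a] under the grading element of [p_r]. *)
Definition wd a : int := if (a < r)%N then 1 else if a == r :> nat then 0 else -1.

Lemma wd_rev a : wd (rv a) = - wd a.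
Proof.
rewrite /wd rvE; have := ltn_ord a; move: (nat_of_ord a) => k kN.
have [kr|kr|->] := ltngtP k r.
- have -> : (r.*2 - k < r)%N = false by apply/negbTE; rewrite -leqNgt; lia.
  by have -> : (r.*2 - k == r)%N = false by apply/negbTE/eqP; lia.
- by have -> : (r.*2 - k < r)%N by lia.
- have -> : (r.*2 - r)%N = r by lia.
  by rewrite ltnn eqxx oppr0.
Qed.

Lemma wd_up k : (k < r)%N -> wd (up k) = 1.
Proof. by move=> kr; rewrite /wd upE ?kr //; lia. Qed.

Lemma wd_mid : wd mid = 0.
Proof. by rewrite /wd midE ltnn eqxx. Qed.

Definition so_component (k : int) : classical_sets.set so :=
  fun X => forall a b, somx X a b != 0 -> wd a - wd b = k.

Fact so_component_subspace k : subspace (so_component k).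
Proof.
split=> [a b|l X Y gX gY a b]; first by rewrite linear0 mxE eqxx.
rewrite somxP !mxE; have [X0|/gX //] := eqVneq (somx X a b) 0.
by rewrite X0 mulr0 add0r => /gY.
Qed.

Fact so_component_span X : exists (s : seq int) (u : int -> so),
  (forall k, so_component k (u k)) /\ X = \sum_(k <- s) u k.
Proof.
pose M k : 'M[K]_N := \matrix_(a, b) ((wd a - wd b == k)%:R * somx X a b).
have MK k : somx (mxso (M k)) = M k.
  apply/mxsoK/so_spaceP => a b; rewrite !mxE !wd_rev opprK addrC -mulrN.
  by rewrite -somx_rev.
exists [:: -2; -1; 0; 1; 2], (fun k => mxso (M k)); split=> [k a b|].
  by rewrite MK mxE; case: (wd a - wd b =P k) => //= _; rewrite mul0r eqxx.
apply: somx_inj; rewrite linear_sum /=; under eq_bigr => k _ do rewrite MK.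
apply/matrixP => a b; rewrite summxE (bigD1_seq (wd a - wd b)) //=.
  rewrite mxE eqxx mul1r big1 ?addr0 // => k; rewrite mxE eq_sym => /negPf ->.
  by rewrite mul0r.
by rewrite /wd; do 4 (case: ifP => _ //).
Qed.

Fact so_component_indep (s : seq int) (u : int -> so) : uniq s ->
  (forall k, so_component k (u k)) -> \sum_(k <- s) u k = 0 ->
  forall k, k \in s -> u k = 0.
Proof.
move=> Us gu su k ks; apply: somx_inj; rewrite linear0.
apply/matrixP => a b; rewrite [RHS]mxE; apply: contrapT => /eqP nz.
have wk := gu k a b nz; move/eqP: nz; apply.
have := congr1 (fun X => somx X a b) su; rewrite linear0 linear_sum /= mxE summxE.
rewrite (bigD1_seq k) //= big1 ?addr0 // => j jk; apply: contrapT => /eqP/gu.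
by rewrite wk => kj; rewrite kj eqxx in jk.
Qed.

Fact so_component_lie k l X Y :
  so_component k X -> so_component l Y -> so_component (k + l) [lie X, Y].
Proof.
move=> gX gY a b; apply: contraNeq => ne; rewrite so_lieE !mxE.
rewrite !big1 ?subrr // => c _; apply/eqP; rewrite mulf_eq0; apply: contraTT ne;
  rewrite negb_or => /andP[]; rewrite negbK.
  by move=> /gY <- /gX <-; apply/eqP; ring.
by move=> /gX <- /gY <-; apply/eqP; ring.
Qed.

Definition so_grading : grading so :=
  Grading so_component_subspace so_component_span so_component_indep so_component_lie.

Lemma F_component k a b : wd a - wd b = k -> so_grading k (F a b).
Proof.
move=> <- i j; rewrite somxF !mxE.
have [/andP[/eqP-> /eqP->] //|_] := boolP ((i == a) && (j == b)).
have [/andP[/eqP-> /eqP->] _|_] := boolP ((i == rv b) && (j == rv a)).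
  by rewrite !wd_rev; ring.
by rewrite subrr eqxx.
Qed.

Definition so_neg (i : 'I_r + 'I_r * 'I_r) : so :=
  match i with
  | inl i => F mid (up i)
  | inr (i, j) => [lie F mid (up i), F mid (up j)]
  end.

Definition deg_neg (i : 'I_r + 'I_r * 'I_r) : int := if i is inl _ then -1 else -2.

Lemma so_neg2 (i j : 'I_r) : so_neg (inr (i, j)) = - F (rv (up i)) (up j).
Proof.
have ir := ltn_ord i; have jr := ltn_ord j; rewrite /= lieFF.
rewrite ord_neq ?(@ord_neq r mid) ?(@ord_neq r (up i) (rv _)); rewrite ?midE /= ?upE ?midE; try lia.
rewrite (_ : rv mid == mid); last by apply/eqP/val_inj; rewrite /= midE; lia.
by rewrite !scale0r !sub0r subr0 oppr0 add0r scale1r.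
Qed.

Lemma so_neg_component i : so_grading (deg_neg i) (so_neg i).
Proof.
case: i => [i|[i j]]; first by apply: F_component; rewrite wd_mid wd_up.
rewrite so_neg2; apply/componentN/F_component; rewrite wd_rev !wd_up //.
Qed.

Lemma so_neg_span k X : k < 0 -> so_grading k X ->
  exists c, X = \sum_(i | deg_neg i == k) c i *: so_neg i.
Proof.
move=> k0 gX; pose P Z := exists c, Z = \sum_(i | deg_neg i == k) c i *: so_neg i.
have PP l Y Z : P Y -> P Z -> P (l *: Y + Z).
  move=> [c ->] [c' ->]; exists (fun i => l * c i + c' i).
  rewrite scaler_sumr -big_split; apply: eq_bigr => i _ /=.
  by rewrite scalerDl scalerA.
have P0 : P 0 by exists (fun=> 0); rewrite big1 // => i _; rewrite scale0r.
have Pneg i : deg_neg i = k -> P (so_neg i).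
  move=> ik; exists (fun j => (j == i)%:R); rewrite (bigD1 i) ?ik //= eqxx scale1r.
  by rewrite big1 ?addr0 // => j /andP[_ /negPf ->]; rewrite scale0r.
have PN Z : P Z -> P (- Z) by move=> PZ; rewrite -scaleN1r -[_ *: _]addr0; apply: PP.
have ord_up a : (a < r)%N -> exists2 i : 'I_r, a = up i & (i : nat) = a.
  by move=> ar; exists (Ordinal ar) => //; apply/val_inj; rewrite /= upE //=; lia.
have PF a b : wd a - wd b = k -> P (F a b).
  move=> abk.
  have [ar|ar|ar] := ltngtP (a : nat) r.
  - have : wd a = 1 by rewrite /wd ar.
    move=> wa; move: abk k0; rewrite wa /wd; case: ifP => _; first by move=> <-; lia.
    by case: ifP => _ <-; lia.
  - have [i iE ia] : exists2 i : 'I_r, rv a = up i & (i : nat) = rv a.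
      by apply: ord_up; rewrite /=; have := ltn_ord a; lia.
    have wa : wd a = -1 by rewrite -[a]rev_ordK wd_rev iE wd_up.
    have [br|br|br] := ltngtP (b : nat) r.
    + have [j jE jb] := ord_up b br.
      rewrite -[a]rev_ordK iE jE -[F _ _]opprK -so_neg2; apply/PN/Pneg.
      by rewrite -abk wa jE wd_up.
    + by move: abk k0; rewrite wa /wd (ltnNge b) (ltnW br) (gtn_eqF br) /= => <-; lia.
    + have -> : b = mid by apply/val_inj; rewrite /= midE.
      rewrite -[a]rev_ordK -[F _ _]opprK -F_midr iE; apply/PN/(Pneg (inl i)).
      rewrite -abk wa; have -> : b = mid by apply/val_inj; rewrite /= midE.
      by rewrite wd_mid subr0.
  - have aE : a = mid by apply/val_inj; rewrite /= midE.
    have [br|br|br] := ltngtP (b : nat) r.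
    + have [j jE jb] := ord_up b br; rewrite aE jE; apply: (Pneg (inl j)).
      by rewrite -abk aE wd_mid jE wd_up.
    + by move: abk k0; rewrite aE wd_mid /wd (ltnNge b) (ltnW br) (gtn_eqF br) /= => <-; lia.
    + by move: abk k0; rewrite aE wd_mid /wd br ltnn eqxx => <-; lia.
rewrite (so_expand X); elim/big_rec: _ => // a Y _ PY.
rewrite -[\sum_b _]scale1r; apply: (PP 1) => //.
elim/big_rec: _ => // b Z _ PZ.
have [X0|/gX/PF PFab] := eqVneq (somx X a b) 0; last exact: (PP).
by rewrite X0 mul0r scale0r add0r.
Qed.

Lemma so_neg_lie12 (i : 'I_r) (p : 'I_r * 'I_r) :
  [lie so_neg (inl i), so_neg (inr p)] = 0.
Proof.
case: p => k l; have := ltn_ord i; have := ltn_ord k; have := ltn_ord l => lr kr ir.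
rewrite so_neg2 /= lieNr lieFF rev_ordK !ord_neq ?oppr0; rewrite ?upE ?midE /= ?upE ?midE; try lia.
by rewrite !scale0r !subr0 oppr0.
Qed.

Lemma so_neg_lie22 (p q : 'I_r * 'I_r) : [lie so_neg (inr p), so_neg (inr q)] = 0.
Proof.
case: q p => k l p; rewrite [so_neg (inr (k, l))]/= lie_leibniz.
rewrite (lieC _ (F mid (up k))) -!/(so_neg (inl _)) so_neg_lie12 oppr0 lie0l add0r.
by rewrite (lieC _ (so_neg (inl l))) so_neg_lie12 oppr0 lie0r.
Qed.

Lemma sum_delta (T : finType) (c : T -> K) y : \sum_x c x * (x == y)%:R = c y.
Proof.
rewrite (bigD1 y) //= eqxx mulr1 big1 ?addr0 // => x /negPf ->.
by rewrite mulr0.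
Qed.

(** An entry in row [mid] isolates one coefficient of degree $-1$. The entry at [rv (up j)], [up i]
    isolates the difference of the coefficients of the pairs $(i,j)$ and $(j,i)$. *)
Lemma so_neg_indep c : \sum_i c i *: so_neg i = 0 ->
  (forall i, c (inl i) = 0) /\ forall i j, c (inr (i, j)) = c (inr (j, i)).
Proof.
rewrite big_sumType /= => E.
have entry a b : \sum_i c (inl i) * somx (so_neg (inl i)) a b
    + \sum_p c (inr p) * somx (so_neg (inr p)) a b = 0.
  have somx_sum (T : finType) (g : T -> so) :
      somx (\sum_x g x) a b = \sum_x somx (g x) a b.
    by rewrite (linear_sum (@somx K N)) summxE.
  transitivity (somx (\sum_i c (inl i) *: so_neg (inl i)
      + \sum_p c (inr p) *: so_neg (inr p)) a b); last by rewrite E linear0 mxE.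
  rewrite (linearD (@somx K N)) [RHS]mxE !somx_sum.
  by congr (_ + _); apply: eq_bigr => x _; rewrite somxZ [RHS]mxE.
have ur (k : 'I_r) : (k <= r.*2)%N by have := ltn_ord k; lia.
have mur (k : 'I_r) : (mid == up k) = false.
  by apply: ord_neq; rewrite midE upE //; have := ltn_ord k; lia.
have murv (k : 'I_r) : (mid == rv (up k)) = false.
  by apply: ord_neq; rewrite midE /= upE //; have := ltn_ord k; lia.
have inr_entry (p : 'I_r * 'I_r) a b : somx (so_neg (inr p)) a b =
    (a == rv (up p.2))%:R * (b == up p.1)%:R - (a == rv (up p.1))%:R * (b == up p.2)%:R.
  case: p => k l; rewrite so_neg2 linearN /= somxF !mxE rev_ordK.
  by rewrite -!mulnb !natrM; ring.
split=> [i|i j].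
  have := entry mid (up i); rewrite [X in _ + X]big1 ?addr0 => [|p _]; last first.
    by rewrite inr_entry !murv !mul0r subr0 mulr0.
  under eq_bigr => k _.
    rewrite /= somxF !mxE murv eqxx /= subr0 up_eq //.
  over.
  under eq_bigr => k _ do rewrite eq_sym [(_ == _)](_ : _ = (k == i)) //.
  by rewrite sum_delta.
have := entry (rv (up j)) (up i); rewrite big1 ?add0r => [|k _]; last first.
  rewrite /= somxF !mxE -!(eq_sym mid) murv.
  rewrite (_ : rv mid = mid); last by apply/val_inj; rewrite /= midE; lia.
  by rewrite (eq_sym (up i) mid) mur andbF subrr mulr0.
under eq_bigr => p _.
  rewrite inr_entry !(inj_eq rev_ord_inj) !up_eq //.
  rewrite (_ : _ - _ = (p == (i, j))%:R - (p == (j, i))%:R); last first.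
    case: p => k l; rewrite !xpair_eqE -!mulnb !natrM.
    by rewrite !(eq_sym k) !(eq_sym l) -!val_eqE; ring.
  rewrite mulrBr.
over.
by rewrite sumrB !sum_delta => /subr0_eq.
Qed.

Lemma so_parabolic : (1 < r)%N ->
  maximal_parabolic_grading (cartan_B r) r so_grading.
Proof.
move=> r_gt1; split; first exact: so_simple.
exists (@gen_e K r), (@gen_f K r); split; first exact: so_chevalley.
move=> i /=; have ir := ltn_ord i.
have H : wd (up i) - wd (up i.+1) = (i.+1 == r)%:Z.
  rewrite wd_up //; have [->|ne] := eqVneq i.+1 r; first by rewrite wd_mid.
  by rewrite wd_up ?subrr // ltn_neqAle ne.
split; first exact: F_component.
have gF : so_grading (- (i.+1 == r)%:Z) (F (up i.+1) (up i)) by apply: F_component; rewrite -H opprB.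
exact: (componentZ _ gF).
Qed.

End ParabolicB.

(** * Sub-free algebras of small depth *)

Section Fundamental.
Variables (K : numFieldType) (m : finLieAlgType K) (gm : grading m) (n : nat).
Variables (F : frame m n) (gF : graded_frame F gm) (fund : fundamental gm).
Local Notation e := (vec F).

Lemma vec_noncentral p : (forall j, [lie e p, e j] = 0) -> False.
Proof.
move=> p0; have [_ ge _ free] := gF.
have cp y : [lie e p, y] = 0.
  move: y; apply: (@frame_ind _ _ _ F) => [|a x y x0 y0|//|i x x0].
  - exact: lie0r.
  - by rewrite lieDr lieZr x0 y0 scaler0 addr0.
  - by rewrite lie_leibniz p0 lie0l x0 lie0r addr0.
have : classical_sets.setI (lie_center m) (gm (-1)) (e p) by [].
rewrite fund.2 => /= ep0.
have /(_ p)/eqP : forall i, (i == p)%:R = 0 :> K.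
  apply: free; rewrite (bigD1 p) //= eqxx scale1r ep0 add0r big1 // => i /negPf ->.
  by rewrite scale0r.
by rewrite eqxx oner_eq0.
Qed.

(** If one such bracket vanished, matrix units would carry the zero to all brackets with [e p],
    which would be central. *)
Lemma lie_vec_neq0 p q : p != q -> [lie e p, e q] != 0.
Proof.
move=> pq; apply/eqP => pq0.
have iq i : [lie e i, e q] = 0.
  have [->|ip] := eqVneq i p; first exact: pq0.
  have := congr1 (act F (delta_mx i p)) pq0.
  rewrite linear0 act_lie !act_delta_vec eqxx (negPf pq) scale1r scale0r.
  by rewrite lie0r addr0.
apply: (@vec_noncentral p) => j.
have := congr1 (act F (delta_mx j q)) (iq p).
rewrite linear0 act_lie !act_delta_vec eqxx eq_sym (negPf pq) scale0r scale1r.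
by rewrite lie0l add0r.
Qed.

(** The operator $E_{pp}E_{qq}$ kills every bracket of two generators except $[e_p,e_q]$ and
    $[e_q,e_p]$. *)
Lemma lie_vec_indep (c : 'I_n * 'I_n -> K) :
  \sum_p c p *: [lie e p.1, e p.2] = 0 -> forall i j, c (i, j) = c (j, i).
Proof.
move=> c0 p q; have [->//|pq] := eqVneq p q.
have D k i j : act F (delta_mx k k) [lie e i, e j]
    = ((i == k)%:R + (j == k)%:R) *: [lie e i, e j].
  rewrite act_lie !act_delta_vec lieZl lieZr (eq_sym k i) (eq_sym k j).
  by case: (eqVneq i k) => [->|_]; case: (eqVneq j k) => [->|_] /=; linear_arith.
have := congr1 (fun x => act F (delta_mx p p) (act F (delta_mx q q) x)) c0.
rewrite !linear0 !linear_sum /= (eq_bigr (fun x =>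
    ((x == (p, q))%:R * c x) *: [lie e p, e q]
    + ((x == (q, p))%:R * c x) *: [lie e q, e p])); last first.
  move=> [i j] _; rewrite !linearZ /= D linearZ /= D !xpair_eqE -!mulnb !natrM.
  case: (eqVneq i p) => [ip|ip]; case: (eqVneq j p) => [jp|jp];
    case: (eqVneq i q) => [iq|iq]; case: (eqVneq j q) => [jq|jq];
    try (by move/eqP: pq; congruence);
    rewrite ?ip ?jp ?iq ?jq ?liexx /=; linear_arith.
rewrite big_split /= -!scaler_suml.
have sd y : \sum_x (x == y)%:R * c x = c y.
  rewrite (bigD1 y) //= eqxx mul1r big1 ?addr0 // => x /negPf ->.
  by rewrite mul0r.
rewrite !sd (lieC (e q)) scalerN -scalerBl => /eqP.
by rewrite scaler_eq0 (negPf (lie_vec_neq0 pq)) orbF subr_eq0 => /eqP.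
Qed.

Lemma one_step_dim : (0 < n)%N -> (1 < n)%N.
Proof.
move=> n0; rewrite ltnNge; apply/negP => n1.
apply: (@vec_noncentral (Ordinal n0)) => j.
by rewrite (_ : j = Ordinal n0) ?liexx //; apply/val_inj; have := ltn_ord j; rewrite /=; lia.
Qed.

Lemma graded_sum2 (k l : int) (x y : m) : k != l -> gm k x -> gm l y -> x + y = 0 ->
  x = 0 /\ y = 0.
Proof.
move=> kl gx gy xy.
pose u (j : int) := if j == k then x else if j == l then y else 0.
have gu (j : int) : gm j (u j).
  rewrite /u; case: eqP => [->//|_]; case: eqP => [->//|_]; exact: component0.
have U : uniq [:: k; l] by rewrite /= inE kl.
have su : \sum_(j <- [:: k; l]) u j = 0.
  by rewrite !big_cons big_nil addr0 /u eqxx eq_sym (negPf kl) eqxx.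
have H := component_indep U gu su.
have := H k; have := H l; rewrite !inE /u !eqxx orbT (eq_sym l) (negPf kl).
by move=> /(_ isT) -> /(_ isT) ->.
Qed.

(** Both sides are the free two-step nilpotent algebra on $n$ generators. *)
Lemma two_step_parabolic : (1 < n)%N ->
  (forall i j k, [lie e i, [lie e j, e k]] = 0) ->
  is_parabolic_negative_part gm (cartan_B n) n.
Proof.
move=> n_gt1 e3; have [_ ge _ free] := gF.
pose X (i : 'I_n + 'I_n * 'I_n) := match i with
  | inl i => e i | inr p => [lie e p.1, e p.2] end.
have XE c : \sum_i c i *: X i = \sum_i c (inl i) *: e i
    + \sum_p c (inr p) *: [lie e p.1, e p.2] by rewrite big_sumType.
have ge2 (p : 'I_n * 'I_n) : gm (-2) (X (inr p)) by apply: (component_lie (ge p.1) (ge p.2)).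
have X12 i (p : 'I_n * 'I_n) : [lie X (inl i), X (inr p)] = 0 by apply: e3.
have X22 (p q : 'I_n * 'I_n) : [lie X (inr p), X (inr q)] = 0.
  rewrite {2}/X lie_leibniz (lieC _ (e q.1)) -!/(X (inl _)) X12 oppr0 lie0l add0r.
  by rewrite (lieC _ (X (inl q.2))) X12 oppr0 lie0r.
have indep c : \sum_i c i *: X i = 0 ->
    (forall i, c (inl i) = 0) /\ forall i j, c (inr (i, j)) = c (inr (j, i)).
  rewrite XE => E; have [] := @graded_sum2 (-1) (-2) _ _ isT _ _ E.
  - elim/big_rec: _ => [|i x _ gx]; [exact: component0|exact: componentP].
  - elim/big_rec: _ => [|p x _ gx]; [exact: component0|exact: componentP (ge2 p) gx].
  - move=> /free E1 E2; split; first exact: E1.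
    exact: (lie_vec_indep (c := fun p => c (inr p)) E2).
have zero (M : finLieAlgType K) (v : 'I_n -> M) c : (forall i, c (inl i) = 0) ->
    (forall i j, c (inr (i, j)) = c (inr (j, i)) :> K) ->
    \sum_i c (inl i) *: v i + \sum_p c (inr p) *: [lie v p.1, v p.2] = 0.
  move=> c1 c2; rewrite big1 ?add0r => [|i _]; last by rewrite c1 scale0r.
  set S := \sum_p _; have SN : S = - S.
    have swapK : cancel (fun p : 'I_n * 'I_n => (p.2, p.1)) (fun p => (p.2, p.1)) by case.
    rewrite {1}/S (reindex_inj (can_inj swapK)) /= -sumrN.
    by apply: eq_bigr => -[i j] _ /=; rewrite lieC c2 scalerN.
  have /eqP : 2%:R *: S = 0 by rewrite scaler_nat mulr2n {1}SN addNr.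
  by rewrite scaler_eq0 pnatr_eq0 => /eqP.
have so_negE c : \sum_i c i *: so_neg K i = \sum_i c (inl i) *: so_delta K (mid n) (up n i)
    + \sum_p c (inr p) *: [lie so_delta K (mid n) (up n p.1), so_delta K (mid n) (up n p.2)].
  by rewrite big_sumType /=; congr (_ + _); apply: eq_bigr => -[i j] _.
have sum_delta (M : lmodType K) (Z : 'I_n + 'I_n * 'I_n -> M) (i : 'I_n + 'I_n * 'I_n) :
    \sum_j (j == i)%:R *: Z j = Z i.
  rewrite (bigD1 i) //= eqxx scale1r big1 ?addr0 // => j /negPf ->.
  by rewrite scale0r.
have sum0 (M : lmodType K) (Z : 'I_n + 'I_n * 'I_n -> M) : \sum_j (0 : K) *: Z j = 0.
  by rewrite big1 // => j _; rewrite scale0r.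
have spanX x : exists c, x = \sum_i c i *: X i.
  pose P y := exists c, y = \sum_i c i *: X i.
  have PP a y z : P y -> P z -> P (a *: y + z).
    move=> [c ->] [c' ->]; exists (fun i => a * c i + c' i).
    rewrite scaler_sumr -big_split; apply: eq_bigr => i _ /=.
    by rewrite scalerDl scalerA.
  have P0 : P 0 by exists (fun=> 0); rewrite sum0.
  have PX (i : 'I_n + 'I_n * 'I_n) : P (X i) by exists (fun j => (j == i)%:R); rewrite sum_delta.
  move: x; apply: (@frame_ind _ _ _ F) => // [i|i x [c ->]]; first exact: (PX (inl i)).
  rewrite lie_sumr; elim/big_rec: _ => // k y _ Py; rewrite lieZr; apply: (PP) => //.
  by case: k => [j|p]; [apply: (PX (inr (i, j)))|rewrite (X12 i p)].
have [i|i||||c|i j|phi phiE] := @onto_negative_part_of_bases _ _ _ gm (so_grading K n) _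
    (@deg_neg n) X (@so_neg K n).
- by case: i => [i|p]; [apply: ge|apply: ge2].
- exact: so_neg_component.
- exact: spanX.
- exact: so_neg_span.
- by move=> c /indep[c1 c2]; rewrite so_negE; apply: zero.
- by move=> /so_neg_indep[c1 c2]; rewrite XE; apply: zero.
- have Y12 := @so_neg_lie12 K n; have Y22 := @so_neg_lie22 K n.
  case: i j => [i|p] [j|q].
  + exists (fun k => (k == inr (i, j))%:R); by split; rewrite sum_delta.
  + by exists (fun=> 0); split; rewrite sum0 ?X12 ?Y12.
  + by exists (fun=> 0); split; rewrite sum0 lieC ?X12 ?Y12 oppr0.
  + by exists (fun=> 0); split; rewrite sum0 ?X22 ?Y22.
exists (so K n.*2.+1), (so_grading K n), phi; split=> //.
exact: so_parabolic.
Qed.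

End Fundamental.

(** * The split Lie algebra of type G2 *)

(* The basis: 0, 1, 2, 3, 4 span the negative part for p_1, with brackets
   [0,1] = 2, [0,2] = 3, [1,2] = 4; 5 and 8 are root vectors for -alpha_2 and
   alpha_2; 6 and 7 are the fundamental coweights; 9, ..., 13 are positive. The
   triple (j, k, c) in row i stands for the term c k of [i, j]; the constants
   were computed in the 7-dimensional representation. *)
Definition g2_row (i : nat) : seq (nat * nat * int) := nth [::] (
[::
  [:: (1, 2, Posz 1); (2, 3, Posz 1); (5, 1, Negz 0); (6, 0, Posz 1); (9, 6, Negz 1); (9, 7, Posz 3); (10, 8, Posz 3); (11, 10, Negz 1); (12, 11, Negz 0)];
  [:: (0, 2, Negz 0); (2, 4, Posz 1); (6, 1, Posz 1); (7, 1, Posz 1); (8, 0, Negz 0); (9, 5, Posz 3); (10, 6, Posz 1); (10, 7, Negz 2); (11, 9, Posz 2); (13, 11, Negz 0)];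
  [:: (0, 3, Negz 0); (1, 4, Negz 0); (6, 2, Posz 2); (7, 2, Posz 1); (9, 1, Negz 3); (10, 0, Posz 4); (11, 6, Negz 1); (12, 9, Posz 2); (13, 10, Posz 2)];
  [:: (5, 4, Negz 0); (6, 3, Posz 3); (7, 3, Posz 1); (9, 2, Negz 2); (11, 0, Posz 6); (12, 6, Negz 5); (12, 7, Posz 6); (13, 8, Posz 6)];
  [:: (6, 4, Posz 3); (7, 4, Posz 2); (8, 3, Negz 0); (10, 2, Negz 2); (11, 1, Posz 6); (12, 5, Posz 6); (13, 7, Negz 5)];
  [:: (0, 1, Posz 1); (3, 4, Posz 1); (7, 5, Posz 1); (8, 6, Posz 1); (8, 7, Negz 1); (10, 9, Negz 0); (13, 12, Negz 0)];
  [:: (0, 0, Negz 0); (1, 1, Negz 0); (2, 2, Negz 1); (3, 3, Negz 2); (4, 4, Negz 2); (9, 9, Posz 1); (10, 10, Posz 1); (11, 11, Posz 2); (12, 12, Posz 3); (13, 13, Posz 3)];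
  [:: (1, 1, Negz 0); (2, 2, Negz 0); (3, 3, Negz 0); (4, 4, Negz 1); (5, 5, Negz 0); (8, 8, Posz 1); (10, 10, Posz 1); (11, 11, Posz 1); (12, 12, Posz 1); (13, 13, Posz 2)];
  [:: (1, 0, Posz 1); (4, 3, Posz 1); (5, 6, Negz 0); (5, 7, Posz 2); (7, 8, Negz 0); (9, 10, Negz 0); (12, 13, Negz 0)];
  [:: (0, 6, Posz 2); (0, 7, Negz 2); (1, 5, Negz 2); (2, 1, Posz 4); (3, 2, Posz 3); (6, 9, Negz 0); (8, 10, Posz 1); (10, 11, Negz 1); (11, 12, Negz 2)];
  [:: (0, 8, Negz 2); (1, 6, Negz 0); (1, 7, Posz 3); (2, 0, Negz 3); (4, 2, Posz 3); (5, 9, Posz 1); (6, 10, Negz 0); (7, 10, Negz 0); (9, 11, Posz 2); (11, 13, Negz 2)];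
  [:: (0, 10, Posz 2); (1, 9, Negz 1); (2, 6, Posz 2); (3, 0, Negz 5); (4, 1, Negz 5); (6, 11, Negz 1); (7, 11, Negz 0); (9, 12, Posz 3); (10, 13, Posz 3)];
  [:: (0, 11, Posz 1); (2, 9, Negz 1); (3, 6, Posz 6); (3, 7, Negz 5); (4, 5, Negz 5); (6, 12, Negz 2); (7, 12, Negz 0); (8, 13, Posz 1)];
  [:: (1, 11, Posz 1); (2, 10, Negz 1); (3, 8, Negz 5); (4, 7, Posz 6); (5, 12, Posz 1); (6, 13, Negz 2); (7, 13, Negz 1)]])%N i.

Definition g2_deg (i : nat) : int :=
  nth 0 [:: -1; -1; -2; -3; -3; 0; 0; 0; 0; 1; 1; 2; 3; 3] i.

(** Generic in the ring: one table defines the bracket over [K] and is evaluated over the integers,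
    where identities between basis vectors are decided by computation. *)
Definition ad_coef (R : nzRingType) (i : nat) (v : nat -> R) (l : nat) : R :=
  foldr (fun t s => (if l == t.1.2 then v t.1.1 *~ t.2 else 0) + s) 0 (g2_row i).

Definition ad_ints (i : nat) (v : seq int) : seq int :=
  foldr (fun t s => set_nth 0 s t.1.2 (nth 0 v t.1.1 *~ t.2 + nth 0 s t.1.2))
    (nseq 14 0) (g2_row i).

Definition unit_ints (i : nat) : seq int := mkseq (fun k => (k == i)%:Z) 14.

Lemma nth_ad_ints i v l : nth 0 (ad_ints i v) l = ad_coef i (nth 0 v) l.
Proof.
have z0 k : nth 0 (nseq 14 0 : seq int) k = 0 by rewrite nth_nseq if_same.
rewrite /ad_ints /ad_coef; move: (nseq 14 0) z0 => z z0.
elim: (g2_row i) l => [|t s IH] l /=; first exact: z0.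
by rewrite nth_set_nth /= !IH; case: eqP => [->|_]; rewrite ?add0r.
Qed.

Lemma g2_row_bound i t : t \in g2_row i -> (t.1.1 < 14)%N.
Proof.
have [i14|i14] := ltnP i 14; last by rewrite /g2_row nth_default.
have : all (fun i => all (fun t => t.1.1 < 14)%N (g2_row i)) (iota 0 14) by vm_compute.
by move=> /allP/(_ i); rewrite mem_iota => /(_ i14)/allP/(_ t); apply.
Qed.

Section G2.
Variable K : numFieldType.
Local Notation V := 'rV[K]_14.
Implicit Types (u v w : V).

Definition vcoef u (j : nat) : K := u 0 (inord j).

Definition g2_lie u v : V := \row_l \sum_(i < 14) u 0 i * ad_coef i (vcoef v) l.

Definition of_ints (s : seq int) : V := \row_k (nth 0 s k)%:~R.

Definition g2_basis (i : nat) : V := of_ints (unit_ints i).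

Lemma eq_ad_coef (R : nzRingType) i (v w : nat -> R) l :
  (forall j, (j < 14)%N -> v j = w j) -> ad_coef i v l = ad_coef i w l.
Proof.
move=> vw; rewrite /ad_coef; have := @g2_row_bound i.
elim: (g2_row i) => //= t s IH b; rewrite vw ?b ?mem_head // IH // => t' ts.
by apply: b; rewrite inE ts orbT.
Qed.

Lemma ad_coef_lin i a (v w : nat -> K) l :
  ad_coef i (fun j => a * v j + w j) l = a * ad_coef i v l + ad_coef i w l.
Proof.
rewrite /ad_coef; elim: (g2_row i) => [|t s /= ->]; first by rewrite mulr0 addr0.
case: eqP => _; last by ring.
by rewrite mulrzDl -mulrzAr mulrDr addrACA.
Qed.

Lemma g2_lie_linearl a u v w : g2_lie (a *: u + v) w = a *: g2_lie u w + g2_lie v w.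
Proof.
apply/rowP => l; rewrite !mxE mulr_sumr -big_split /=; apply: eq_bigr => i _.
by rewrite !mxE; ring.
Qed.

Lemma g2_lie_linearr a u v w : g2_lie w (a *: u + v) = a *: g2_lie w u + g2_lie w v.
Proof.
apply/rowP => l; rewrite !mxE mulr_sumr -big_split /=; apply: eq_bigr => i _.
rewrite (@eq_ad_coef _ _ _ (fun j => a * vcoef u j + vcoef v j)).
  by rewrite ad_coef_lin; ring.
by move=> j _; rewrite /vcoef !mxE.
Qed.

Lemma g2_basisE (i : 'I_14) : g2_basis i = delta_mx 0 i.
Proof.
by apply/rowP => k; rewrite !mxE nth_mkseq // -pmulrn eqxx /= -val_eqE eq_sym.
Qed.

Lemma zero_on_basis (U : lmodType K) (f : V -> U) :
  (forall a u v, f (a *: u + v) = a *: f u + f v) ->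
  (forall i, (i < 14)%N -> f (g2_basis i) = 0) -> forall u, f u = 0.
Proof.
move=> fl fb u; have f0 : f 0 = 0.
  by have := fl (-1) 0 0; rewrite scaler0 addr0 scaleN1r addNr.
rewrite (row_sum_delta u); elim/big_rec: _ => // i v _ fv.
by rewrite fl -g2_basisE fb // scaler0 add0r.
Qed.

Lemma intr_ad_coef i (v : nat -> int) l :
  (ad_coef i v l)%:~R = ad_coef i (fun j => (v j)%:~R) l :> K.
Proof.
rewrite /ad_coef; elim: (g2_row i) => //= t s <-; rewrite intrD; congr (_ + _).
by case: eqP => // _; rewrite -mulrzA -[v _ *~ _]mulrzr intz.
Qed.

Lemma g2_lie_ints i s : (i < 14)%N -> g2_lie (g2_basis i) (of_ints s) = of_ints (ad_ints i s).
Proof.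
move=> i14; apply/rowP => l; rewrite !mxE nth_ad_ints intr_ad_coef.
rewrite (bigD1 (Ordinal i14)) //= big1 ?addr0 => [|j /negPf ji].
  rewrite mxE nth_mkseq // eqxx mul1r; apply: eq_ad_coef => j j14.
  by rewrite /vcoef mxE inordK.
by rewrite mxE nth_mkseq // (_ : (j == i :> nat) = false) ?mul0r // -ji -val_eqE.
Qed.

Lemma of_ints0 (s : seq int) : all (pred1 0) s -> of_ints s = 0.
Proof.
move=> /all_nthP s0; apply/rowP => k; rewrite !mxE.
have [ks|ks] := ltnP k (size s); last by rewrite nth_default.
by have /eqP -> := s0 0 k ks.
Qed.

Definition comb_ints (a b : int) (s t : seq int) : seq int :=
  mkseq (fun k => nth 0 s k * a + nth 0 t k * b) 14.

Lemma of_ints_comb a b s t :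
  of_ints (comb_ints a b s t) = a%:~R *: of_ints s + b%:~R *: of_ints t.
Proof.
apply/rowP => k; rewrite !mxE nth_mkseq // intrD !intrM; ring.
Qed.

Lemma g2_lieC u v : g2_lie u v = - g2_lie v u.
Proof.
apply/eqP; rewrite -addr_eq0; apply/eqP; move: u.
apply: zero_on_basis => [a u w|i i14].
  by rewrite g2_lie_linearl g2_lie_linearr scalerDr addrACA.
move: v; apply: zero_on_basis => [a u w|j j14].
  by rewrite g2_lie_linearl g2_lie_linearr scalerDr addrACA.
rewrite !g2_lie_ints // -[of_ints (ad_ints i _)]scale1r -[of_ints (ad_ints j _)]scale1r.
rewrite -(of_ints_comb 1 1) of_ints0 //.
have : all (fun i => all (fun j => all (pred1 0)
   (comb_ints 1 1 (ad_ints i (unit_ints j)) (ad_ints j (unit_ints i))))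
   (iota 0 14)) (iota 0 14) by vm_compute.
by move=> /allP/(_ i); rewrite mem_iota => /(_ i14)/allP/(_ j); rewrite mem_iota => /(_ j14).
Qed.

Lemma g2_liexx u : g2_lie u u = 0.
Proof.
have /eqP := g2_lieC u u; rewrite -addr_eq0 -mulr2n -scaler_nat scaler_eq0.
by rewrite pnatr_eq0 => /eqP.
Qed.

(** The Jacobi sum is cyclically invariant, so linearity in the first argument reduces each argument
    in turn to a basis vector. *)
Lemma jacobi_on_basis (B : V -> V -> V) :
  (forall a u v w, B (a *: u + v) w = a *: B u w + B v w) ->
  (forall a u v w, B w (a *: u + v) = a *: B w u + B w v) ->
  let J u v w := B u (B v w) + B v (B w u) + B w (B u v) in
  (forall i j k, (i < 14)%N -> (j < 14)%N -> (k < 14)%N ->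
     J (g2_basis i) (g2_basis j) (g2_basis k) = 0) ->
  forall u v w, J u v w = 0.
Proof.
move=> Bl Br J Jb u v w.
have Jl a x y v' w' : J (a *: x + y) v' w' = a *: J x v' w' + J y v' w'.
  by rewrite /J Bl (Br a x y w') Br (Bl a x y v') Br; linear_arith.
have Jc x y z : J x y z = J y z x by rewrite /J -addrA addrC.
move: u; apply: zero_on_basis => [a x y|i i14]; first exact: Jl.
move: v; apply: zero_on_basis => [a x y|j j14]; first by rewrite !(Jc (g2_basis i)); apply: Jl.
move: w; apply: zero_on_basis => [a x y|k k14]; first by rewrite -!(Jc _ (g2_basis i)); apply: Jl.
exact: Jb.
Qed.

Lemma g2_jacobi u v w :
  g2_lie u (g2_lie v w) + g2_lie v (g2_lie w u) + g2_lie w (g2_lie u v) = 0.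
Proof.
move: u v w; apply: (jacobi_on_basis g2_lie_linearl g2_lie_linearr) => i j k i14 j14 k14.
rewrite !g2_lie_ints // -[of_ints (ad_ints i _)]scale1r -[of_ints (ad_ints j _)]scale1r.
rewrite -(of_ints_comb 1 1) -[of_ints (comb_ints _ _ _ _)]scale1r.
rewrite -[of_ints (ad_ints k _)]scale1r -(of_ints_comb 1 1) of_ints0 //.
have : all (fun i => all (fun j => all (fun k => all (pred1 0)
   (comb_ints 1 1 (comb_ints 1 1 (ad_ints i (ad_ints j (unit_ints k)))
      (ad_ints j (ad_ints k (unit_ints i)))) (ad_ints k (ad_ints i (unit_ints j)))))
   (iota 0 14)) (iota 0 14)) (iota 0 14) by vm_compute.
move=> /allP/(_ i); rewrite mem_iota => /(_ i14)/allP/(_ j); rewrite mem_iota.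
by move=> /(_ j14)/allP/(_ k); rewrite mem_iota => /(_ k14).
Qed.

Definition g2 : Type := 'rV[K]_14.

HB.instance Definition _ := Vector.on g2.

HB.instance Definition _ := Lmodule_isLieAlgebra.Build K g2
  g2_lie_linearl g2_lie_linearr g2_liexx g2_jacobi.

End G2.

Arguments g2_row : simpl never.
Arguments ad_ints : simpl never.
Arguments unit_ints : simpl never.
Arguments comb_ints : simpl never.

(* Entry k is a word w and an integer c such that applying to X the operators
   ad b_i, for i in w, gives c times the k-th coordinate of X times the highest
   root vector b_13. The square of ad b_i for a long root i is the source of
   these projections. *)
Definition g2_projections : seq (seq nat * int) := ([:: ([:: 8; 12; 12; 2], Negz 11); ([:: 13; 13; 2], Posz 12); ([:: 13; 13; 1], Negz 11); ([:: 8; 12; 12], Posz 12); ([:: 13; 13], Negz 11); ([:: 13; 13; 3], Posz 12); ([:: 8; 12; 12; 2; 0], Negz 11); ([:: 13; 13; 3; 5], Posz 12); ([:: 8; 12; 12; 4], Negz 11); ([:: 13; 13; 1; 3], Posz 36); ([:: 13; 13; 1; 4], Posz 36); ([:: 13; 13; 2; 4], Posz 72); ([:: 12; 13; 3; 3], Posz 72); ([:: 13; 13; 4; 4], Posz 144)])%N.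

(* Entry k is (w, g, c) where the word w applied to the Chevalley generator g
   gives c b_k; the entries of the Cartan subalgebra are missing (c = 0). *)
Definition g2_generation : seq (seq nat * nat * int) := ([:: ([::], 0, Posz 1); ([:: 5], 0, Posz 1); ([:: 0; 5], 0, Posz 1); ([:: 0; 0; 5], 0, Posz 1); ([:: 5; 0; 0; 5], 0, Posz 1); ([::], 5, Posz 1); ([::], 0, Posz 0); ([::], 0, Posz 0); ([::], 8, Posz 1); ([::], 9, Posz 1); ([:: 9], 8, Posz 1); ([:: 9; 9], 8, Negz 1); ([:: 9; 9; 9], 8, Posz 6); ([:: 8; 9; 9; 9], 8, Negz 5)])%N.

Definition g2_gens : seq nat := [:: 0; 5; 8; 9]%N.

Definition g2_projection k := nth ([::], 0) g2_projections k.
Arguments g2_projection : simpl never.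

Definition g2_generator k := nth ([::], 0%N, 0) g2_generation k.
Arguments g2_generator : simpl never.

Definition g2_projection_ok k := let: (w, c) := g2_projection k in
  [&& c != 0, all (fun i => i < 14)%N w &
    all (fun i => all (pred1 0) (comb_ints 1 (- (c * nth 0 (unit_ints i) k))
      (foldr ad_ints (unit_ints i) w) (unit_ints 13))) (iota 0 14)].

Lemma g2_projectionP k : (k < 14)%N -> g2_projection_ok k.
Proof.
move=> k14; have : all g2_projection_ok (iota 0 14) by vm_compute.
by move=> /allP; apply; rewrite mem_iota.
Qed.

Definition g2_generator_ok k := let: (w, g, c) := g2_generator k in
  (c != 0) ==> [&& all (mem g2_gens) w, g \in g2_gens & all (pred1 0)
    (comb_ints 1 (- c) (foldr ad_ints (unit_ints g) w) (unit_ints k))].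

Lemma g2_generatorP k : (k < 14)%N -> g2_generator_ok k.
Proof.
move=> k14; have : all g2_generator_ok (iota 0 14) by vm_compute.
by move=> /allP; apply; rewrite mem_iota.
Qed.

(** * Generation and simplicity of G2 *)

Section G2Structure.
Variable K : numFieldType.
Local Notation L := (g2 K).
Implicit Types (X Y : L) (w : seq nat) (s t : seq int).

Definition ints s : L := of_ints K s.
Definition bas (i : nat) : L := ints (unit_ints i).

Lemma lie_ints i s : (i < 14)%N -> [lie bas i, ints s] = ints (ad_ints i s).
Proof. exact: g2_lie_ints. Qed.

Lemma ints_eq (c : int) s t : all (pred1 0) (comb_ints 1 (- c) s t) ->
  ints s = c%:~R *: ints t.
Proof.
move=> /(of_ints0 K); rewrite of_ints_comb scale1r intrN scaleNr.
by move/subr0_eq.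
Qed.

Definition word w X : L := foldr (fun i Y => [lie bas i, Y]) X w.

Lemma word_ints w s : all (fun i => i < 14)%N w ->
  word w (ints s) = ints (foldr ad_ints s w).
Proof. by elim: w => //= i w IH /andP[i14 /IH ->]; rewrite lie_ints. Qed.

Lemma word_lin w a X Y : word w (a *: X + Y) = a *: word w X + word w Y.
Proof. by elim: w => //= i w ->; rewrite lieDr lieZr. Qed.

Lemma word_projection k X : (k < 14)%N ->
  exists w (c : K), c != 0 /\
    word w X = (c * (X : 'rV[K]_14) 0 (inord k)) *: bas 13.
Proof.
move=> k14; have := g2_projectionP k14; rewrite /g2_projection_ok.
case: (g2_projection k) => w c /and3P[c0 w14 /allP wc].
exists w, c%:~R; split; first by rewrite intr_eq0.
pose f (Y : L) : L := word w Y - (c%:~R * (Y : 'rV[K]_14) 0 (inord k)) *: bas 13.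
have fl a Y Z : f (a *: Y + Z) = a *: f Y + f Z.
  rewrite /f word_lin !mxE mulrDr scalerDl scalerBr opprD addrACA scalerA.
  by rewrite mulrCA.
have fb i : (i < 14)%N -> f (g2_basis K i) = 0.
  move=> i14; rewrite /f word_ints // mxE inordK // -intrM.
  by apply/eqP; rewrite subr_eq0; apply/eqP/ints_eq/wc; rewrite mem_iota.
by have /eqP := zero_on_basis fl fb X; rewrite subr_eq0 => /eqP.
Qed.

Lemma g2_full (S : classical_sets.set L) : lie_subalgebra S ->
  (forall g, g \in g2_gens -> S (bas g)) -> S = classical_sets.setT.
Proof.
move=> [[S0 SP] SL] Sg; have SZ a X : S X -> S (a *: X).
  by move=> SX; rewrite -[a *: X]addr0; apply: SP.
have gens14 g : g \in g2_gens -> (g < 14)%N by rewrite !inE => /or4P[]/eqP->.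
have Sword w X : all (mem g2_gens) w -> S X -> S (word w X).
  by elim: w => //= i w IH /andP[/Sg Si /IH wS] SX; apply: SL => //; apply: wS.
have Sb k : (k < 14)%N -> (g2_generator k).2 != 0 -> S (bas k).
  move=> k14; have := g2_generatorP k14; rewrite /g2_generator_ok.
  case: (g2_generator k) => -[w g] c /implyP H /= c0.
  have /and3P[wg gg /ints_eq E] := H c0.
  have -> : bas k = (c%:~R)^-1 *: word w (bas g).
    rewrite word_ints; first by rewrite E scalerA mulVf ?scale1r // intr_eq0.
    by apply/allP => i /(allP wg); apply: gens14.
  by apply/SZ/Sword/Sg.
have Sh i j : i \in g2_gens -> j \in g2_gens -> S (ints (ad_ints i (unit_ints j))).
  by move=> ig jg; rewrite -lie_ints ?gens14 //; apply: SL; apply: Sg.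
have Sall k : (k < 14)%N -> S (bas k).
  have [k6|k6] := eqVneq k 6%N.
    (* These coefficients, and those for the other coweight, invert $[b_9,b_0]=2b_6-3b_7$ and
       $[b_8,b_5]=-b_6+2b_7$. *)
    have -> : bas k = 2%:~R *: ints (ad_ints 9 (unit_ints 0)) + 3%:~R *: ints (ad_ints 8 (unit_ints 5)).
      by rewrite -of_ints_comb k6; congr (of_ints K _); vm_compute.
    by move=> _; apply: SP; [|apply: SZ]; apply: Sh.
  have [k7|k7] := eqVneq k 7%N.
    have -> : bas k = 1%:~R *: ints (ad_ints 9 (unit_ints 0)) + 2%:~R *: ints (ad_ints 8 (unit_ints 5)).
      by rewrite -of_ints_comb k7; congr (of_ints K _); vm_compute.
    by move=> _; apply: SP; [|apply: SZ]; apply: Sh.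
  move=> k14; apply: (Sb k k14); have : all (fun k => [|| k == 6, k == 7 |
      (g2_generator k).2 != 0])%N (iota 0 14) by vm_compute.
  by move=> /allP/(_ k); rewrite mem_iota (negPf k6) (negPf k7); apply.
apply/funext => X; apply/propext; split=> // _.
rewrite [X]row_sum_delta; elim/big_rec: _ => // i Y _ SY; apply: SP => //.
by rewrite -g2_basisE; apply: Sall.
Qed.

Lemma g2_simple : lie_simple L.
Proof.
split.
  exists (bas 0), (bas 1); rewrite lie_ints //; apply/eqP => /rowP/(_ (inord 2)).
  rewrite !mxE inordK // (_ : nth _ _ _ = 1); last by vm_compute.
  by apply/eqP; rewrite oner_eq0.
move=> S [[S0 SP] SI].
have SZ a X : S X -> S (a *: X) by move=> SX; rewrite -[a *: X]addr0; apply: SP.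
have [[X [SX nzX]]|S_0] := EM (exists X, S X /\ X != 0); last first.
  left; apply/funext => X; apply/propext; split=> [SX|->] //.
  by apply: contrapT => /eqP nz; apply: S_0; exists X.
right.
have Sword w Y : S Y -> S (word w Y).
  by move=> SY; elim: w => //= i w; apply: SI.
have [k nz] : exists k : 'I_14, (X : 'rV[K]_14) 0 k != 0.
  apply: contrapT => H; move/eqP: nzX; apply; apply/rowP => k; rewrite mxE.
  by apply: contrapT => /eqP nz; apply: H; exists k.
(* A nonzero coordinate of [X] is projected onto the highest root vector, from which words lead down
   to the four generators. *)
have S13 : S (bas 13).
  have [w [c [c0 E]]] := word_projection X (ltn_ord k).
  have := Sword w _ SX; rewrite E inord_val; set d := _ * _ => Sd.
  have d0 : d != 0 by rewrite mulf_neq0.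
  by rewrite -[bas 13]scale1r -(mulVf d0) -scalerA; apply: SZ.
have from13 w (c : int) g : c != 0 -> all (fun i => i < 14)%N w ->
    all (pred1 0) (comb_ints 1 (- c) (foldr ad_ints (unit_ints 13) w) (unit_ints g)) ->
    S (bas g).
  move=> c0 w14 /ints_eq E; have := Sword w _ S13; rewrite word_ints // E => Sc.
  have c0' : c%:~R != 0 :> K by rewrite intr_eq0.
  by rewrite -[bas g]scale1r -(mulVf c0') -scalerA; apply: SZ.
apply: g2_full => [|g].
  by split=> // Y Z SY SZ'; apply: SI.
rewrite !inE => /or4P[]/eqP ->.
- by apply: (from13 [:: 3; 1]%N (-6)).
- by apply: (from13 [:: 4; 5]%N (-6)).
- by apply: (from13 [:: 3]%N 6).
- by apply: (from13 [:: 1; 1]%N (-2)).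
Qed.

End G2Structure.

Arguments g2_deg : simpl never.

(** * The grading of G2 and its negative part *)

Section G2Grading.
Variable K : numFieldType.
Local Notation L := (g2 K).
Local Notation bas := (@bas K).
Implicit Types (X Y : L).

(** Node 1 has the generators $b_9$, $b_0$ and node 2 has $b_8$, $b_5$, which explains the index
    formulas here and in [g2_f]. *)
Definition g2_e (i : 'I_2) : L := bas (9 - i).
Definition g2_f (i : 'I_2) : L := bas (5 * i).

Lemma lie_lie_ints i j s : (i < 14)%N -> (j < 14)%N ->
  [lie [lie bas i, bas j], ints K s] =
  ints K (comb_ints 1 (-1) (ad_ints i (ad_ints j s)) (ad_ints j (ad_ints i s))).
Proof.
move=> i14 j14; rewrite lie_leibnizl !lie_ints //.
by rewrite [RHS]of_ints_comb scale1r scaleN1r.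
Qed.

Definition cartan (i j : nat) : int := if i == j then 2 else if (i < j)%N then -1 else -3.

Definition g2_relations_ok (i j : nat) :=
  (* The action of the coroot $[e_j,f_j]$, as a commutator of adjoint actions. *)
  let h s := comb_ints 1 (-1) (ad_ints (9 - j) (ad_ints (5 * j) s)) (ad_ints (5 * j) (ad_ints (9 - j) s)) in
  let e := unit_ints (9 - i) in let f := unit_ints (5 * i) in
  [&& all (pred1 0) (h (ad_ints (9 - i) f)),
      (i != j) ==> all (pred1 0) (ad_ints (9 - i) (unit_ints (5 * j))),
      all (pred1 0) (comb_ints 1 (- cartan i j) (h e) e)
    & all (pred1 0) (comb_ints 1 (- - cartan i j) (h f) f)].

Lemma g2_relations (i j : 'I_2) : g2_relations_ok i j.
Proof.
have : all (fun i => all (g2_relations_ok i) (iota 0 2)) (iota 0 2) by vm_compute.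
move=> /allP/(_ i); rewrite mem_iota => /(_ (ltn_ord i))/allP; apply.
by rewrite mem_iota; apply: ltn_ord.
Qed.

Lemma g2_chevalley : chevalley_generators cartan_G2 g2_e g2_f.
Proof.
have e14 (i : 'I_2) : (9 - i < 14)%N by have := ltn_ord i; lia.
have f14 (i : 'I_2) : (5 * i < 14)%N by have := ltn_ord i; lia.
split.
- move=> S subS SX; apply: g2_full => // g; rewrite !inE => /or4P[]/eqP->; apply: SX.
  + by right; exists ord0.
  + by right; exists (lift ord0 ord0).
  + by left; exists (lift ord0 ord0).
  + by left; exists ord0.
- move=> i j; rewrite lieC; have /and4P[H _ _ _] := g2_relations i j.
  by rewrite /g2_e /g2_f [X in [lie _, X]]lie_ints // lie_lie_ints // [ints K _]of_ints0 ?oppr0.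
- move=> i j ij; have /and4P[_ /implyP H _ _] := g2_relations i j.
  by rewrite /g2_e /g2_f lie_ints // [ints K _]of_ints0 // H.
- move=> i j; have /and4P[_ _ H _] := g2_relations i j; rewrite /g2_e /g2_f lie_lie_ints //.
  by rewrite (ints_eq K H) mxE.
- move=> i j; have /and4P[_ _ _ H] := g2_relations i j; rewrite /g2_e /g2_f lie_lie_ints //.
  by rewrite (ints_eq K H) mxE intrN.
Qed.

Definition g2_component (k : int) : classical_sets.set L :=
  fun X => forall j : 'I_14, (X : 'rV[K]_14) 0 j != 0 -> g2_deg j = k.

Fact g2_component_subspace k : subspace (g2_component k).
Proof.
split=> [j|a X Y gX gY j]; first by rewrite mxE eqxx.
rewrite !mxE; have [X0|/gX //] := eqVneq ((X : 'rV[K]_14) 0 j) 0.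
by rewrite X0 mulr0 add0r => /gY.
Qed.

Fact g2_component_span X : exists (s : seq int) (u : int -> L),
  (forall k, g2_component k (u k)) /\ X = \sum_(k <- s) u k.
Proof.
pose u k : L := \row_j ((g2_deg j == k)%:R * (X : 'rV[K]_14) 0 j).
exists (undup [seq g2_deg (j : 'I_14) | j <- enum 'I_14]), u; split=> [k j|].
  by rewrite mxE; case: (g2_deg j =P k) => //= _; rewrite mul0r eqxx.
apply/rowP => j; rewrite summxE (bigD1_seq (g2_deg j)) ?undup_uniq //=.
  rewrite mxE eqxx mul1r big1 ?addr0 // => k; rewrite mxE eq_sym => /negPf ->.
  by rewrite mul0r.
by rewrite mem_undup; apply/mapP; exists j; rewrite ?mem_enum.
Qed.

Fact g2_component_indep (s : seq int) (u : int -> L) : uniq s ->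
  (forall k, g2_component k (u k)) -> \sum_(k <- s) u k = 0 ->
  forall k, k \in s -> u k = 0.
Proof.
move=> Us gu su k ks; apply/rowP => j; rewrite [RHS]mxE.
apply: contrapT => /eqP nz; have jk := gu k j nz; move/eqP: nz; apply.
have := congr1 (fun X : L => (X : 'rV[K]_14) 0 j) su; rewrite /= [RHS]mxE summxE.
rewrite (bigD1_seq k) //= big1 ?addr0 // => l lk; apply: contrapT => /eqP/gu.
by rewrite jk => kl; rewrite kl eqxx in lk.
Qed.

Lemma g2_row_deg (i : 'I_14) t : t \in g2_row i ->
  g2_deg t.1.2 = g2_deg i + g2_deg t.1.1.
Proof.
have : all (fun i => all (fun t => g2_deg t.1.2 == g2_deg i + g2_deg t.1.1) (g2_row i)) (iota 0 14) by vm_compute.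
by move=> /allP/(_ i); rewrite mem_iota => /(_ (ltn_ord i))/allP/(_ t) H /H/eqP.
Qed.

Fact g2_component_lie k l X Y :
  g2_component k X -> g2_component l Y -> g2_component (k + l) [lie X, Y].
Proof.
move=> gX gY j; apply: contraNeq => jkl; rewrite mxE big1 // => i _.
apply/eqP; rewrite mulf_eq0; apply/orP.
have [X0|/gX ik] := eqVneq ((X : 'rV[K]_14) 0 i) 0; [by left|right].
rewrite /ad_coef; have := @g2_row_bound i; have := @g2_row_deg i.
elim: (g2_row i) => //= t s IH dt bt.
rewrite addr_eq0 (eqP (IH _ _)) ?oppr0 => [|t' ts|t' ts]; last 2 first.
- by apply: dt; rewrite inE ts orbT.
- by apply: bt; rewrite inE ts orbT.
case: (j =P t.1.2 :> nat) => [jt|//].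
have [->|/gY] := eqVneq (vcoef (Y : 'rV[K]_14) t.1.1) 0; first by rewrite mul0rz.
rewrite inordK ?bt ?mem_head // => tl; case/eqP: jkl.
by rewrite jt dt ?mem_head // ik tl.
Qed.

Definition g2_grading : grading L :=
  Grading g2_component_subspace g2_component_span g2_component_indep g2_component_lie.

Lemma bas_component i : (i < 14)%N -> g2_grading (g2_deg i) (bas i).
Proof.
move=> i14 j; rewrite mxE nth_mkseq // -pmulrn.
by case: (nat_of_ord j =P i) => [->//|_]; rewrite eqxx.
Qed.

Lemma g2_parabolic : maximal_parabolic_grading cartan_G2 1 g2_grading.
Proof.
split; first exact: g2_simple.
exists g2_e, g2_f; split; first exact: g2_chevalley.
move=> i /=; rewrite /g2_e /g2_f.
have -> : (i.+1 == 1)%:Z = g2_deg (9 - i).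
  by case: i => [[|[|//]] ?].
split; first by apply: bas_component; have := ltn_ord i; lia.
have -> : - g2_deg (9 - i) = g2_deg (5 * i) by case: i => [[|[|//]] ?].
by apply: bas_component; have := ltn_ord i; lia.
Qed.

Lemma g2_neg_span k X : k < 0 -> g2_grading k X ->
  exists c, X = \sum_(i : 'I_5 | g2_deg i == k) c i *: bas i.
Proof.
move=> k0 gX; exists (fun i => (X : 'rV[K]_14) 0 (inord i)).
apply/rowP => j; rewrite summxE.
under eq_bigr => i _.
  rewrite !mxE nth_mkseq // -pmulrn.
over.
have [X0|nz] := eqVneq ((X : 'rV[K]_14) 0 j) 0.
  rewrite X0 big1 // => i _; case: eqP => [ji|_]; last by rewrite mulr0.
  by rewrite -ji inord_val X0 mul0r.
have jk := gX j nz; have j5 : (j < 5)%N.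
  have : all (fun j => (g2_deg j < 0) ==> (j < 5)%N) (iota 0 14) by vm_compute.
  by move=> /allP/(_ j); rewrite mem_iota jk k0 => /(_ (ltn_ord j)).
rewrite (bigD1 (Ordinal j5)) /= ?jk // eqxx mulr1 inord_val big1 ?addr0 // => i.
move=> /andP[_ /negPf ij]; rewrite (_ : (j == i :> nat) = false) ?mulr0 //.
by rewrite eq_sym -ij -val_eqE.
Qed.

Lemma g2_neg_indep (c : 'I_5 -> K) : \sum_i c i *: bas i = 0 -> forall i, c i = 0.
Proof.
move=> c0 i; have i14 : (i < 14)%N by have := ltn_ord i; lia.
have := congr1 (fun X : L => (X : 'rV[K]_14) 0 (Ordinal i14)) c0.
rewrite /= [RHS]mxE summxE (bigD1 i) //= !mxE nth_mkseq // eqxx mulr1.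
rewrite big1 ?addr0 // => j /negPf ji; rewrite !mxE nth_mkseq // -pmulrn /=.
by rewrite (_ : (i == j :> nat) = false) ?mulr0 // eq_sym -ji -val_eqE.
Qed.

End G2Grading.

(** * Two generators and depth three *)

Section DepthThree.
Variables (K : numFieldType) (m : finLieAlgType K) (gm : grading m).
Variables (F : frame m 2) (gF : graded_frame F gm) (fund : fundamental gm).

Lemma depth_three_parabolic :
  (forall i j k l, [lie vec F i, [lie vec F j, [lie vec F k, vec F l]]] = 0) ->
  (exists i j k, [lie vec F i, [lie vec F j, vec F k]] != 0) ->
  is_parabolic_negative_part gm cartan_G2 1.
Proof.
move=> e4 [p [q [t nz]]]; have [_ ge _ free] := gF.
pose i0 : 'I_2 := ord0; pose i1 : 'I_2 := lift ord0 ord0.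
have ord2 (i : 'I_2) : i = i0 \/ i = i1.
  by case: i => [[|[|//]] hi]; [left|right]; apply/val_inj.
pose e i := vec F i; pose z := [lie e i0, e i1]; pose y i := [lie e i, z].
have ez i j : [lie e i, e j] = z \/ [lie e i, e j] = - z \/ [lie e i, e j] = 0.
  case: (ord2 i) (ord2 j) => -> [] ->; rewrite ?liexx; auto.
  by right; left; rewrite lieC.
have ey i j : [lie e i, y j] = 0 by apply: e4.
have zy j : [lie z, y j] = 0 by rewrite lie_leibnizl !ey !lie0r subr0.
have yy i j : [lie y i, y j] = 0 by rewrite lie_leibnizl zy ey !lie0r subr0.
have dz i j : i != j -> act F (delta_mx i j) z = 0.
  by case: (ord2 i) (ord2 j) => -> [] -> // _;
    rewrite act_lie !act_delta_vec /= ?scale0r ?scale1r liexx ?lie0l ?lie0r addr0.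
have y_swap i j : i != j -> act F (delta_mx i j) (y j) = y i.
  move=> ij; rewrite /y act_lie dz // act_delta_vec eqxx scale1r lie0r addr0 //.
(* Matrix units exchange [y i0] and [y i1], so one zero would make both vanish and with them all
   triple brackets. *)
have y_neq0 i : y i != 0.
  apply/eqP => yi0; have y0 j : y j = 0.
    have [->//|ji] := eqVneq j i.
    by rewrite -(y_swap _ _ ji) yi0 linear0.
  move/eqP: nz; apply; have [->|[->|->]] := ez q t.
  - exact: y0.
  - by rewrite lieNr (y0 p : [lie vec F p, z] = 0) oppr0.
  - exact: lie0r.
have z_neq0 : z != 0 by apply: (lie_vec_neq0 gF fund).
pose X (i : 'I_5) : m := nth 0 [:: e i0; e i1; z; y i0; y i1] i.
have gz : gm (-2) z by apply: (component_lie (ge i0) (ge i1)).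
have gy i : gm (-3) (y i) by apply: (component_lie (ge i) gz).
have gX (i : 'I_5) : gm (g2_deg i) (X i).
  case: i => [[|[|[|[|[|//]]]]] hi]; rewrite /X /=; [exact: ge|exact: ge|exact: gz|exact: gy|exact: gy].
have indep c : \sum_i c i *: X i = 0 -> forall i, c i = 0.
  rewrite !big_ord_recl big_ord0 /X /= addr0.
  set c0 := c _; set c1 := c _; set c2 := c _; set c3 := c _; set c4 := c _ => E.
  have g1 : gm (-1) (c0 *: e i0 + c1 *: e i1) by apply: componentP; last apply: componentZ; apply: ge.
  have g2' : gm (-2) (c2 *: z) by apply: componentZ.
  have g3 : gm (-3) (c3 *: y i0 + c4 *: y i1) by apply: componentP; last apply: componentZ; apply: gy.
  pose u (k : int) := if k == -1 then c0 *: e i0 + c1 *: e i1 else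
    if k == -2 then c2 *: z else if k == -3 then c3 *: y i0 + c4 *: y i1 else 0.
  have gu k : gm k (u k).
    rewrite /u; case: eqP => [->//|_]; case: eqP => [->//|_]; case: eqP => [->//|_].
    exact: component0.
  have su : \sum_(k <- [:: -1; -2; -3 : int]) u k = 0.
    by rewrite !big_cons big_nil /u /= addr0 -[RHS]E !addrA.
  have H := component_indep (isT : uniq [:: -1; -2; -3 : int]) gu su.
  have := H (-1) isT; have := H (-2) isT; have := H (-3) isT; rewrite /u /=.
  move=> E3 /eqP; rewrite scaler_eq0 (negPf z_neq0) orbF => /eqP E2 E1.
  have [E10 E11] : c0 = 0 /\ c1 = 0.
    pose cc (i : 'I_2) := if i == i0 then c0 else c1.
    have ccE : \sum_i cc i *: vec F i = 0 by rewrite !big_ord_recl big_ord0 /cc /= addr0.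
    by have := free _ ccE i0; have := free _ ccE i1; rewrite /cc /= => -> ->.
  have [E30 E31] : c3 = 0 /\ c4 = 0.
    (* The first diagonal matrix unit has eigenvalue 2 on [y i0] and 1 on [y i1], which separates
       them. *)
    have dy i j : act F (delta_mx i i) (y j) = (1 + (j == i)%:R) *: y j.
      rewrite /y /z !act_lie !act_delta_vec lieDr !lieZl !lieZr.
      by case: (ord2 i) (ord2 j) => -> [] -> /=; linear_arith.
    have := congr1 (act F (delta_mx i0 i0)) E3.
    rewrite linear0 linearD !linearZ /= !dy /= => E3'.
    have c30 : c3 *: y i0 = 0.
      rewrite -[LHS](_ : c3 *: ((1 + 1) *: y i0) + c4 *: ((1 + 0) *: y i1)
         - (c3 *: y i0 + c4 *: y i1) = _); first by rewrite E3' E3 subrr.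
      linear_arith.
    move: E3; rewrite c30 add0r => /eqP; rewrite scaler_eq0 (negPf (y_neq0 _)) orbF => /eqP.
    by move/eqP: c30; rewrite scaler_eq0 (negPf (y_neq0 _)) orbF => /eqP.
  case=> [[|[|[|[|[|//]]]]] hi].
  - by rewrite -[RHS]E10 /c0; congr c; apply/val_inj.
  - by rewrite -[RHS]E11 /c1; congr c; apply/val_inj.
  - by rewrite -[RHS]E2 /c2; congr c; apply/val_inj.
  - by rewrite -[RHS]E30 /c3; congr c; apply/val_inj.
  - by rewrite -[RHS]E31 /c4; congr c; apply/val_inj.
have sum_delta (M : lmodType K) (Z : 'I_5 -> M) a i :
    \sum_j (a * (j == i)%:R) *: Z j = a *: Z i.
  rewrite (bigD1 i) //= eqxx mulr1 big1 ?addr0 // => j /negPf ->.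
  by rewrite mulr0 scale0r.
pose br (i j : 'I_5) := exists c, [lie X i, X j] = \sum_k c k *: X k
  /\ [lie bas K i, bas K j] = \sum_k c k *: bas K (k : 'I_5).
have brC i j : br i j -> br j i.
  move=> [c [E1 E2]]; exists (fun k => - c k); rewrite lieC E1 lieC E2 -!sumrN.
  by split; apply: eq_bigr => k _; rewrite scaleNr.
have br0 i j : [lie X i, X j] = 0 -> all (pred1 0) (ad_ints i (unit_ints j)) -> br i j.
  move=> E1 E2; exists (fun=> 0); rewrite E1 lie_ints ?of_ints0; last by have := ltn_ord i; lia.
  by rewrite [ints K _]of_ints0 //; split; rewrite big1 // => k _; rewrite scale0r.
have br1 i j k : [lie X i, X j] = X k -> ad_ints i (unit_ints j) = unit_ints k -> br i j.
  move=> E1 E2; exists (fun l => 1 * (l == k)%:R); rewrite !sum_delta !scale1r E1 lie_ints ?E2 //.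
  by have := ltn_ord i; lia.
have br_lt (i j : 'I_5) : (i < j)%N -> br i j.
  case: i j => [[|[|[|[|[|//]]]]] hi] [[|[|[|[|[|//]]]]] hj] // _;
    try (by apply: br0; [rewrite /X /= ?ey ?zy ?yy|vm_compute]).
  - by apply: (@br1 _ _ (inord 2)); rewrite /X /= inordK.
  - by apply: (@br1 _ _ (inord 3)); rewrite /X /= inordK.
  - by apply: (@br1 _ _ (inord 4)); rewrite /X /= inordK.
have brX i j : br i j.
  have [ij|ji|/val_inj ->] := ltngtP i j; [exact: br_lt|exact/brC/br_lt|].
  apply: br0; first exact: liexx.
  by case: j => [[|[|[|[|[|//]]]]] hj]; vm_compute.
have spanX x : exists c, x = \sum_i c i *: X i.
  pose P x := exists c, x = \sum_i c i *: X i.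
  have PP a u v : P u -> P v -> P (a *: u + v).
    move=> [c ->] [c' ->]; exists (fun i => a * c i + c' i).
    rewrite scaler_sumr -big_split; apply: eq_bigr => i _ /=.
    by rewrite scalerDl scalerA.
  have P0 : P 0 by exists (fun=> 0); rewrite big1 // => i _; rewrite scale0r.
  have PX i : P (X i) by exists (fun j => 1 * (j == i)%:R); rewrite sum_delta scale1r.
  have PN u : P u -> P (- u) by move=> Pu; rewrite -scaleN1r -[_ *: _]addr0; apply: PP.
  have Pe i : P (e i).
    by case: (ord2 i) => ->; [have := PX (inord 0)|have := PX (inord 1)]; rewrite /X inordK.
  have Pz : P z by have := PX (inord 2); rewrite /X inordK.
  have Py i : P (y i).
    by case: (ord2 i) => ->; [have := PX (inord 3)|have := PX (inord 4)]; rewrite /X inordK.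
  move: x; apply: (@frame_ind _ _ _ F) => // i x [c ->].
  rewrite lie_sumr; elim/big_rec: _ => // k u _ Pu; rewrite lieZr; apply: (PP) => //.
  have Pee j : P [lie e i, e j].
    by have [->|[->|->]] := ez i j; [exact: Pz|exact/PN/Pz|exact: P0].
  case: k => [[|[|[|[|[|//]]]]] hk]; rewrite /X /=; [exact: Pee|exact: Pee|exact: Py| |];
    by rewrite (ey i _ : [lie vec F i, _] = 0).
have [|i||||c|i j|phi phiE] := @onto_negative_part_of_bases _ _ _ gm (g2_grading K) _
    (fun i : 'I_5 => g2_deg i) X (fun i : 'I_5 => bas K i).
- exact: gX.
- by apply: bas_component; have := ltn_ord i; lia.
- exact: spanX.
- exact: g2_neg_span.
- by move=> c /indep c0; rewrite big1 // => i _; rewrite c0 scale0r.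
- by move=> /g2_neg_indep c0; rewrite big1 // => i _; rewrite c0 scale0r.
- exact: brX.
exists (g2 K), (g2_grading K), phi; split=> //.
exact: g2_parabolic.
Qed.

End DepthThree.

(** * Conclusion *)

Lemma prolongation_rigid_numField (K : numFieldType) (s : nat)
    (m : finLieAlgType K) (gm : grading m) :
  gnla gm s -> fundamental gm ->
  ~ is_parabolic_negative_part gm cartan_G2 1 ->
  (forall r : nat, (2 <= r)%N -> ~ is_parabolic_negative_part gm (cartan_B r) r) ->
  sub_free gm -> prolongation_rigid gm.
Proof.
move=> gm_s fund hG2 hB hfree; have [n [F gF]] := frame_of_sub_free fund hfree.
apply: (prolongation_rigid_of_frame gm_s gF).
have bounded := graded_frame_bounded gm_s gF.
have [n0|n0] := posnP n.
  by move=> T f _ i; have := ltn_ord i; rewrite {2}n0.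
have n1 := one_step_dim gF fund n0.
have [i [j [k triple]]] : exists i j k, [lie vec F i, [lie vec F j, vec F k]] != 0.
  apply: contrapT => H; apply: (hB n n1); apply: (two_step_parabolic gF fund n1).
  move=> i j k; apply: contrapT => /eqP nz; by apply: H; exists i, j, k.
apply: (first_prolongation_trivial bounded).
have [n2|n2] := ltnP 2 n; first by left; split=> //; exists i, j, k.
have {n1 n2} En : n = 2%N by apply/eqP; rewrite eqn_leq n2.
right; split=> //; subst n; apply: contrapT => H; apply: hG2.
apply: (depth_three_parabolic gF fund); last by exists i, j, k.
move=> a b c d; apply: contrapT => /eqP nz; by apply: H; exists a, b, c, d.
Qed.

Theorem theorem1 (R : realType) (K : fieldType)
    (hK : K = (R : fieldType) \/ K = (R[i] : fieldType))
    (s : nat) (m : finLieAlgType K) (gm : grading m)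
    (hm : gnla gm s) (hfund : fundamental gm)
    (hG2 : ~ is_parabolic_negative_part gm cartan_G2 1)
    (hB : forall r : nat, (2 <= r)%N ->
       ~ is_parabolic_negative_part gm (cartan_B r) r)
    (hfree : sub_free gm) :
  prolongation_rigid gm.
Proof.
case: hK => EK; subst K.
  exact: (@prolongation_rigid_numField R s m gm).
exact: (@prolongation_rigid_numField R[i] s m gm).
Qed.
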